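(* Fix $h>0$, $a\geqslant0$ and an integer $N\geqslant0$. With $X$, $X_{n,k}$, $P_n$ as below, set \[ A(h)=\frac{h}{2\pi}\Bigl(X+\sum_{n=0}^\infty\frac{1}{2^n}\sum_{k=1}^{P_n}X_{n,k}\Bigr),\qquad A_N(h)=\frac{h}{2\pi}\Bigl(X+\sum_{n=0}^N\frac{1}{2^n}\sum_{k=1}^{P_n}X_{n,k}\Bigr). \] Then \[ \mathbb E\,\bigl|A(h)-A_N(h)\bigr|^2=\frac{a^2}{3\cdot2^{N+1}}\Bigl(\frac h2\Bigr)^2 . \] Moreover, writing $\sigma_N=\frac{a}{\sqrt{3\cdot2^{N+1}}}\,\frac h2$, there exists (on a suitable extension of the probability space) a standard Normal random variable $Z$, independent of $A_N(h)$, such that \[ \mathbb E\,\bigl|A(h)-\bigl(A_N(h)+\sigma_N Z\bigr)\bigr|^2\leqslant\frac{8}{15}\,\frac{1}{2^{2N+2}}\Bigl(\frac h2\Bigr)^2 . \]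
   Context: $X$ and $X_{n,k}$ ($n\geqslant0$, $k\geqslant1$) are i.i.d. standard Logistic random variables (density $e^{-x}/(1+e^{-x})^2$, mean $0$, variance $\pi^2/3$); $P_n\sim\mathsf{Poisson}(\tfrac12a^22^n)$ for $n\geqslant0$; all are mutually independent. Empty sums are $0$. By the logistic expansion, $A(h)$ has the conditional distribution of the Lévy area of a two-dimensional Wiener process over a time step $h$ given the increments, with $a^2=((\Delta W^1(h))^2+(\Delta W^2(h))^2)/h$. *)

(* Defs.v *)
From HB Require Import structures.
From mathcomp Require Import all_boot all_order all_algebra.
From mathcomp Require Import all_classical all_reals all_analysis.
Set Implicit Arguments. Unset Strict Implicit. Unset Printing Implicit Defensive.
Import Order.TTheory GRing.Theory Num.Theory.
Import numFieldNormedType.Exports.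
Local Open Scope classical_set_scope.
Local Open Scope ring_scope.

Definition logistic_pdf {R : realType} (x : R) : R :=
  expR (- x) / (1 + expR (- x)) ^+ 2.

Definition logistic_prob {R : realType} : set R -> \bar R :=
  fun V => (\int[@lebesgue_measure R]_(x in V) (logistic_pdf x)%:E)%E.

Definition mutually_independent {d} {T : measurableType d} {R : realType}
  (P : probability T R) (I : eqType) (G : I -> set (set T)) : Prop :=
  forall (s : seq I) (E : I -> set T), uniq s ->
    (forall i, i \in s -> G i (E i)) ->
    P (\big[setI/setT]_(i <- s) E i) = (\prod_(i <- s) P (E i))%E.

(* Index type for the family X, X_{n,k}, P_n :
   None = X ; Some (inl (n,k)) = X_{n,k} ; Some (inr n) = P_n. *)
Definition lidx := option ((nat * nat) + nat)%type.

Definition levents {d} {T : measurableType d} {R : realType}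
  (X : T -> R) (Xnk : nat -> nat -> T -> R) (Pn : nat -> T -> nat)
  (i : lidx) : set (set T) :=
  match i with
  | None => [set X @^-1` B | B in [set B : set R | measurable B]]
  | Some (inl (n, k)) => [set Xnk n k @^-1` B | B in [set B : set R | measurable B]]
  | Some (inr n) => [set Pn n @^-1` U | U in [set: set nat]]
  end.

(* X + sum_{n=0}^N 2^{-n} sum_{k=1}^{P_n} X_{n,k}
   (the inner index k = 1..P_n is re-indexed as k = 0..P_n - 1) *)
Definition lev_partial {T} {R : realType}
  (X : T -> R) (Xnk : nat -> nat -> T -> R) (Pn : nat -> T -> nat)
  (N : nat) (t : T) : R :=
  X t + \sum_(n < N.+1) ((2 ^+ n)^-1 * \sum_(k < Pn n t) Xnk n k t).

Definition levyA_N {T} {R : realType} (h : R)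
  (X : T -> R) (Xnk : nat -> nat -> T -> R) (Pn : nat -> T -> nat)
  (N : nat) (t : T) : R :=
  h / (pi *+ 2) * lev_partial X Xnk Pn N t.

Definition levyA {T} {R : realType} (h : R)
  (X : T -> R) (Xnk : nat -> nat -> T -> R) (Pn : nat -> T -> nat)
  (t : T) : R :=
  h / (pi *+ 2) * limn (fun N => lev_partial X Xnk Pn N t).

(* Main.v *)
Require Import Defs.
From HB Require Import structures.
From mathcomp Require Import all_boot all_order all_algebra.
From mathcomp Require Import all_classical all_reals all_analysis.
From mathcomp Require Import measurable_realfun ring lra.
Set Implicit Arguments. Unset Strict Implicit. Unset Printing Implicit Defensive.
Import Order.TTheory GRing.Theory Num.Theory.
Import numFieldNormedType.Exports.
Local Open Scope classical_set_scope.
Local Open Scope ring_scope.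

(** Put [q = h / (2 pi)]. The error [A - A_N] is [q] times the sum of the levels [n > N], where
    level [n] is [2^-n] times a compound Poisson sum ([row]) with rate [a^2 2^n / 2] and Logistic
    summands. Levels are independent and symmetric, and level [n] has variance
    [4^-n (a^2 2^n / 2) (pi^2 / 3)]. Summing this geometric series over finite blocks and passing to
    the limit by dominated convergence gives the first claim ([truncation_errorE]). The value
    [pi^2 / 3] comes from a recursion between the powers of the Logistic density and the Basel sum
    ([mk1E]).

    For the coupling, the key fact is that a block of levels is a Gaussian scale mixture: it has the
    law of [sqrt S * Z] with [S >= 0] independent of a standard Normal [Z]. Indeed the Logistic
    characteristic function is the product of the [(1 + t^2 / k^2)^-1], the Laplace transform at
    [t^2 / 2] of a sum of independent exponentials ([gauss_mixture_logistic]), and scaling, products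
    and compound Poisson sums preserve such mixtures. Replacing [sqrt S] by the constant [sigma]
    with [sigma^2 = E S] costs [E (sqrt S - sigma)^2 <= Var S / sigma^2]. Since the fourth moment of
    the mixture is [3 E S^2], [Var S] is one third of its fourth cumulant. Fourth cumulants add over
    independent levels and are of order [8^-N], while [sigma^2] is of order [2^-N], whence the rate
    [4^-N].

    An equality of laws must still become a coupling over the given space, with [Z] independent of
    [A_N]. The tail is cut at a level [N + M]; to the resulting block [V] one adds Gaussian noise
    whose variance [e] is that of the discarded levels. The sum [U] has a positive density that can
    be written both from the law of [V] and from the mixing law ([gauss_smoothing]). The original
    sample point and the mixing variable are glued along [U], conditionally independent given [U]
    ([gluing]), and [Z] is [U] divided by its conditional standard deviation ([gauss_coupling]).
    Given the sample point, the law of [Z] depends only on [V], which is independent of [A_N]; hence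
    so is [Z].

    The crude bound [E X^4 <= 6 (E X^2)^2] for a Logistic [X] ([qk1_le]) yields the constant
    [8 / 21]. The gap up to [8 / 15] absorbs the two errors of size [e], which are small for large
    [M] ([normal_approx_gt0]). For [a = 0] the error vanishes and any independent Normal serves
    ([normal_approx0]). *)

(** * Decaying functions on the line and integrals of derivatives over it *)

Section realline.
Context {R : realType}.
Notation mu := (@lebesgue_measure R).
Implicit Types (f g F : R -> R).

(** One polynomial scale for all integrability questions: order [1] already gives integrability and
    vanishing at infinity, and multiplication by [x] costs one order. *)
Definition decay (n : nat) f :=
  exists C : R, forall x, `|f x| <= C / (1 + x ^+ 2) ^+ n.

Lemma oneDsq_gt0 (x : R) : 0 < 1 + x ^+ 2.
Proof. by rewrite ltr_pwDl// sqr_ge0. Qed.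

Lemma integrable_oneDsqV :
  mu.-integrable setT (fun x : R => ((1 + x ^+ 2)^-1)%:E).
Proof.
have m : measurable_fun [set: R] (EFin \o (fun x : R => (1 + x ^+ 2)^-1)).
  apply/measurable_EFinP; apply: continuous_measurable_fun.
  exact: continuous_oneDsqrV.
apply/integrableP; split => //.
under eq_integral => x _ do rewrite /= ger0_norm ?invr_ge0 ?ltW ?oneDsq_gt0//.
rewrite (ge0_symfun_integralT (f := fun x : R => (1 + x ^+ 2)^-1)).
- have := @integral0y_oneDsqr R; rewrite /oneDsqr set_itvcy => ->.
  by rewrite -EFinM ltry.
- by move=> x; rewrite invr_ge0 ltW// oneDsq_gt0.
- exact: continuous_oneDsqrV.
- by move=> x /=; rewrite sqrrN.
Qed.

Lemma integrable_decay f : continuous f -> decay 1 f ->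
  mu.-integrable setT (EFin \o f).
Proof.
move=> cf [C fC].
apply: (@le_integrable _ _ _ mu _ measurableT _
  (fun x => (C * (1 + x ^+ 2)^-1)%:E)).
- by apply/measurable_EFinP; exact: continuous_measurable_fun.
- move=> x _ /=; rewrite lee_fin (le_trans (fC x))//.
  by rewrite expr1 ler_norm.
- by under eq_fun do rewrite EFinM; apply: integrableZl => //;
    exact: integrable_oneDsqV.
Qed.

Lemma decayS n m f : (m <= n)%N -> decay n f -> decay m f.
Proof.
move=> mn [C fC]; exists C => x; apply: le_trans (fC x) _.
have C0 : 0 <= C.
  have := le_trans (normr_ge0 _) (fC x).
  by rewrite pmulr_lge0// invr_gt0 exprn_gt0// oneDsq_gt0.
rewrite ler_wpM2l// lef_pV2 ?posrE ?exprn_gt0 ?oneDsq_gt0//.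
by rewrite ler_weXn2l// lerDl sqr_ge0.
Qed.

Lemma decayD n f g : decay n f -> decay n g -> decay n (fun x => f x + g x).
Proof.
move=> [C fC] [D gD]; exists (C + D) => x; rewrite mulrDl.
by rewrite (le_trans (ler_normD _ _))// lerD.
Qed.

Lemma decayZ n c f : decay n f -> decay n (fun x => c * f x).
Proof.
move=> [C fC]; exists (`|c| * C) => x.
by rewrite normrM -mulrA ler_wpM2l.
Qed.

Lemma decayN n f : decay n f -> decay n (fun x => - f x).
Proof. by move=> [C fC]; exists C => x; rewrite normrN. Qed.

Lemma decayB n f g : decay n f -> decay n g -> decay n (fun x => f x - g x).
Proof. by move=> ? ?; apply: decayD => //; exact: decayN. Qed.

Lemma decay_bM n (M : R) f g : (forall x, `|f x| <= M) -> decay n g ->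
  decay n (fun x => f x * g x).
Proof.
move=> fM [C gC]; exists (M * C) => x.
by rewrite normrM -mulrA ler_pM.
Qed.

Lemma decay_XM n f : decay n.+1 f -> decay n (fun x => x * f x).
Proof.
move=> [C fC]; exists C => x.
rewrite normrM; apply: (@le_trans _ _ ((1 + x ^+ 2) * (C / (1 + x ^+ 2) ^+ n.+1))).
  apply: ler_pM => //.
  by rewrite ler_norml; apply/andP; split; nra.
have := oneDsq_gt0 x; move: (1 + x ^+ 2) => y y0.
by rewrite exprS invfM mulrCA (mulrA y) mulfV ?mul1r// gt_eqF.
Qed.

Lemma decay_cvg0 f : decay 1 f ->
  f n%:R @[n --> \oo] --> (0 : R) /\ f (- n%:R) @[n --> \oo] --> (0 : R).
Proof.
move=> [C fC].
have h : C / (1 + n%:R ^+ 2) ^+ 1 @[n --> \oo] --> (0 : R).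
  rewrite -(mulr0 C); apply: cvgM; first exact: cvg_cst.
  apply/gtr0_cvgV0; first by near=> n; rewrite expr1 oneDsq_gt0.
  apply: ger_cvgy (cvgr_idn) => //.
  near=> n; rewrite expr1; have := sqr_ge0 (n%:R - 1 : R); nra.
have hN := cvgN h; rewrite oppr0 in hN.
split; apply: (squeeze_cvgr _ (hN _) h); near=> n; rewrite /= -ler_norml.
  exact: fC.
by rewrite (le_trans (fC _))// sqrrN.
Unshelve. all: by end_near. Qed.

(** The fundamental theorem of calculus on the intervals [[-(n+1), n+1]], followed by dominated
    convergence with [|g|] as the bound; integrability of [g] is what [decay 1] provides. *)
Lemma integral_derive_cvg F g (l : R) :
  (forall x : R, is_derive x (1 : R) F (g x)) -> continuous g -> decay 1 g ->
  F n%:R @[n --> \oo] --> l -> F (- n%:R) @[n --> \oo] --> (0 : R) ->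
  (\int[mu]_x (g x)%:E = l%:E)%E.
Proof.
move=> Fg cg dg h1 h2.
have ig := integrable_decay cg dg.
have mg : measurable_fun [set: R] (EFin \o g) by case/integrableP : ig.
pose g_ (n : nat) : R -> \bar R := (EFin \o g) \_ `[- n.+1%:R, n.+1%:R].
have [_ _ h] : [/\ mu.-integrable setT (EFin \o g),
  (\int[mu]_x `|g_ n x - (EFin \o g) x|)%E @[n --> \oo] --> (0%:E : \bar R) &
  (\int[mu]_x g_ n x)%E @[n --> \oo] --> (\int[mu]_x (EFin \o g) x)%E].
  apply: (@dominated_convergence _ _ _ mu _ measurableT g_ (EFin \o g)
    (abse \o (EFin \o g))) => //.
  - move=> n; apply/measurable_restrict => //.
    by rewrite setTI; exact: measurable_funS mg.
  - apply: aeW => x _; apply: cvg_near_cst; near=> n.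
    rewrite /g_ patchE mem_set//= in_itv/= -ler_norml.
    rewrite (@le_trans _ _ n%:R) ?ler_nat//.
    near: n; exact: nbhs_infty_ger.
  - exact: integrable_abse.
  - apply: aeW => x n _; rewrite /g_ patchE; case: ifPn => // _.
    by rewrite abse0 abse_ge0.
have hn n : (\int[mu]_x g_ n x = (F n.+1%:R - F (- n.+1%:R))%:E)%E.
  rewrite -integral_mkcond EFinB.
  apply: continuous_FTC2 => //.
  - by rewrite gtrN// ltr0n.
  - exact: continuous_subspaceT.
  - have cF x : {for x, continuous F}.
      by apply: differentiable_continuous; apply/derivable1_diffP; case: (Fg x).
    split => [x _||]; first by case: (Fg x).
      exact/cvg_at_right_filter/cF.
    exact/cvg_at_left_filter/cF.
  - by move=> x _; rewrite derive1E; case: (Fg x).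
have h3 : (F n.+1%:R - F (- n.+1%:R))%:E @[n --> \oo] --> (l%:E : \bar R).
  apply: cvg_EFin; first by near=> n.
  rewrite -(subr0 l) /comp /=; apply: cvgB.
    by move: h1; rewrite -(cvg_shiftS (fun n => F n%:R)).
  by move: h2; rewrite -(cvg_shiftS (fun n => F (- n%:R))).
rewrite -(eq_cvg _ _ hn) in h3.
have := cvg_lim (@ereal_hausdorff R) h.
by rewrite (@cvg_lim _ (@ereal_hausdorff R) _ _ _ _ (l%:E : \bar R) h3) => <-.
Unshelve. all: by end_near. Qed.

Lemma integral_derive_decay F g : (forall x : R, is_derive x (1 : R) F (g x)) ->
  continuous g -> decay 1 g -> decay 1 F -> (\int[mu]_x (g x)%:E = 0)%E.
Proof.
by move=> Fg cg dg /decay_cvg0[h1 h2]; exact: integral_derive_cvg h1 h2.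
Qed.

End realline.

(** * Affine change of variables and the centred Gaussian density *)

Definition pushm {d d'} {T1 : measurableType d} {T2 : measurableType d'}
    {R : realType} (m : {measure set T1 -> \bar R}) (f : T1 -> T2)
    (mf : measurable_fun setT f) : {measure set T2 -> \bar R} :=
  measure_function_pushforward__canonical__measure_function_Measure m mf.

Section gaussian.
Context {R : realType}.
Notation mu := (@lebesgue_measure R).

(** Pushing Lebesgue measure forward along [x |-> (x - m) / c] multiplies the length of half-open
    intervals by [c], and Lebesgue measure is determined by these lengths. *)
Lemma ge0_integral_affine (c m : R) (f : R -> \bar R) : 0 < c ->
  measurable_fun setT f -> (forall x, 0 <= f x)%E ->
  (\int[mu]_x f ((x - m) / c)%R = c%:E * \int[mu]_x f x)%E.
Proof.
move=> c0 mf f0.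
have mg : measurable_fun setT (fun x : R => (x - m) / c).
  by apply: measurable_funM => //; exact: measurable_funB.
pose c' : {nonneg R} := NngNum (ltW c0).
have H A : measurable A -> mscale c' mu A = pushm (T2 := measurableTypeR R) mu mg A.
  move=> mA; rewrite {1}/mscale/=.
  have cV0 : 0 <= c^-1 by rewrite invr_ge0 ltW.
  pose m' : {measure set (measurableTypeR R) -> \bar R} :=
    mscale (NngNum cV0) (pushm (T2 := measurableTypeR R) mu mg).
  have -> : mu A = m' A.
    apply: lebesgue_measure_unique => // I [[a b]]/= _ <-.
    rewrite {}/m'.
    rewrite /mscale/= /pushm/= /pushforward.
    have -> : (fun x : R => (x - m) / c) @^-1` `]a, b]%classic = `](c * a + m), (c * b + m)]%classic.
      apply/seteqP; split => x /=; rewrite !in_itv/=.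
        by rewrite ltr_pdivlMr// ler_pdivrMr// ltrBrDr lerBlDr (mulrC c) (mulrC c).
      by rewrite ltr_pdivlMr// ler_pdivrMr// ltrBrDr lerBlDr (mulrC c) (mulrC c).
    rewrite !lebesgue_measure_itv/= !lte_fin ltrD2r ltr_pM2l//.
    case: ifPn => _; last by rewrite mule0.
    rewrite -EFinD -EFinM; congr (_%:E).
    by field; rewrite gt_eqF.
  rewrite /mscale/= muleA -EFinM mulfV ?gt_eqF// mul1e//.
rewrite -(@ge0_integral_mscale _ _ R mu setT measurableT c' f)//.
rewrite [RHS](@eq_measure_integral _ _ _ _
  (pushm (T2 := measurableTypeR R) mu mg)).
  by rewrite /pushm/= ge0_integral_pushforward.
by move=> A mA _; exact: H.
Qed.

Lemma ge0_integral_shift (m : R) (f : R -> \bar R) :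
  measurable_fun setT f -> (forall x, 0 <= f x)%E ->
  (\int[mu]_x f (x - m)%R = \int[mu]_x f x)%E.
Proof.
move=> mf f0; rewrite -[RHS]mul1e -(ge0_integral_affine m ltr01)//.
by under [RHS]eq_integral do rewrite divr1.
Qed.

(** The inverse is discontinuous at [0], so it is rewritten as [y * expR (- ln (y ^+ 2))], which
    also has the value [0] at [y = 0]. *)
Lemma measurable_funV d (T : measurableType d) (f : T -> R) :
  measurable_fun setT f -> measurable_fun setT (fun t => (f t)^-1).
Proof.
move=> mf; rewrite (_ : (fun t => _) = (fun t => f t * expR (- ln (f t ^+ 2)))).
  apply: measurable_funM => //; apply: measurableT_comp => //.
  apply: measurableT_comp => //; apply: measurableT_comp => //.
  exact: measurable_funX.
apply/funext => t; have [->|f0] := eqVneq (f t) 0; first by rewrite invr0 mul0r.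
by rewrite expRN lnK ?posrE ?exprn_even_gt0// expr2 invfM mulrA mulfV// mul1r.
Qed.

(** The parameter [s] is the variance, not the standard deviation: variances add and will themselves
    be integrated out, which needs joint measurability in both arguments. *)
Definition gpdf (s x : R) : R :=
  (Num.sqrt (2 * pi * s))^-1 * expR (- (x ^+ 2) / (2 * s)).

Lemma gpdf_ge0 (s x : R) : 0 <= gpdf s x.
Proof. by rewrite mulr_ge0 ?expR_ge0// invr_ge0. Qed.

Lemma gpdf_gt0 (s x : R) : 0 < s -> 0 < gpdf s x.
Proof.
move=> s0; rewrite mulr_gt0 ?expR_gt0// invr_gt0 sqrtr_gt0.
by rewrite !mulr_gt0// pi_gt0.
Qed.

Lemma gpdfE (s x : R) : 0 < s -> gpdf s x = normal_pdf 0 (Num.sqrt s) x.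
Proof.
move=> s0; rewrite normal_pdfE ?gt_eqF ?sqrtr_gt0//.
rewrite /normal_peak /normal_fun subr0 sqr_sqrtr ?ltW//.
rewrite -(mulr_natl s 2) (_ : s * pi *+ 2 = 2 * pi * s)//.
by rewrite -mulr_natl mulrA (mulrAC 2 s).
Qed.

Lemma measurable_gpdf : measurable_fun setT (fun p : R * R => gpdf p.1 p.2).
Proof.
have mM (c : R) : measurable_fun setT (fun p : R * R => c * p.1).
  by apply: measurable_funM => //; exact: measurable_fst.
apply: measurable_funM.
  apply: measurable_funV; apply: (measurableT_comp _ (mM (2 * pi))).
  exact: (continuous_measurable_fun (@sqrt_continuous R)).
apply: measurableT_comp => //.
apply: (measurable_funM (f := fun p : R * R => - p.2 ^+ 2)).
  apply: measurableT_comp => //; apply: measurable_funX.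
  exact: measurable_snd.
exact: measurable_funV (mM 2).
Qed.

Lemma integral_gpdf (s : R) : 0 < s -> (\int[mu]_x (gpdf s x)%:E = 1)%E.
Proof.
move=> s0; under eq_integral do rewrite gpdfE//.
exact: integral_normal_pdf.
Qed.

Lemma is_derive_gpdf (s x : R) : 0 < s ->
  is_derive x (1 : R) (gpdf s) (- (x / s) * gpdf s x).
Proof.
move=> s0; rewrite /gpdf.
have e : is_derive x (1 : R) (fun x => expR (- (x ^+ 2) / (2 * s)))
   (- (x / s) * expR (- (x ^+ 2) / (2 * s))).
  have h : is_derive x (1 : R) (fun x : R => - (x ^+ 2) / (2 * s)) (- (x / s)).
    apply: is_derive_eq; rewrite /GRing.scale/=.
    by field; rewrite gt_eqF.
  by apply: is_derive_eq (is_derive1_comp _ _) _; rewrite mulrC.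
by apply: is_derive_eq; rewrite /GRing.scale/= mulrCA.
Qed.

Lemma continuous_gpdf (s : R) : 0 < s -> continuous (gpdf s).
Proof.
move=> s0 x; apply: differentiable_continuous; apply/derivable1_diffP.
by case: (is_derive_gpdf x s0).
Qed.

(** The exponential is the [(n+1)]-st power of [expR (x ^+ 2 / c)] with [c = 2 s (n+1)], and each
    factor is at least [1 + x ^+ 2 / c]. *)
Lemma decay_gpdf n (s : R) : 0 < s -> decay n.+1 (gpdf s).
Proof.
move=> s0; pose c : R := 2 * s * n.+1%:R.
have c0 : 0 < c by rewrite !mulr_gt0.
exists ((Num.sqrt (2 * pi * s))^-1 * (1 + c) ^+ n.+1) => x.
rewrite ger0_norm ?gpdf_ge0// /gpdf -[leRHS]mulrA ler_wpM2l ?invr_ge0//.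
have y0 := oneDsq_gt0 x.
rewrite ler_pdivlMr ?exprn_gt0// mulNr expRN mulrC ler_pdivrMr ?expR_gt0//.
have -> : x ^+ 2 / (2 * s) = (x ^+ 2 / c) * n.+1%:R.
  have k0 : n.+1%:R != 0 :> R by rewrite pnatr_eq0.
  by rewrite /c; move: n.+1%:R k0 => k k0; field; rewrite k0 gt_eqF.
rewrite expRM_natr -exprMn ler_pXn2r ?nnegrE//; last 2 first.
- exact: ltW.
- by rewrite mulr_ge0 ?expR_ge0// addr_ge0// ltW.
apply: le_trans (_ : (1 + c) * (1 + x ^+ 2 / c) <= _); last first.
  by rewrite ler_wpM2l ?expR_ge1Dx// addr_ge0// ltW.
have -> : (1 + c) * (1 + x ^+ 2 / c) = 1 + x ^+ 2 + c + x ^+ 2 / c.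
  by field; rewrite gt_eqF.
rewrite -addrA lerDl addr_ge0//; first exact: ltW.
by rewrite divr_ge0 ?sqr_ge0// ltW.
Qed.

End gaussian.

(** * Gaussian moments, characteristic function and Fourier inversion *)

Section gaussian2.
Context {R : realType}.
Notation mu := (@lebesgue_measure R).

Lemma is_derive_continuous (f g : R -> R) :
  (forall x : R, is_derive x (1 : R) f (g x)) -> continuous f.
Proof.
move=> h x; apply: differentiable_continuous; apply/derivable1_diffP.
by case: (h x).
Qed.

Lemma is_derive_cosM (t x : R) :
  is_derive x (1 : R) (fun x => cos (t * x)) (- t * sin (t * x)).
Proof.
have h : is_derive x (1 : R) (fun x : R => t * x) t.
  by apply: is_derive_eq; rewrite /GRing.scale/=; ring.
by apply: is_derive_eq (is_derive1_comp _ _) _; rewrite mulNr mulrC mulNr.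
Qed.

Lemma is_derive_sinM (t x : R) :
  is_derive x (1 : R) (fun x => sin (t * x)) (t * cos (t * x)).
Proof.
have h : is_derive x (1 : R) (fun x : R => t * x) t.
  by apply: is_derive_eq; rewrite /GRing.scale/=; ring.
by apply: is_derive_eq (is_derive1_comp _ _) _; rewrite mulrC.
Qed.

Lemma continuous_cosM (t : R) : continuous (fun x => cos (t * x)).
Proof. exact: is_derive_continuous (is_derive_cosM t). Qed.

Lemma continuous_sinM (t : R) : continuous (fun x => sin (t * x)).
Proof. exact: is_derive_continuous (is_derive_sinM t). Qed.

Lemma norm_cos_le1 (x : R) : `|cos x| <= 1.
Proof. by rewrite ler_norml cos_geN1 cos_le1. Qed.

Lemma norm_sin_le1 (x : R) : `|sin x| <= 1.
Proof. by rewrite ler_norml sin_geN1 sin_le1. Qed.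

Lemma integral_cst_gpdf (s c : R) : 0 < s ->
  (\int[mu]_x (c * gpdf s x)%:E = c%:E)%E.
Proof.
move=> s0; under eq_integral do rewrite EFinM.
rewrite integralZl//; first by rewrite integral_gpdf// mule1.
apply: (integrable_decay (f := gpdf s)); first exact: continuous_gpdf.
  exact: (decay_gpdf 0 s0).
Qed.

Lemma gpdf_poly_decay (s c0 c1 c2 c3 c4 : R) : 0 < s ->
  decay 1 (fun y =>
    (c0 + c1 * y + c2 * y ^+ 2 + c3 * y ^+ 3 + c4 * y ^+ 4) * gpdf s y).
Proof.
move=> s0; have d0 := decay_gpdf 4 s0.
have d1 := decay_XM d0; have d2 := decay_XM d1.
have d3 := decay_XM d2; have d4 := decay_XM d3.
have := decayD (decayD (decayD (decayD (decayZ c0 (decayS (isT : 1 <= 5)%N d0))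
  (decayZ c1 (decayS (isT : 1 <= 4)%N d1)))
  (decayZ c2 (decayS (isT : 1 <= 3)%N d2)))
  (decayZ c3 (decayS (isT : 1 <= 2)%N d3)))
  (decayZ c4 (decayS (isT : 1 <= 1)%N d4)).
by congr decay; apply/funext => y; ring.
Qed.

Lemma gpdf_poly_continuous (s c0 c1 c2 c3 c4 : R) : 0 < s ->
  continuous (fun y =>
    (c0 + c1 * y + c2 * y ^+ 2 + c3 * y ^+ 3 + c4 * y ^+ 4) * gpdf s y).
Proof.
move=> s0 x; apply: cvgM; last exact: continuous_gpdf.
have cX n (c : R) : c * y ^+ n @[y --> x] --> c * x ^+ n.
  by apply: cvgM; [exact: cvg_cst|exact: exprn_continuous].
apply: cvgD (cX 4%N c4); apply: cvgD (cX 3%N c3); apply: cvgD (cX 2%N c2).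
by apply: cvgD (cX 1%N c1); exact: cvg_cst.
Qed.

(** Stein's identity: for [r y = c0 + c1 y + c2 y^2 + c3 y^3], the function [(s r' - y r) gpdf] is
    the derivative of [s r gpdf] and integrates to [0]. A polynomial of the form [m + s r' - y r]
    therefore has Gaussian mean [m]. *)
Lemma gpdf_poly_integral (s c0 c1 c2 c3 m : R) (p : R -> R) : 0 < s ->
  (forall y, p y = m + (c1 * s + c2 * s * 2 * y + c3 * s * 3 * y ^+ 2)
    - (c0 * y + c1 * y ^+ 2 + c2 * y ^+ 3 + c3 * y ^+ 4)) ->
  (\int[mu]_y (p y * gpdf s y)%:E = m%:E)%E.
Proof.
move=> s0 pE.
pose F y := (c0 * s + c1 * s * y + c2 * s * y ^+ 2 + c3 * s * y ^+ 3 + 0 * y ^+ 4) * gpdf s y.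
pose g y := (c1 * s + (c2 * s * 2 - c0) * y + (c3 * s * 3 - c1) * y ^+ 2
  + (- c2) * y ^+ 3 + (- c3) * y ^+ 4) * gpdf s y.
have Fg (x : R) : is_derive x (1 : R) F (g x).
  have h := is_derive_gpdf x s0.
  have hp : is_derive x (1 : R) (fun y => c0 * s + c1 * s * y + c2 * s * y ^+ 2 + c3 * s * y ^+ 3 + 0 * y ^+ 4)
    (c1 * s + c2 * s * 2 * x + c3 * s * 3 * x ^+ 2).
    by apply: is_derive_eq; rewrite /GRing.scale/=; ring.
  apply: is_derive_eq; rewrite /GRing.scale/= /g.
  by field; rewrite gt_eqF.
have cg : continuous g by exact: gpdf_poly_continuous.
have dg : decay 1 g by exact: gpdf_poly_decay.
have := integral_derive_decay Fg cg dg (gpdf_poly_decay _ _ _ _ _ s0).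
have -> : (fun y => (p y * gpdf s y)%:E) = (fun y => (g y)%:E + (m * gpdf s y)%:E)%E.
  by apply/funext => y; rewrite -EFinD /g pE; congr EFin; ring.
move=> I0; rewrite integralD//; first by rewrite I0 add0e integral_cst_gpdf.
  exact: (integrable_decay cg dg).
apply: (integrable_decay (f := fun y => m * gpdf s y)).
  by move=> x; apply: cvgM; [exact: cvg_cst|exact: continuous_gpdf].
by apply: decayZ; exact: decay_gpdf.
Qed.

Lemma gpdf_moment2 (s v : R) : 0 < s ->
  (\int[mu]_y ((v + y) ^+ 2 * gpdf s y)%:E = (v ^+ 2 + s)%:E)%E.
Proof.
move=> s0; apply: (@gpdf_poly_integral s (- 2 * v) (-1) 0 0 _ (fun y => (v + y) ^+ 2)) => // y.
by ring.
Qed.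

Lemma gpdf_moment4 (s v : R) : 0 < s ->
  (\int[mu]_y ((v + y) ^+ 4 * gpdf s y)%:E
     = (v ^+ 4 + 6 * v ^+ 2 * s + 3 * s ^+ 2)%:E)%E.
Proof.
move=> s0; apply: (@gpdf_poly_integral s (- 4 * v ^+ 3 - 8 * v * s)
  (- 6 * v ^+ 2 - 3 * s) (- 4 * v) (-1) _ (fun y => (v + y) ^+ 4)) => // y.
by ring.
Qed.

Lemma integrable_cos_gpdf (s t : R) : 0 < s ->
  mu.-integrable setT (EFin \o (fun x => cos (t * x) * gpdf s x)).
Proof.
move=> s0; apply: integrable_decay.
  by move=> x; apply: cvgM; [exact: continuous_cosM|exact: continuous_gpdf].
by apply: (decay_bM (M := 1)) (decay_gpdf 0 s0) => x; exact: norm_cos_le1.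
Qed.

(** Differentiating under the integral and integrating by parts gives [F' = - s t F], so that
    [F t * expR (s t^2 / 2)] is constant, equal to [F 0 = 1]. *)
Lemma Rintegral_cos_gpdf (s t : R) : 0 < s ->
  \int[mu]_x (cos (t * x) * gpdf s x) = expR (- (s * t ^+ 2 / 2)).
Proof.
move=> s0.
pose F t := \int[mu]_x (cos (t * x) * gpdf s x).
pose f (t x : R) := cos (t * x) * gpdf s x.
have f1 (u x : R) : is_derive u (1 : R) (f ^~ x) (- (x * gpdf s x) * sin (u * x)).
  have := is_derive_cosM x u.
  under eq_fun do rewrite mulrC.
  by move=> h; apply: is_derive_eq; rewrite /GRing.scale/= (mulrC u x); ring.
have f1E (u x : R) : partial1of2 f u x = - (x * gpdf s x) * sin (u * x).
  by rewrite partial1of2E; case: (f1 u x).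
have dG := decay_XM (decay_gpdf 1 s0).
have cG : continuous (fun x : R => x * gpdf s x).
  by move=> x; apply: cvgM; [exact: cvg_id|exact: continuous_gpdf].
have dF (u : R) : is_derive u (1 : R) F (- (s * u) * F u).
  have iG : mu.-integrable setT (EFin \o (fun x => `|x * gpdf s x|)).
    have := integrable_abse (integrable_decay cG dG).
    by under eq_fun do rewrite /=.
  have uI : `]u - 1, u + 1[%classic u by rewrite /= in_itv/=; apply/andP; split; lra.
  have hI x : `]u - 1, u + 1[%classic x -> mu.-integrable setT (EFin \o f x).
    by move=> _; exact: integrable_cos_gpdf.
  have hd x y : `]u - 1, u + 1[%classic x -> setT y -> derivable (f ^~ y) x 1.
    by move=> _ _; case: (f1 x y).
  have hG x y : `]u - 1, u + 1[%classic x -> setT y ->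
      `|partial1of2 f x y| <= `|y * gpdf s y|.
    by move=> _ _; rewrite f1E normrM normrN ler_piMr// norm_sin_le1.
  have G0 (y : R) : 0 <= `|y * gpdf s y| by [].
  have d1 := derivable_under_integral measurableT uI hI hd G0 iG hG.
  have d2 := differentiation_under_integral measurableT uI hI hd G0 iG hG.
  apply: DeriveDef; first exact: d1.
  rewrite -derive1E d2.
  under eq_Rintegral do rewrite f1E.
  (* The boundary term of the integration by parts: its derivative is
     [s u cos (u x) gpdf - x sin (u x) gpdf], whose integral vanishes. *)
  pose H x := s * (sin (u * x) * gpdf s x).
  have Hd (x : R) : is_derive x (1 : R) H
      (s * u * (cos (u * x) * gpdf s x) + - (x * gpdf s x) * sin (u * x)).
    have h1 := is_derive_gpdf x s0; have h2 := is_derive_sinM u x.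
    rewrite /H; apply: is_derive_eq; rewrite /GRing.scale/=.
    by field; rewrite gt_eqF.
  have i1 := integrable_cos_gpdf u s0.
  have i2 : mu.-integrable setT (EFin \o (fun x => - (x * gpdf s x) * sin (u * x))).
    apply: integrable_decay.
      move=> x; apply: cvgM; last exact: continuous_sinM.
      by apply: cvgN; exact: cG.
    have := decay_bM (f := fun x => sin (u * x)) (fun x => norm_sin_le1 (u * x)) (decayN dG).
    by congr decay; apply/funext => x; rewrite mulrC.
  have i3 : mu.-integrable setT (EFin \o (fun x => s * u * (cos (u * x) * gpdf s x))).
    exact: (integrableZl measurableT (s * u) i1).
  have cH : continuous (fun x : R => s * u * (cos (u * x) * gpdf s x) + - (x * gpdf s x) * sin (u * x)).
    move=> x; apply: cvgD; apply: cvgM.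
    - exact: cvg_cst.
    - by apply: cvgM; [exact: continuous_cosM|exact: continuous_gpdf].
    - by apply: cvgN; exact: cG.
    - exact: continuous_sinM.
  have dH : decay 1 (fun x => s * u * (cos (u * x) * gpdf s x) + - (x * gpdf s x) * sin (u * x)).
    apply: decayD.
      apply: decayZ; apply: (decay_bM (M := 1)) (decay_gpdf 0 s0) => x.
      exact: norm_cos_le1.
    have := decay_bM (f := fun x => sin (u * x)) (fun x => norm_sin_le1 (u * x)) (decayN dG).
    by congr decay; apply/funext => x; rewrite mulrC.
  have dH0 : decay 1 H.
    apply: decayZ; apply: (decay_bM (M := 1)) (decay_gpdf 0 s0) => x.
    exact: norm_sin_le1.
  have := integral_derive_decay Hd cH dH dH0.
  move/(congr1 fine); rewrite -/(Rintegral mu setT _) /= RintegralD//.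
  rewrite RintegralZl// -/(F u) => /eqP; rewrite addrC addr_eq0 => /eqP ->.
  by rewrite mulNr.
pose K u := F u * expR (s * u ^+ 2 / 2).
have dK (u : R) : is_derive u (1 : R) K 0.
  have h := dF u.
  have he : is_derive u (1 : R) (fun u => expR (s * u ^+ 2 / 2)) (s * u * expR (s * u ^+ 2 / 2)).
    have h1 : is_derive u (1 : R) (fun u : R => s * u ^+ 2 / 2) (s * u).
      by apply: is_derive_eq; rewrite /GRing.scale/=; field.
    by apply: is_derive_eq (is_derive1_comp _ _) _; rewrite mulrC.
  rewrite /K; apply: is_derive_eq; rewrite /GRing.scale/=; ring.
have := is_derive_0_is_cst t 0 dK.
rewrite /K expr0n/= mulr0 mul0r expR0 mulr1.
have -> : F 0 = 1.
  rewrite /F /Rintegral; under eq_integral do rewrite mul0r cos0 mul1r.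
  by rewrite integral_gpdf.
have e0 : expR (s * t ^+ 2 / 2) != 0 by rewrite expR_eq0.
by move=> h; apply: (mulIf e0); rewrite expRN mulVf.
Qed.

(** Up to a constant, [expR (- (s t^2 / 2))] is the Gaussian density of variance [s^-1] in [t],
    whose characteristic function is already computed. *)
Lemma gpdf_Fourier (s y : R) : 0 < s ->
  \int[mu]_t (cos (y * t) * expR (- (s * t ^+ 2 / 2))) = 2 * pi * gpdf s y.
Proof.
move=> s0; have sV0 : 0 < s^-1 by rewrite invr_gt0.
have pi0 := pi_gt0 R.
have E (t : R) : cos (y * t) * expR (- (s * t ^+ 2 / 2)) =
    Num.sqrt (2 * pi / s) * (cos (y * t) * gpdf s^-1 t).
  have eE : - (t ^+ 2) / (2 * s^-1) = - (s * t ^+ 2 / 2).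
    by field; rewrite gt_eqF.
  rewrite /gpdf eE.
  have : Num.sqrt (2 * pi / s) != 0 by rewrite gt_eqF// sqrtr_gt0 !mulr_gt0.
  move: (Num.sqrt _) (expR _) (cos _) => A e c A0.
  by rewrite mulrCA (mulrA A) mulfV// mul1r.
under eq_Rintegral do rewrite E.
rewrite RintegralZl//; last exact: integrable_cos_gpdf.
rewrite Rintegral_cos_gpdf// /gpdf [RHS]mulrA; congr (_ * _); last first.
  by congr expR; field; rewrite gt_eqF.
have p2 : 0 <= 2 * pi :> R by rewrite mulr_ge0 ?pi_ge0.
rewrite !(sqrtrM _ p2) sqrtrV ?ltW// -[X in _ = X * _](sqr_sqrtr p2).
have : Num.sqrt s != 0 by rewrite gt_eqF// sqrtr_gt0.
have : Num.sqrt (2 * pi) != 0 :> R by rewrite gt_eqF// sqrtr_gt0 mulr_gt0.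
move: (Num.sqrt s) (Num.sqrt _) => A B A0 B0.
by field; rewrite A0 B0.
Qed.

End gaussian2.

(** * Elementary bounds on sine and cosine *)

Section trig_bounds.
Context {R : realType}.

Lemma norm_sin_le (y : R) : `|sin y| <= `|y|.
Proof.
wlog y0 : y / 0 < y => [h|].
  have [/h//|y0|<-] := ltgtP 0 y; last by rewrite sin0.
  by rewrite -normrN -sinN -(normrN y) h// oppr_gt0.
have cs : {within `[0, y], continuous (@sin R)}.
  by apply: continuous_subspaceT => x; exact: continuous_sin.
have [c _] := MVT y0 (fun x _ => is_derive_sin x) cs.
rewrite sin0 !subr0 => ->; rewrite normrM ler_piMl//; exact: norm_cos_le1.
Qed.

Lemma cos_ge (y : R) : 1 - cos y <= y ^+ 2 / 2.
Proof.
have -> : 1 - cos y = 2 * sin (y / 2) ^+ 2.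
  have := cosD (y / 2) (y / 2); rewrite -splitr => ->.
  by have := cos2Dsin2 (y / 2); nra.
have : `|sin (y / 2)| ^+ 2 <= `|y / 2| ^+ 2.
  by rewrite ler_sqr ?nnegrE// norm_sin_le.
rewrite !real_normK ?num_real// => h.
apply: (@le_trans _ _ (2 * (y / 2) ^+ 2)); first by rewrite ler_wpM2l.
by rewrite (_ : 2 * (y / 2) ^+ 2 = y ^+ 2 / 2)//; field.
Qed.

End trig_bounds.

(** * The Logistic density and the derivatives of its powers *)

Section logistic.
Context {R : realType}.
Notation mu := (@lebesgue_measure R).
Local Notation f := (@logistic_pdf R).

(** The Logistic distribution function; the density is [sigmoid * (1 - sigmoid)], which makes all
    derivatives polynomial in [sigmoid]. *)
Definition sigmoid (x : R) : R := (1 + expR (- x))^-1.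

Lemma sigmoid_denom_gt0 (x : R) : 0 < 1 + expR (- x).
Proof. by rewrite addr_gt0// expR_gt0. Qed.

Lemma is_derive_expRN (x : R) :
  is_derive x (1 : R) (fun x => expR (- x)) (- expR (- x)).
Proof.
have h : is_derive x (1 : R) (fun x : R => - x) (- 1) by exact: is_deriveNid.
by apply: is_derive_eq (is_derive1_comp _ _) _; rewrite mulrN1.
Qed.

Lemma logistic_pdfE (x : R) : f x = sigmoid x * (1 - sigmoid x).
Proof.
rewrite /logistic_pdf /sigmoid; have := sigmoid_denom_gt0 x.
by move=> ?; field; rewrite gt_eqF.
Qed.

Lemma logistic_pdf_gt0 (x : R) : 0 < f x.
Proof. by rewrite divr_gt0 ?expR_gt0// exprn_gt0// sigmoid_denom_gt0. Qed.

Lemma logistic_pdf_ge0 (x : R) : 0 <= f x.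
Proof. exact/ltW/logistic_pdf_gt0. Qed.

Lemma sigmoid_gt0 (x : R) : 0 < sigmoid x.
Proof. by rewrite invr_gt0 sigmoid_denom_gt0. Qed.

Lemma sigmoid_lt1 (x : R) : sigmoid x < 1.
Proof. by rewrite invf_lt1 ?sigmoid_denom_gt0// ltrDl expR_gt0. Qed.

Lemma is_derive_sigmoid (x : R) : is_derive x (1 : R) sigmoid (f x).
Proof.
have h := is_derive_expRN x.
have h1 : is_derive x (1 : R) (fun x => 1 + expR (- x)) (- expR (- x)).
  by apply: is_derive_eq; rewrite add0r mul1r.
have n0 : 1 + expR (- x) != 0 by rewrite gt_eqF// sigmoid_denom_gt0.
apply: (is_derive_eq (f := sigmoid) (is_deriveV (f := fun x => 1 + expR (- x)) n0 h1)).
by rewrite /GRing.scale/= /logistic_pdf; field.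
Qed.

Lemma is_derive_logistic_pdf (x : R) :
  is_derive x (1 : R) f (f x * (1 - 2 * sigmoid x)).
Proof.
have h := is_derive_sigmoid x.
rewrite (_ : f = fun x => sigmoid x * (1 - sigmoid x)); last first.
  by apply/funext => y; rewrite logistic_pdfE.
by apply: is_derive_eq; rewrite /GRing.scale/= logistic_pdfE; ring.
Qed.

Lemma logistic_pdf_le1 (x : R) : f x <= 1.
Proof.
rewrite logistic_pdfE; have := sigmoid_gt0 x; have := sigmoid_lt1 x; nra.
Qed.

Lemma sigmoid_bound (x : R) : `|1 - 2 * sigmoid x| <= 1.
Proof.
have := sigmoid_gt0 x; have := sigmoid_lt1 x.
by rewrite ler_norml => ? ?; apply/andP; split; lra.
Qed.

Lemma logistic_pdf_even (x : R) : f (- x) = f x.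
Proof.
rewrite /logistic_pdf opprK.
have := expR_gt0 x; rewrite expRN; move: (expR x) => y y0.
by field; rewrite !gt_eqF ?addr_gt0.
Qed.

Lemma logistic_pdf_le_exp (x : R) : f x <= expR (- `|x|).
Proof.
wlog x0 : x / 0 <= x => [h|].
  have [/h//|/ltW x0] := leP 0 x.
  by rewrite -logistic_pdf_even -normrN h// oppr_ge0.
rewrite ger0_norm// /logistic_pdf ler_pdivrMr ?exprn_gt0 ?sigmoid_denom_gt0//.
have := expR_gt0 (- x); move: (expR _) => y y0.
by rewrite ler_peMr // ?(ltW y0)// exprn_ege1//; lra.
Qed.

(** [expR |x|] is the eighth power of [expR (|x| / 8) >= 1 + |x| / 8], and
    [(1 + |x| / 8) ^+ 2 >= (1 + x ^+ 2) / 64]; the fourth power of the latter gives the constant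
    [64 ^+ 4]. *)
Lemma decay_logistic : decay 4 f.
Proof.
exists (64 ^+ 4) => x.
rewrite ger0_norm ?logistic_pdf_ge0//.
apply: le_trans (logistic_pdf_le_exp x) _.
have y0 := oneDsq_gt0 x.
rewrite expRN -[leRHS]invrK invf_div lef_pV2 ?posrE ?expR_gt0//; last first.
  by rewrite divr_gt0 ?exprn_gt0.
rewrite -expr_div_n.
have -> : `|x| = `|x| / 8 * 2%:R * 4%:R by field.
rewrite !expRM_natr lerXn2r ?nnegrE ?sqr_ge0//; first by rewrite divr_ge0 ?(ltW y0).
have e1 := expR_ge1Dx (`|x| / 8).
apply: (@le_trans _ _ ((1 + `|x| / 8) ^+ 2)); last first.
  by rewrite ler_sqr ?nnegrE// ?expR_ge0// addr_ge0// divr_ge0.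
have : `|x| ^+ 2 = x ^+ 2 by rewrite real_normK ?num_real.
by have := normr_ge0 x; move: (`|x|) => z z0 <-; nra.
Qed.

Lemma is_derive_logistic_pow k (x : R) :
  is_derive x (1 : R) (fun x => f x ^+ k) (k%:R * (1 - 2 * sigmoid x) * f x ^+ k).
Proof.
have h := is_derive_logistic_pdf x; case: k => [|k].
  by rewrite !mul0r; exact: is_derive_cst.
have -> : (fun x => f x ^+ k.+1) = (f : R -> R) ^+ k.+1.
  by apply/funext => y; rewrite exprfctE.
apply: is_derive_eq (is_deriveX k.+1 h) _; rewrite /GRing.scale/=.
by rewrite [f x ^+ k.+1](exprS (f x) k); ring.
Qed.

Definition logistic_dpow k (x : R) : R := k%:R * (1 - 2 * sigmoid x) * f x ^+ k.

(** Because [(1 - 2 sigmoid) ^+ 2 = 1 - 4 f], the second derivative of [f ^+ k] is a combination of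
    [f ^+ k] and [f ^+ k.+1] alone. All the moment recursions come from this closure. *)
Lemma is_derive_logistic_dpow k (x : R) :
  is_derive x (1 : R) (logistic_dpow k)
   (k%:R ^+ 2 * f x ^+ k - (4 * k%:R ^+ 2 + 2 * k%:R) * f x ^+ k.+1).
Proof.
have h := is_derive_logistic_pow k x; have h2 := is_derive_sigmoid x.
rewrite /logistic_dpow; apply: is_derive_eq; rewrite /GRing.scale/=.
rewrite (exprS (f x) k); move: (f x ^+ k) => z.
by rewrite logistic_pdfE; ring.
Qed.

Lemma logistic_pow_le k (x : R) : (0 < k)%N -> f x ^+ k <= f x.
Proof.
move=> k0; rewrite -[leRHS]expr1.
by apply: ler_wiXn2l => //; [exact: logistic_pdf_ge0|exact: logistic_pdf_le1].
Qed.

Lemma decay_le n (g g' : R -> R) (M : R) : 0 <= M ->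
  (forall x, `|g x| <= M * `|g' x|) -> decay n g' -> decay n g.
Proof.
move=> M0 gg [D hD]; exists (M * D) => x; apply: le_trans (gg x) _.
by rewrite -mulrA ler_wpM2l.
Qed.

Lemma decay_polyM m n (w g : R -> R) (D : R) :
  (forall x, `|w x| <= D * (1 + x ^+ 2) ^+ m) -> decay (m + n) g ->
  decay n (fun x => w x * g x).
Proof.
move=> wD [E gE]; exists (D * E) => x; rewrite normrM.
apply: le_trans (ler_pM _ _ (wD x) (gE x)) _ => //.
have := oneDsq_gt0 x; move: (1 + x ^+ 2) => y y0.
rewrite le_eqVlt; apply/orP; left; apply/eqP; rewrite exprD.
by field; rewrite !gt_eqF ?exprn_gt0.
Qed.

Lemma decay_logistic_pow k : (0 < k)%N -> decay 4 (fun x => f x ^+ k).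
Proof.
move=> k0; apply: decay_le ler01 _ decay_logistic => x; rewrite mul1r.
by rewrite !ger0_norm ?exprn_ge0 ?logistic_pow_le ?logistic_pdf_ge0.
Qed.

Lemma decay_logistic_dpow k : (0 < k)%N -> decay 4 (logistic_dpow k).
Proof.
move=> k0; apply: (@decay_le _ _ (fun x => f x ^+ k) k%:R) => //; last first.
  exact: decay_logistic_pow.
move=> x; rewrite /logistic_dpow !normrM normr_nat.
by rewrite ler_wpM2r// ler_piMr// sigmoid_bound.
Qed.

Lemma continuous_logistic_pow k : continuous (fun x => f x ^+ k).
Proof. exact: is_derive_continuous (is_derive_logistic_pow k). Qed.

End logistic.

(** * Recursions for integrals against powers of the Logistic density *)

Section logistic_moments.
Context {R : realType}.
Notation mu := (@lebesgue_measure R).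
Local Notation f := (@logistic_pdf R).

(** The weights [f ^+ k], once normalised, concentrate at [0] as [k] grows; a recursion in [k] thus
    leads from the Logistic law at [k = 1] to a trivial limit. *)
Definition LI (w : R -> R) k : R := \int[mu]_x (w x * f x ^+ k).

Lemma integrable_LI (w : R -> R) (D : R) k : (0 < k)%N -> continuous w ->
  (forall x, `|w x| <= D * (1 + x ^+ 2) ^+ 2) ->
  mu.-integrable setT (EFin \o (fun x => w x * f x ^+ k)).
Proof.
move=> k0 cw wD; apply: integrable_decay.
  by move=> x; apply: cvgM; [exact: cw|exact: continuous_logistic_pow].
by apply: decay_polyM wD _; apply: decayS (decay_logistic_pow k0).
Qed.

(** Two integrations by parts move both derivatives of [f ^+ k] onto the weight [w]; [F] collects
    the boundary terms, which vanish at infinity. *)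
Lemma logistic_parts (w w1 w2 : R -> R) (D : R) k : (0 < k)%N ->
  (forall x : R, is_derive x (1 : R) w (w1 x)) ->
  (forall x : R, is_derive x (1 : R) w1 (w2 x)) -> continuous w2 ->
  (forall x, `|w x| <= D * (1 + x ^+ 2) ^+ 2) ->
  (forall x, `|w1 x| <= D * (1 + x ^+ 2) ^+ 2) ->
  (forall x, `|w2 x| <= D * (1 + x ^+ 2) ^+ 2) ->
  k%:R ^+ 2 * LI w k - (4 * k%:R ^+ 2 + 2 * k%:R) * LI w k.+1 = LI w2 k.
Proof.
move=> k0 dw dw1 cw2 bw bw1 bw2.
have cw := is_derive_continuous dw; have cw1 := is_derive_continuous dw1.
pose F x := w x * logistic_dpow k x - w1 x * f x ^+ k.
pose g x := k%:R ^+ 2 * (w x * f x ^+ k)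
  - (4 * k%:R ^+ 2 + 2 * k%:R) * (w x * f x ^+ k.+1) - w2 x * f x ^+ k.
have dF (x : R) : is_derive x (1 : R) F (g x).
  have h1 := is_derive_logistic_pow k x.
  have h2 := is_derive_logistic_dpow k x.
  have h3 := dw x; have h4 := dw1 x.
  rewrite /F; apply: is_derive_eq; rewrite /GRing.scale/= /g /logistic_dpow.
  by ring.
have cwf (v : R -> R) j : continuous v -> continuous (fun x => v x * f x ^+ j).
  by move=> cv x; apply: cvgM; [exact: cv|exact: continuous_logistic_pow].
have dwf (v h : R -> R) : (forall x, `|v x| <= D * (1 + x ^+ 2) ^+ 2) ->
    decay 4 h -> decay 1 (fun x => v x * h x).
  by move=> vD h4; apply: decay_polyM vD _; exact: decayS h4.
have cg : continuous g.
  move=> x; apply: cvgB; last exact: cwf.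
  by apply: cvgB; apply: cvgM; [exact: cvg_cst|exact: cwf|exact: cvg_cst|exact: cwf].
have dg : decay 1 g.
  apply: decayB; last exact/dwf/decay_logistic_pow.
  by apply: decayB; apply: decayZ; apply: dwf => //; exact: decay_logistic_pow.
have dF1 : decay 1 F.
  by apply: decayB; apply: dwf => //; [exact: decay_logistic_dpow|
    exact: decay_logistic_pow].
have /(congr1 fine) := integral_derive_decay dF cg dg dF1.
have i1 := integrable_LI k0 cw bw.
have i2 := integrable_LI (ltn0Sn k) cw bw.
have i3 := integrable_LI k0 cw2 bw2.
have i4 := integrableZl measurableT (k%:R ^+ 2) i1.
have i5 := integrableZl measurableT (4 * k%:R ^+ 2 + 2 * k%:R) i2.
rewrite -/(Rintegral mu setT g) /g RintegralB//; last exact: integrableB i4 i5.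
rewrite RintegralB// !RintegralZl//.
by move=> /= /eqP; rewrite subr_eq0 => /eqP.
Qed.

Lemma continuous_exprn n : continuous (fun x : R => x ^+ n).
Proof. by move=> x; exact: exprn_continuous. Qed.

Lemma exprn_bound (x : R) n : (n <= 4)%N -> `|x ^+ n| <= (1 + x ^+ 2) ^+ 2.
Proof.
move=> n4; rewrite normrX.
have : `|x| ^+ 2 = x ^+ 2 by rewrite real_normK ?num_real.
move: (normr_ge0 x) => + <-; move: `|x| => y y0.
have [y1|/ltW y1] := leP y 1.
  apply: (@le_trans _ _ 1); first by rewrite exprn_ile1.
  by rewrite exprn_ege1// lerDl sqr_ge0.
apply: (@le_trans _ _ (y ^+ 4)); first by rewrite ler_weXn2l.
by rewrite (_ : 4 = 2 * 2)%N// exprM lerXn2r ?nnegrE ?addr_ge0 ?sqr_ge0// lerDr.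
Qed.

Lemma cosM_bound (t x : R) : `|cos (t * x)| <= (1 + `|t|) ^+ 2 * (1 + x ^+ 2) ^+ 2.
Proof.
apply: (le_trans (norm_cos_le1 _)); rewrite -exprMn exprn_ege1//.
by rewrite -[leLHS]mulr1 ler_pM// lerDl// sqr_ge0.
Qed.

Notation Jk := (LI (fun=> 1)).
Notation Mk := (LI (fun x => x ^+ 2)).
Notation Qk := (LI (fun x => x ^+ 4)).
Local Notation ck k := (4 * k%:R ^+ 2 + 2 * k%:R : R).

Lemma Jk_rec k : (0 < k)%N -> k%:R ^+ 2 * Jk k = ck k * Jk k.+1.
Proof.
move=> k0; apply/eqP; rewrite -subr_eq0; apply/eqP.
rewrite (@logistic_parts _ (fun=> 0) (fun=> 0) 1 k)//.
- by rewrite /LI; under eq_Rintegral do rewrite mul0r; rewrite Rintegral_cst// mul0r.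
- by move=> x; exact: cvg_cst.
- by move=> x; rewrite normr1 mul1r exprn_ege1// lerDl sqr_ge0.
- by move=> x; rewrite normr0 mul1r sqr_ge0.
- by move=> x; rewrite normr0 mul1r sqr_ge0.
Qed.

(** [cos (t x)] is an eigenfunction of the second derivative, with eigenvalue [- t^2], so the
    recursion involves this weight only. *)
Lemma LIcos_rec t k : (0 < k)%N ->
  (k%:R ^+ 2 + t ^+ 2) * LI (fun x => cos (t * x)) k =
  ck k * LI (fun x => cos (t * x)) k.+1.
Proof.
move=> k0.
have bs (x : R) : `|sin (t * x)| <= 1 := norm_sin_le1 _.
have b1 (x : R) : 1 <= (1 + x ^+ 2) ^+ 2 by rewrite exprn_ege1// lerDl sqr_ge0.
have B (c : R) (x y : R) : `|c| <= (1 + `|t|) ^+ 2 -> `|y| <= 1 ->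
    `|c * y| <= (1 + `|t|) ^+ 2 * (1 + x ^+ 2) ^+ 2.
  move=> hc hy; rewrite normrM; apply: ler_pM => //; exact: le_trans hy (b1 x).
have := @logistic_parts (fun x => cos (t * x)) (fun x => - t * sin (t * x))
  (fun x => - t ^+ 2 * cos (t * x)) ((1 + `|t|) ^+ 2) k k0 (is_derive_cosM t).
have -> : LI (fun x => - t ^+ 2 * cos (t * x)) k =
    - t ^+ 2 * LI (fun x => cos (t * x)) k.
  have I := integrable_LI k0 (continuous_cosM (t := t)) (cosM_bound t).
  rewrite /LI -(RintegralZl (- t ^+ 2) measurableT I).
  by apply: eq_Rintegral => x _; rewrite mulrA.
move=> h; suff /eqP : k%:R ^+ 2 * LI (fun x => cos (t * x)) k -
    ck k * LI (fun x => cos (t * x)) k.+1 = - t ^+ 2 * LI (fun x => cos (t * x)) k.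
  by rewrite subr_eq (mulrDl (k%:R ^+ 2)) => /eqP ->; ring.
apply: h.
- move=> x; have h2 := is_derive_sinM t x.
  by apply: is_derive_eq; rewrite /GRing.scale/=; ring.
- by move=> x; apply: cvgM; [exact: cvg_cst|exact: continuous_cosM].
- exact: cosM_bound.
- move=> x; apply: B; last exact: norm_sin_le1.
  by rewrite normrN; have := normr_ge0 t; nra.
- move=> x; apply: B; last exact: norm_cos_le1.
  by rewrite normrN normrX; have := normr_ge0 t; nra.
Qed.

Lemma Mk_rec k : (0 < k)%N ->
  k%:R ^+ 2 * Mk k = ck k * Mk k.+1 + 2 * Jk k.
Proof.
move=> k0.
have := @logistic_parts (fun x => x ^+ 2) (fun x => 2 * x) (fun x => 2) 2 k k0.
have -> : LI (fun => 2) k = 2 * Jk k.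
  have I : mu.-integrable setT (EFin \o (fun x => 1 * f x ^+ k)).
    apply: (@integrable_LI (fun=> 1) 1) => //; first by move=> x; exact: cvg_cst.
    by move=> x; rewrite normr1 mul1r exprn_ege1// lerDl sqr_ge0.
  rewrite /LI -(RintegralZl 2 measurableT I).
  by apply: eq_Rintegral => x _; rewrite mul1r.
move=> h; apply/eqP; rewrite addrC -subr_eq; apply/eqP; apply: h.
- by move=> x; apply: is_derive_eq; rewrite /GRing.scale/=; ring.
- by move=> x; apply: is_derive_eq; rewrite /GRing.scale/=; ring.
- by move=> x; exact: cvg_cst.
- move=> x; rewrite mulrDl !mul1r -[leLHS]add0r lerD ?sqr_ge0//.
  exact: exprn_bound.
- by move=> x; rewrite normrM normr_nat ler_wpM2l// -[x]expr1 exprn_bound.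
- by move=> x; rewrite normr_nat ler_peMr// exprn_ege1// lerDl sqr_ge0.
Qed.

Lemma Qk_rec k : (0 < k)%N ->
  k%:R ^+ 2 * Qk k = ck k * Qk k.+1 + 12 * Mk k.
Proof.
move=> k0.
have b (x c : R) n : (n <= 4)%N -> 0 <= c -> c <= 12 -> `|c * x ^+ n| <= 12 * (1 + x ^+ 2) ^+ 2.
  by move=> n4 c0 c12; rewrite normrM ger0_norm// ler_pM// exprn_bound.
have := @logistic_parts (fun x => x ^+ 4) (fun x => 4 * x ^+ 3)
  (fun x => 12 * x ^+ 2) 12 k k0.
have -> : LI (fun x => 12 * x ^+ 2) k = 12 * Mk k.
  have I : mu.-integrable setT (EFin \o (fun x => x ^+ 2 * f x ^+ k)).
    apply: (@integrable_LI (fun x => x ^+ 2) 1) => //; first exact: continuous_exprn.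
    by move=> x; rewrite mul1r exprn_bound.
  rewrite /LI -(RintegralZl 12 measurableT I).
  by apply: eq_Rintegral => x _; rewrite mulrA.
move=> h; apply/eqP; rewrite addrC -subr_eq; apply/eqP; apply: h.
- by move=> x; apply: is_derive_eq; rewrite /GRing.scale/=; ring.
- by move=> x; apply: is_derive_eq; rewrite /GRing.scale/=; ring.
- by move=> x; apply: cvgM; [exact: cvg_cst|exact: continuous_exprn].
- by move=> x; rewrite -[x ^+ 4]mul1r; apply: b => //; rewrite ler1n.
- by move=> x; apply: b => //; rewrite ler_nat.
- by move=> x; apply: b => //; rewrite lexx.
Qed.

(** With [y = expR (x / 2)] and [z = y^-1], for [x >= 0] this is the square of [x z <= 2 (1 - z^2)],
    that is [x <= 2 (y - z)], which follows from [y >= 1 + x / 2] and [z <= 1]. The right side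
    vanishes at [x = 0], where [f = 1 / 4]; this makes the integrated bound small for large [k]. *)
Lemma logistic_sq_bound (x : R) : x ^+ 2 * f x <= 4 * (1 - 4 * f x).
Proof.
wlog x0 : x / 0 <= x => [h|].
  have [/h//|/ltW x0] := leP 0 x.
  by rewrite -logistic_pdf_even -sqrrN h// oppr_ge0.
rewrite /logistic_pdf.
have -> : expR (- x) = expR (- (x / 2)) ^+ 2.
  by rewrite -expRM_natr; congr expR; field.
have : expR (x / 2) * expR (- (x / 2)) = 1 by rewrite expRxMexpNx_1.
have := expR_ge1Dx (x / 2); have := expR_gt0 (- (x / 2)).
move: (expR (x / 2)) (expR (- (x / 2))) => y z z0 hy hz.
have y0 : 0 < 1 + z ^+ 2 by rewrite oneDsq_gt0.
have -> : 4 * (1 - 4 * (z ^+ 2 / (1 + z ^+ 2) ^+ 2)) =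
    (2 * (1 - z ^+ 2)) ^+ 2 / (1 + z ^+ 2) ^+ 2.
  by field; rewrite gt_eqF.
rewrite mulrA ler_pdivrMr ?exprn_gt0// divfK ?gt_eqF ?exprn_gt0//.
rewrite -exprMn lerXn2r ?nnegrE ?mulr_ge0// ?(ltW z0)//; nra.
Qed.

(** The integrand is [sigmoid ^ u * sigmoid'], with primitive [sigmoid ^ (1 + u) / (1 + u)]. In
    probabilistic terms, [- ln sigmoid] of a Logistic variable is standard exponential; [u = 0]
    gives total mass one. *)
Lemma integral_sigmoid_pow (u : R) : 0 <= u ->
  (\int[mu]_x (expR (- (u * ln (1 + expR (- x)))) * f x)%:E = ((1 + u)^-1)%:E)%E.
Proof.
move=> u0; have u1 : 0 < 1 + u by rewrite ltr_pwDl.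
pose E (x : R) := ln (1 + expR (- x)).
pose F (x : R) := (1 + u)^-1 * expR (- ((1 + u) * E x)).
have E0 (x : R) : 0 <= E x by rewrite ln_ge0// lerDl expR_ge0.
have dE (x : R) : is_derive x (1 : R) E (- (expR (- x) / (1 + expR (- x)))).
  have h := is_derive_expRN x.
  have h1 : is_derive x (1 : R) (fun x => 1 + expR (- x)) (- expR (- x)).
    by apply: is_derive_eq; rewrite add0r mul1r.
  have h2 := is_derive1_ln (sigmoid_denom_gt0 x).
  by apply: is_derive_eq (is_derive1_comp _ _) _; rewrite mulrN mulrC.
have dF (x : R) : is_derive x (1 : R) F (expR (- (u * E x)) * f x).
  have h := dE x.
  have h1 : is_derive x (1 : R) (fun x => - ((1 + u) * E x))
      ((1 + u) * (expR (- x) / (1 + expR (- x)))).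
    by apply: is_derive_eq; rewrite /GRing.scale/=; ring.
  have h2 : is_derive x (1 : R) (fun x => expR (- ((1 + u) * E x)))
      (expR (- ((1 + u) * E x)) * ((1 + u) * (expR (- x) / (1 + expR (- x))))).
    by apply: is_derive_eq (is_derive1_comp _ _) _.
  rewrite /F; apply: is_derive_eq; rewrite /GRing.scale/=.
  have eE : expR (- E x) = (1 + expR (- x))^-1.
    by rewrite expRN lnK// posrE sigmoid_denom_gt0.
  have -> : - ((1 + u) * E x) = - E x - u * E x by ring.
  rewrite expRD eE /logistic_pdf; have := sigmoid_denom_gt0 x => ?.
  by field; rewrite !gt_eqF.
have ce : continuous (fun x => expR (- (u * E x)) * f x).
  move=> x; apply: cvgM; last first.
    exact: (is_derive_continuous is_derive_logistic_pdf).
  apply: continuous_comp; last exact: continuous_expR.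
  apply: cvgN; apply: cvgM; first exact: cvg_cst.
  exact: (is_derive_continuous dE).
have de : decay 1 (fun x => expR (- (u * E x)) * f x).
  apply: (decay_bM (M := 1)); last exact: decayS decay_logistic.
  by move=> x; rewrite ger0_norm ?expR_ge0// expR_le1 oppr_le0 mulr_ge0.
have iu1 : (1 + u)^-1 <= 1 by rewrite invf_le1// lerDl.
apply: integral_derive_cvg dF ce de _ _.
  have h : (1 + u)^-1 - expR (- n%:R) @[n --> \oo] --> (1 + u)^-1.
    rewrite -[X in _ --> X]subr0; apply: cvgB; first exact: cvg_cst.
    exact: cvgn_expR.
  apply: squeeze_cvgr h (cvg_cst _); near=> n.
  apply/andP; split; last first.
    rewrite /F ler_piMr ?invr_ge0 ?(ltW u1)// expR_le1 oppr_le0.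
    by rewrite mulr_ge0 ?(ltW u1).
  have e1 : E n%:R <= expR (- n%:R).
    by rewrite /E; apply: le_ln1Dx; rewrite (lt_trans _ (expR_gt0 _))// ltrN10.
  have := expR_ge1Dx (- ((1 + u) * E n%:R)).
  rewrite -(ler_pM2l (_ : 0 < (1 + u)^-1)) ?invr_gt0// -/(F _).
  rewrite mulrDr mulr1 mulrN mulKf ?gt_eqF// => /(le_trans _); apply.
  by rewrite lerB.
have h0 : (0 : R) @[n --> \oo] --> (0 : R) by exact: cvg_cst.
apply: squeeze_cvgr h0 (@cvgn_expR R); near=> n.
apply/andP; split; first by rewrite mulr_ge0 ?expR_ge0// invr_ge0 ltW.
apply: (@le_trans _ _ (expR (- E (- n%:R)))).
  rewrite -[leRHS]mul1r; apply: ler_pM; rewrite ?expR_ge0 ?invr_ge0 ?(ltW u1)//.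
  by rewrite ler_expR lerN2 ler_peMl// lerDl.
rewrite /E opprK (expRN (ln _)) lnK ?posrE ?addr_gt0 ?expR_gt0//.
by rewrite expRN lef_pV2 ?posrE ?expR_gt0 ?addr_gt0 ?expR_gt0// lerDr.
Unshelve. all: by end_near. Qed.

End logistic_moments.

(** * Logistic variance as a series, fourth moment bound, and the product formula for the
    characteristic function *)

Section logistic_limits.
Context {R : realType}.
Notation mu := (@lebesgue_measure R).
Local Notation f := (@logistic_pdf R).
Local Notation Jk := (@LI R (fun=> 1)).
Local Notation Mk := (@LI R (fun x => x ^+ 2)).
Local Notation Qk := (@LI R (fun x => x ^+ 4)).
Local Notation ck k := (4 * k%:R ^+ 2 + 2 * k%:R : R).

Lemma integral_logistic_pdf : (\int[mu]_x (f x)%:E = 1%:E)%E.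
Proof.
have := @integral_sigmoid_pow R 0 (lexx 0); rewrite addr0 invr1 => <-.
by apply: eq_integral => x _; rewrite mul0r oppr0 expR0 mul1r.
Qed.

Lemma Jk1 : Jk 1 = 1.
Proof.
rewrite /LI /Rintegral; under eq_integral do rewrite mul1r expr1.
by rewrite integral_logistic_pdf.
Qed.

Lemma ck_gt0 k : (0 < k)%N -> 0 < ck k.
Proof.
by move=> k0; rewrite addr_gt0// mulr_gt0// ?exprn_gt0 ?ltr0n.
Qed.

Lemma Jk_gt0 k : (0 < k)%N -> 0 < Jk k.
Proof.
case: k => // k _; elim: k => [|k IH]; first by rewrite Jk1.
have := Jk_rec (ltn0Sn k); have c0 := ck_gt0 (ltn0Sn k) => e.
by rewrite -(pmulr_rgt0 _ c0) -e mulr_gt0// exprn_gt0.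
Qed.

Lemma integrable_Xn n k : (n <= 4)%N -> (0 < k)%N ->
  mu.-integrable setT (EFin \o (fun x => x ^+ n * f x ^+ k)).
Proof.
move=> n4 k0; apply: (@integrable_LI _ (fun x => x ^+ n) 1) => //.
  exact: continuous_exprn.
by move=> x; rewrite mul1r exprn_bound.
Qed.

Lemma integrable_X0 k : (0 < k)%N ->
  mu.-integrable setT (EFin \o (fun x => 1 * f x ^+ k)).
Proof. by move=> k0; exact: (@integrable_Xn 0 k). Qed.

Lemma Mk_le k : (0 < k)%N -> Mk k.+1 <= 4 * (Jk k - 4 * Jk k.+1).
Proof.
move=> k0; rewrite mulrBr mulrA.
have i1 := integrable_X0 k0; have i2 := integrable_X0 (ltn0Sn k).
have i3 := integrableZl measurableT 4 i1.
have i4 := integrableZl measurableT (4 * 4) i2.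
rewrite /LI -(RintegralZl 4 measurableT i1) -(RintegralZl (4 * 4) measurableT i2).
rewrite -RintegralB//; apply: le_Rintegral => //.
- exact: integrable_Xn.
- exact: integrableB i3 i4.
- move=> x _; rewrite !mul1r !(exprS (f x)).
  have h := logistic_sq_bound x; have := exprn_ge0 k (logistic_pdf_ge0 x).
  by move: (f x ^+ k) => z z0; have := ler_wpM2r z0 h; lra.
Qed.

(** The square of [logistic_sq_bound], with [(1 - 4 f) ^+ 2 <= 1 - 4 f], integrated against
    [f ^+ k]. *)
Lemma Qk_le k : (0 < k)%N -> Qk k.+2 <= 16 * (Jk k - 4 * Jk k.+1).
Proof.
move=> k0; rewrite mulrBr mulrA.
have i1 := integrable_X0 k0; have i2 := integrable_X0 (ltn0Sn k).
have i3 := integrableZl measurableT 16 i1.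
have i4 := integrableZl measurableT (16 * 4) i2.
rewrite /LI -(RintegralZl 16 measurableT i1) -(RintegralZl (16 * 4) measurableT i2).
rewrite -RintegralB//; apply: le_Rintegral => //.
- exact: integrable_Xn.
- exact: integrableB i3 i4.
- move=> x _; rewrite !mul1r !(exprS (f x)).
  have h := logistic_sq_bound x; have z0 := exprn_ge0 k (logistic_pdf_ge0 x).
  have f0 := logistic_pdf_ge0 x.
  have h4 : x ^+ 4 * f x * f x <= 16 * (1 - 4 * f x).
    have x2f : 0 <= x ^+ 2 * f x by rewrite mulr_ge0 ?sqr_ge0.
    have f1 := le_trans x2f h.
    have : (x ^+ 2 * f x) ^+ 2 <= (4 * (1 - 4 * f x)) ^+ 2.
      by rewrite lerXn2r ?nnegrE.
    have -> : (x ^+ 2 * f x) ^+ 2 = x ^+ 4 * f x * f x by ring.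
    by move=> /le_trans; apply; nra.
  by move: (f x ^+ k) z0 => z z0; have := ler_wpM2r z0 h4; lra.
Qed.

(** Second and, below, fourth moment of the probability density proportional to [f ^+ k]. *)
Definition mk k : R := Mk k / Jk k.
Definition qk k : R := Qk k / Jk k.

Lemma mk_ge0 k : (0 < k)%N -> 0 <= mk k.
Proof.
move=> k0; rewrite divr_ge0 ?(ltW (Jk_gt0 k0))//.
by apply: Rintegral_ge0 => x _; rewrite mulr_ge0 ?sqr_ge0// exprn_ge0 ?logistic_pdf_ge0.
Qed.

Lemma qk_ge0 k : (0 < k)%N -> 0 <= qk k.
Proof.
move=> k0; rewrite divr_ge0 ?(ltW (Jk_gt0 k0))//.
apply: Rintegral_ge0 => x _; apply: mulr_ge0; first exact: exprn_even_ge0.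
by rewrite exprn_ge0// logistic_pdf_ge0.
Qed.

Lemma Jk_ratio k : (0 < k)%N -> Jk k = (4 + 2 / k%:R) * Jk k.+1.
Proof.
move=> k0; have k1 : k%:R != 0 :> R by rewrite pnatr_eq0 -lt0n.
apply: (mulfI (expf_neq0 2 k1)); rewrite Jk_rec//.
by field.
Qed.

(** Dividing [Mk_rec] by [Jk_rec] cancels the factor [4 k^2 + 2 k], so the normalised recursion is
    additive and telescopes. *)
Lemma mk_rec k : (0 < k)%N -> mk k = mk k.+1 + 2 / k%:R ^+ 2.
Proof.
move=> k0; have k1 : k%:R != 0 :> R by rewrite pnatr_eq0 -lt0n.
have c0 := ck_gt0 k0.
have a0 : k%:R ^+ 2 != 0 :> R by rewrite expf_neq0.
have eM : Mk k = (ck k * Mk k.+1 + 2 * Jk k) / k%:R ^+ 2.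
  by apply: (mulfI a0); rewrite Mk_rec// [RHS]mulrCA mulfV ?mulr1.
have eJ : Jk k.+1 = k%:R ^+ 2 * Jk k / ck k.
  by apply: (mulfI (lt0r_neq0 c0)); rewrite Jk_rec// [RHS]mulrCA mulfV ?mulr1// lt0r_neq0.
have j0 : Jk k != 0 by rewrite gt_eqF// Jk_gt0.
rewrite /mk eM eJ; move: (lt0r_neq0 c0) => c1.
by field; rewrite c1 j0 k1.
Qed.

Lemma qk_rec k : (0 < k)%N -> qk k = qk k.+1 + 12 * mk k / k%:R ^+ 2.
Proof.
move=> k0; have k1 : k%:R != 0 :> R by rewrite pnatr_eq0 -lt0n.
have c0 := ck_gt0 k0.
have a0 : k%:R ^+ 2 != 0 :> R by rewrite expf_neq0.
have eM : Qk k = (ck k * Qk k.+1 + 12 * Mk k) / k%:R ^+ 2.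
  by apply: (mulfI a0); rewrite Qk_rec// [RHS]mulrCA mulfV ?mulr1.
have eJ : Jk k.+1 = k%:R ^+ 2 * Jk k / ck k.
  by apply: (mulfI (lt0r_neq0 c0)); rewrite Jk_rec// [RHS]mulrCA mulfV ?mulr1// lt0r_neq0.
have j0 : Jk k != 0 by rewrite gt_eqF// Jk_gt0.
rewrite /qk /mk eM eJ; move: (lt0r_neq0 c0) => c1.
by field; rewrite c1 j0 k1.
Qed.

(** By [Jk_ratio] the difference [Jk k - 4 * Jk k.+1] is only [2 / k] times [Jk k.+1]. *)
Lemma mk_le k : (0 < k)%N -> mk k.+1 <= 8 / k%:R.
Proof.
move=> k0; rewrite ler_pdivrMr ?Jk_gt0//; apply: le_trans (Mk_le k0) _.
by rewrite (Jk_ratio k0) le_eqVlt; apply/orP; left; apply/eqP; ring.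
Qed.

Lemma qk_le k : (0 < k)%N -> qk k.+2 <= 192 / k%:R.
Proof.
move=> k0; rewrite ler_pdivrMr ?Jk_gt0//; apply: le_trans (Qk_le k0) _.
rewrite (Jk_ratio k0) (Jk_ratio (ltn0Sn k)).
have j0 := Jk_gt0 (ltn0Sn k.+1); have k1 : 0 < k%:R :> R by rewrite ltr0n.
rewrite (_ : 16 * _ = 32 * (4 + 2 / k.+1%:R) * (Jk k.+2 / k%:R)); last by ring.
rewrite (_ : 192 / _ * _ = 192 * (Jk k.+2 / k%:R)); last by ring.
rewrite ler_wpM2r ?divr_ge0 ?(ltW j0)//.
have : 2 / k.+1%:R <= 2 :> R by rewrite ler_pdivrMr ?ltr0n// ler_peMr// ler1n.
by move: (2 / k.+1%:R) => z z2; lra.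
Qed.

Lemma cvg_div_nat (c : R) : c / n.+1%:R @[n --> \oo] --> 0.
Proof.
rewrite -(mulr0 c); apply: cvgM; first exact: cvg_cst.
exact: cvg_harmonic.
Qed.

Lemma cvg_mk : mk n.+2 @[n --> \oo] --> 0.
Proof.
have h0 : (0 : R) @[n --> \oo] --> (0 : R) by exact: cvg_cst.
apply: squeeze_cvgr h0 (cvg_div_nat 8); near=> n.
by rewrite mk_ge0//= mk_le.
Unshelve. all: by end_near. Qed.

Lemma cvg_qk : qk n.+3 @[n --> \oo] --> 0.
Proof.
have h0 : (0 : R) @[n --> \oo] --> (0 : R) by exact: cvg_cst.
apply: squeeze_cvgr h0 (cvg_div_nat 192); near=> n.
by rewrite qk_ge0//= qk_le.
Unshelve. all: by end_near. Qed.

Lemma mk_sum n : mk 1 = mk n.+1 + \sum_(k < n) 2 / k.+1%:R ^+ 2.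
Proof.
elim: n => [|n IH]; first by rewrite big_ord0 addr0.
rewrite IH big_ord_recr /= (mk_rec (ltn0Sn n)); ring.
Qed.

Lemma qk_sum n : qk 1 = qk n.+1 + \sum_(k < n) 12 * mk k.+1 / k.+1%:R ^+ 2.
Proof.
elim: n => [|n IH]; first by rewrite big_ord0 addr0.
rewrite IH big_ord_recr /= (qk_rec (ltn0Sn n)); ring.
Qed.

Lemma cvg_sum_mk : \sum_(k < n) 2 / k.+1%:R ^+ 2 @[n --> \oo] --> mk 1.
Proof.
have h : (fun n => \sum_(k < n.+1) 2 / k.+1%:R ^+ 2) = (fun n => mk 1 - mk n.+2).
  by apply/funext => n; rewrite (mk_sum n.+1); ring.
rewrite -(cvg_shiftS (fun n => (\sum_(k < n) 2 / k.+1%:R ^+ 2 : R))) h.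
have := cvgB (cvg_cst (mk 1)) cvg_mk; rewrite subr0; exact.
Qed.

(** The fourth moment is the series of the [12 m_k / k^2]; bounding each [m_k] by [m_1] leaves
    [6 m_1] times the series of the [2 / k^2], whose sum is [m_1]. *)
Lemma qk1_le : qk 1 <= 6 * mk 1 ^+ 2.
Proof.
have m1 k : mk k.+1 <= mk 1.
  by rewrite (mk_sum k) lerDl sumr_ge0// => i _; rewrite divr_ge0// sqr_ge0.
have h n : qk 1 - qk n.+1 <= 6 * mk 1 ^+ 2.
  rewrite (qk_sum n) addrC addKr.
  apply: (@le_trans _ _ (\sum_(k < n) 6 * mk 1 * (2 / k.+1%:R ^+ 2))).
    apply: ler_sum => i _.
    have : 0 <= (i.+1%:R ^+ 2)^-1 :> R by rewrite invr_ge0 sqr_ge0.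
    by move: (_^-1) => z /ler_wpM2r /(_ _ _ (m1 i)); lra.
  have m0 : 0 <= 6 * mk 1 by apply: mulr_ge0 => //; exact: mk_ge0.
  rewrite -mulr_sumr (expr2 (mk 1)) (mulrA 6) ler_wpM2l//.
  by rewrite [leRHS](mk_sum n) lerDr mk_ge0.
have c : qk 1 - qk n.+3 @[n --> \oo] --> qk 1.
  have := cvgB (cvg_cst (qk 1)) cvg_qk; rewrite subr0; exact.
rewrite -(cvg_lim (@Rhausdorff R) c); apply: limr_le.
  by apply/cvg_ex; eexists; exact: c.
by near=> n; exact: h.
Unshelve. all: by end_near. Qed.

Lemma LIcos_prod (t : R) n : LI (fun x => cos (t * x)) 1 =
  LI (fun x => cos (t * x)) n.+1 / Jk n.+1 * \prod_(k < n) (1 + t ^+ 2 / k.+1%:R ^+ 2)^-1.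
Proof.
elim: n => [|n IH]; first by rewrite big_ord0 Jk1 divr1 mulr1.
rewrite {}IH big_ord_recr /= [X in _ = _ * X]mulrC mulrA; congr (_ * _).
have c0 := ck_gt0 (ltn0Sn n); have k1 : n.+1%:R != 0 :> R by rewrite pnatr_eq0.
have a0 : 0 < n.+1%:R ^+ 2 + t ^+ 2 by rewrite ltr_pwDl ?sqr_ge0// exprn_gt0.
have eJ : Jk n.+2 = n.+1%:R ^+ 2 * Jk n.+1 / ck n.+1.
  by apply: (mulfI (lt0r_neq0 c0)); rewrite Jk_rec// [RHS]mulrCA mulfV ?mulr1// lt0r_neq0.
have eC : LI (fun x => cos (t * x)) n.+2 =
    (n.+1%:R ^+ 2 + t ^+ 2) * LI (fun x => cos (t * x)) n.+1 / ck n.+1.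
  by apply: (mulfI (lt0r_neq0 c0)); rewrite -LIcos_rec// [RHS]mulrCA mulfV ?mulr1// lt0r_neq0.
have j0 : Jk n.+1 != 0 by rewrite gt_eqF// Jk_gt0.
rewrite eC eJ; move: k1 (lt0r_neq0 c0) (lt0r_neq0 a0).
move: n.+1%:R => K k1 c1 a1.
by field; rewrite j0 k1 c1 a1.
Qed.

(** Euler's product for [pi t / sinh (pi t)]. The factor left over in [LIcos_prod] is the
    characteristic function of the density proportional to [f ^+ k], which lies between
    [1 - t^2 m_k / 2] and [1] and hence tends to [1]. *)
Lemma cvg_LIcos (t : R) : \prod_(k < n) (1 + t ^+ 2 / k.+1%:R ^+ 2)^-1 @[n --> \oo]
  --> LI (fun x => cos (t * x)) 1.
Proof.
pose p n : R := LI (fun x => cos (t * x)) n.+2 / Jk n.+2.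
have p1 : p n @[n --> \oo] --> (1 : R).
  have h : t ^+ 2 / 2 * mk n.+2 @[n --> \oo] --> (0 : R).
    by rewrite -(mulr0 (t ^+ 2 / 2)); apply: cvgM cvg_mk; exact: cvg_cst.
  have h1 : 1 - t ^+ 2 / 2 * mk n.+2 @[n --> \oo] --> (1 : R).
    by rewrite -[X in _ --> X]subr0; apply: cvgB h; exact: cvg_cst.
  apply: squeeze_cvgr h1 (cvg_cst _); near=> n.
  have j0 := Jk_gt0 (ltn0Sn n.+1).
  have i0 := integrable_X0 (ltn0Sn n.+1).
  have ic := integrable_LI (ltn0Sn n.+1) (continuous_cosM (t := t)) (cosM_bound t).
  have i2 := @integrable_Xn 2 n.+2 isT isT.
  have i3 := integrableZl measurableT (t ^+ 2 / 2) i2.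
  apply/andP; split; last first.
    rewrite ler_pdivrMr// mul1r; apply: le_Rintegral => // x _.
    by rewrite ler_wpM2r ?exprn_ge0 ?logistic_pdf_ge0// cos_le1.
  rewrite ler_pdivlMr// /mk mulrBl mul1r mulrA divfK ?gt_eqF//.
  rewrite lerBlDr /LI -(RintegralZl _ measurableT i2) -RintegralD//.
  apply: le_Rintegral => //; first exact: integrableD ic i3.
  move=> x _; rewrite [X in _ <= _ + X]mulrA -mulrDl.
  rewrite ler_wpM2r ?exprn_ge0 ?logistic_pdf_ge0//.
  by have := cos_ge (t * x); rewrite exprMn -mulrAC; lra.
rewrite -(cvg_shiftS (fun n => (\prod_(k < n) (1 + t ^+ 2 / k.+1%:R ^+ 2)^-1 : R))).
have p2 : LI (fun x => cos (t * x)) 1 / p n @[n --> \oo] --> LI (fun x => cos (t * x)) 1.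
  rewrite -[X in _ --> X]divr1; apply: cvgM; first exact: cvg_cst.
  by apply: cvgV.
apply: cvg_trans p2; apply: near_eq_cvg; near=> n.
rewrite (LIcos_prod t n.+1) -/(p n) mulrAC mulfV ?mul1r//.
by near: n; apply: cvgr_neq0 p1 _; rewrite oner_eq0.
Unshelve. all: by end_near. Qed.

End logistic_limits.

(** * The Basel sum through Wallis-type integrals *)

Section basel.
Context {R : realType}.
Notation mu := (@lebesgue_measure R).
Let p : R := pi / 2.
Let I01 : set R := `[0, p]%classic.

Let p_gt0 : 0 < p. Proof. by rewrite divr_gt0// pi_gt0. Qed.

Let int_itv (g : R -> R) : continuous g -> mu.-integrable I01 (EFin \o g).
Proof.
move=> cg; apply: continuous_compact_integrable; first exact: segment_compact.
exact: continuous_subspaceT.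
Qed.

Let ftc (F g : R -> R) : (forall x : R, is_derive x (1 : R) F (g x)) ->
  continuous g -> \int[mu]_(x in I01) g x = F p - F 0.
Proof.
move=> Fg cg; have cF := is_derive_continuous Fg.
rewrite /Rintegral (continuous_FTC2 (F := F))//.
- exact: continuous_subspaceT.
- split => [x _||]; first by case: (Fg x).
    exact/cvg_at_right_filter/cF.
  exact/cvg_at_left_filter/cF.
- by move=> x _; rewrite derive1E; case: (Fg x).
Qed.

Lemma is_derive_cosX m (x : R) : is_derive x (1 : R) (fun x => cos x ^+ m.+1)
  (- m.+1%:R * (cos x ^+ m * sin x)).
Proof.
have -> : (fun x => cos x ^+ m.+1) = (@cos R) ^+ m.+1.
  by apply/funext => y; rewrite exprfctE.
apply: is_derive_eq (is_deriveX m.+1 (is_derive_cos x)) _; rewrite /GRing.scale/=.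
by rewrite mulrN !mulNr mulrA.
Qed.

Let cosX m (x : R) : R := cos x ^+ m.
Let cX m : continuous (cosX m).
Proof.
case: m => [|m]; first by rewrite /cosX; under eq_fun do rewrite expr0; move=> x; exact: cvg_cst.
exact: is_derive_continuous (is_derive_cosX m).
Qed.

(** The ratio of the integrals of [x^2 cos^(2n)] and [cos^(2n)] over [[0, pi / 2]] is [pi^2 / 12] at
    [n = 0], drops by [1 / (2 (n+1)^2)] at each step and tends to [0]. Four times this telescoping
    sum is the series of [cvg_sum_mk]. *)
Let In n := \int[mu]_(x in I01) cosX n.*2 x.
Let Wn n := \int[mu]_(x in I01) (x ^+ 2 * cosX n.*2 x).

Let dw n (x : R) : is_derive x (1 : R) (fun x => - n.*2.+2%:R * (cosX n.*2.+1 x * sin x))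
  (n.*2.+2%:R * n.*2.+1%:R * cosX n.*2 x - n.*2.+2%:R ^+ 2 * cosX n.*2.+2 x).
Proof.
have h := is_derive_cosX n.*2 x; rewrite /cosX.
apply: is_derive_eq; rewrite /GRing.scale/=.
rewrite -(natr1 n.*2.+1) !(exprS (cos x)).
have := cos2Dsin2 x; move: (n.*2.+1%:R) (cos x) (sin x) => a c s h2.
apply/eqP; rewrite -subr_eq0; apply/eqP.
move: (c ^+ n.*2) => z; transitivity ((a + 1) * a * z * (c ^+ 2 + s ^+ 2 - 1)); first by ring.
by rewrite h2 subrr mulr0.
Qed.

Let ddw n (x : R) : is_derive x (1 : R) (cosX n.*2.+2)
  (- n.*2.+2%:R * (cosX n.*2.+1 x * sin x)).
Proof. exact: is_derive_cosX. Qed.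

Let cdw n : continuous (fun x =>
  n.*2.+2%:R * n.*2.+1%:R * cosX n.*2 x - n.*2.+2%:R ^+ 2 * cosX n.*2.+2 x).
Proof. by move=> x; apply: cvgB; apply: cvgM; [exact: cvg_cst|exact: cX|exact: cvg_cst|exact: cX]. Qed.

Let iX n := int_itv (@cX n).
Let c2X n : continuous (fun x : R => x ^+ 2 * cosX n x).
Proof. by move=> x; apply: cvgM; [exact: continuous_exprn|exact: cX]. Qed.
Let i2X n := int_itv (@c2X n).

Let cosp : cos p = 0. Proof. exact: cos_pihalf. Qed.

Let mI : (R.-ocitv.-measurable).-sigma.-measurable I01. Proof. exact: measurable_itv. Qed.

Let In_rec n : n.*2.+1%:R * In n = n.*2.+2%:R * In n.+1.
Proof.
have := ftc (dw n) (@cdw n).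
rewrite /cosX cosp expr0n/= mul0r sin0 !mulr0 subrr.
have i1 := integrableZl mI (n.*2.+2%:R * n.*2.+1%:R) (iX n.*2).
have i2 := integrableZl mI (n.*2.+2%:R ^+ 2) (iX n.*2.+2).
rewrite RintegralB// (RintegralZl _ mI (iX n.*2)) (RintegralZl _ mI (iX n.*2.+2)).
have b0 : n.*2.+2%:R != 0 :> R by rewrite pnatr_eq0.
move=> /eqP; rewrite subr_eq0 => /eqP h.
by apply: (mulfI b0); rewrite mulrA h /In doubleS expr2 -mulrA.
Qed.

Let Wn_rec n : n.*2.+2%:R * n.*2.+1%:R * Wn n =
  n.*2.+2%:R ^+ 2 * Wn n.+1 + 2 * In n.+1.
Proof.
pose b : R := n.*2.+2%:R; pose a : R := n.*2.+1%:R.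
pose F x := x ^+ 2 * (- b * (cosX n.*2.+1 x * sin x)) - 2 * (x * cosX n.*2.+2 x).
pose g x := b * a * (x ^+ 2 * cosX n.*2 x) - b ^+ 2 * (x ^+ 2 * cosX n.*2.+2 x)
  - 2 * cosX n.*2.+2 x.
have Fg (x : R) : is_derive x (1 : R) F (g x).
  have h1 := dw n x; have h2 := ddw n x.
  by rewrite /F; apply: is_derive_eq; rewrite /GRing.scale/= /g /b /a; ring.
have cg : continuous g.
  move=> x; apply: cvgB; first apply: cvgB; apply: cvgM.
  - exact: cvg_cst.
  - exact: c2X.
  - exact: cvg_cst.
  - exact: c2X.
  - exact: cvg_cst.
  - exact: cX.
have := ftc Fg cg.
rewrite /F /cosX cosp !expr0n/= mul0r sin0 !(mulr0, mul0r) !subrr.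
have i1 := integrableZl mI (b * a) (i2X n.*2).
have i2 := integrableZl mI (b ^+ 2) (i2X n.*2.+2).
have i3 := integrableZl mI 2 (iX n.*2.+2).
rewrite /g RintegralB//; last exact: integrableB i1 i2.
rewrite RintegralB// (RintegralZl _ mI (iX n.*2.+2)).
rewrite (RintegralZl _ mI (i2X n.*2)) (RintegralZl _ mI (i2X n.*2.+2)).
by move=> h; rewrite /Wn /In doubleS -/b -/a; move: h; lra.
Qed.

Let In0 : In 0 = p.
Proof.
rewrite /In /cosX; under eq_Rintegral do rewrite expr0.
rewrite Rintegral_cst//= lebesgue_measure_itv/= lte_fin p_gt0 -EFinD/=.
by rewrite subr0 mul1r.
Qed.

Let Wn0 : Wn 0 = p ^+ 3 / 3.
Proof.
have h (x : R) : is_derive x (1 : R) (fun x : R => x ^+ 3 / 3) (x ^+ 2 * cosX 0 x).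
  by apply: is_derive_eq; rewrite /GRing.scale/= /cosX; field.
by rewrite /Wn (ftc h (@c2X 0)) expr0n/= mul0r subr0.
Qed.

Let In_gt0 n : 0 < In n.
Proof.
elim: n => [|n IH]; first by rewrite In0.
have b0 : 0 < n.*2.+2%:R :> R by rewrite ltr0n.
by rewrite -(pmulr_rgt0 _ b0) -In_rec mulr_gt0.
Qed.

Let rn n := Wn n / In n.

Let rn_rec n : rn n = rn n.+1 + (2 * n.+1%:R ^+ 2)^-1.
Proof.
have j0 := lt0r_neq0 (In_gt0 n.+1).
have b0 : n.*2.+2%:R != 0 :> R by rewrite pnatr_eq0.
have a0 : n.*2.+1%:R != 0 :> R by rewrite pnatr_eq0.
have k0 : n.+1%:R != 0 :> R by rewrite pnatr_eq0.
have eb : n.*2.+2%:R = 2 * n.+1%:R :> R by rewrite -doubleS -muln2 natrM mulrC.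
have eI : In n = n.*2.+2%:R * In n.+1 / n.*2.+1%:R.
  by apply: (mulfI a0); rewrite In_rec [RHS]mulrCA mulfV// mulr1.
have eW : Wn n = (n.*2.+2%:R ^+ 2 * Wn n.+1 + 2 * In n.+1) / (n.*2.+2%:R * n.*2.+1%:R).
  by apply: (mulfI (mulf_neq0 b0 a0)); rewrite Wn_rec [RHS]mulrCA mulfV ?mulr1// mulf_neq0.
rewrite /rn eI eW eb; move: k0 a0; move: n.+1%:R n.*2.+1%:R => k a k0 a0.
by field; rewrite j0 k0 a0.
Qed.

Let x_cos_le (x : R) : 0 <= x <= p -> x * cos x <= sin x.
Proof.
move=> /andP[]; rewrite le_eqVlt => /predU1P[<-|x0 xp]; first by rewrite mul0r sin0.
pose G (x : R) := sin x - x * cos x.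
have dG (y : R) : is_derive y (1 : R) G (y * sin y).
  by apply: is_derive_eq; rewrite /GRing.scale/=; ring.
have cG : {within `[0, x], continuous G}.
  by apply: continuous_subspaceT; exact: is_derive_continuous dG.
have [c /[!in_itv]/= /andP[c0 cx]] := MVT x0 (fun y _ => dG y) cG.
rewrite {2}/G sin0 mul0r !subr0 /G => h.
rewrite -subr_ge0 h mulr_ge0 ?(ltW x0)// mulr_ge0 ?(ltW c0)//.
rewrite sin_ge0_pi// (ltW c0)/=; apply: (le_trans (ltW cx)); apply: le_trans xp _.
by rewrite /p ler_pdivrMr// ler_peMr ?pi_ge0// ler1n.
Qed.

(** The square of [x cos x <= sin x] reads [x^2 cos^2 x <= 1 - cos^2 x]; multiply by [cos^(2n)] and
    integrate. *)
Let Wn_le n : Wn n.+1 <= In n - In n.+1.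
Proof.
have i1 := iX n.*2; have i2 := iX n.+1.*2.
rewrite /In /Wn -RintegralB//; apply: le_Rintegral => //.
- exact: integrableB i1 i2.
- move=> x; rewrite /I01/= in_itv/= => xI.
  rewrite /cosX doubleS !(exprS (cos x)).
  have c0 : 0 <= cos x.
    apply: cos_ge0_pihalf; move: xI => /andP[x0 xp]; rewrite xp andbT.
    by apply: le_trans x0; rewrite oppr_le0 ltW.
  have z0 : 0 <= cos x ^+ n.*2 by rewrite exprn_ge0.
  have h := x_cos_le xI; have h2 := cos2Dsin2 x.
  have x0 : 0 <= x by case/andP: xI.
  have xc : (x * cos x) ^+ 2 <= sin x ^+ 2.
    by rewrite lerXn2r ?nnegrE ?mulr_ge0// (le_trans _ h)// mulr_ge0.
  rewrite -subr_ge0 (_ : _ - _ = (sin x ^+ 2 - (x * cos x) ^+ 2) * cos x ^+ n.*2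
     + (1 - (cos x ^+ 2 + sin x ^+ 2)) * cos x ^+ n.*2); last by ring.
  by rewrite h2 subrr mul0r addr0 mulr_ge0// subr_ge0.
Qed.

Let rn_le n : rn n.+1 <= 1 / n.+1%:R.
Proof.
have a0 : 0 < n.*2.+1%:R :> R by rewrite ltr0n.
apply: (@le_trans _ _ (1 / n.*2.+1%:R)); last first.
  by rewrite ler_wpM2l// lef_pV2 ?posrE ?ltr0n// ler_nat ltnS -addnn leq_addr.
rewrite /rn ler_pdivrMr//; apply: le_trans (Wn_le n) _.
have eI : In n = n.*2.+2%:R * In n.+1 / n.*2.+1%:R.
  by apply: (mulfI (lt0r_neq0 a0)); rewrite In_rec [RHS]mulrCA mulfV ?mulr1// lt0r_neq0.
rewrite eI -(natr1 n.*2.+1) le_eqVlt; apply/orP; left; apply/eqP.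
move: (lt0r_neq0 a0); move: (n.*2.+1%:R) => a a1.
by field.
Qed.

Let rn_ge0 n : 0 <= rn n.
Proof.
rewrite divr_ge0 ?(ltW (In_gt0 n))//; apply: Rintegral_ge0 => x _.
by rewrite mulr_ge0 ?sqr_ge0// /cosX -muln2 mulnC exprM exprn_ge0// sqr_ge0.
Qed.

Let rn_sum n : 4 * rn 0 = 4 * rn n + \sum_(k < n) 2 / k.+1%:R ^+ 2.
Proof.
elim: n => [|n IH]; first by rewrite big_ord0 addr0.
rewrite IH big_ord_recr/= rn_rec.
have : n.+1%:R != 0 :> R by rewrite pnatr_eq0.
move: n.+1%:R => k k0; by field.
Qed.

Theorem mk1E : mk 1 = pi ^+ 2 / 3 :> R.
Proof.
have c0 : rn n.+1 @[n --> \oo] --> (0 : R).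
  have h0 : (0 : R) @[n --> \oo] --> (0 : R) by exact: cvg_cst.
  apply: squeeze_cvgr h0 (cvg_div_nat 1); near=> n.
  by rewrite rn_ge0 rn_le.
have c1 : 4 * rn 0 - 4 * rn n.+1 @[n --> \oo] --> 4 * rn 0.
  have := cvgB (cvg_cst (4 * rn 0)) (cvgM (cvg_cst (4 : R)) c0).
  by rewrite mulr0 subr0; exact.
have c2 : \sum_(k < n.+1) 2 / k.+1%:R ^+ 2 @[n --> \oo] --> (mk 1 : R).
  have := @cvg_sum_mk R.
  by rewrite -(cvg_shiftS (fun n => (\sum_(k < n) 2 / k.+1%:R ^+ 2 : R))).
have e : (fun n => 4 * rn 0 - 4 * rn n.+1) = (fun n => \sum_(k < n.+1) 2 / k.+1%:R ^+ 2).
  by apply/funext => n; rewrite (rn_sum n.+1) addrAC subrr add0r.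
rewrite e in c1.
have := cvg_unique (@Rhausdorff R) c1 c2.
have E (q : R) : q != 0 -> 4 * ((q / 2) ^+ 3 / 3 / (q / 2)) = q ^+ 2 / 3.
  by move=> q0; field.
by rewrite /rn Wn0 In0 /p E ?lt0r_neq0 ?pi_gt0// => <-.

Unshelve. all: by end_near. Qed.

End basel.

(** * Independence of sigma-algebras generated by disjoint blocks of indices *)

Section independence.
Local Open Scope ereal_scope.
Context d (T : measurableType d) (R : realType) (P : probability T R).

Definition indep_fun {d1 d2} {U : measurableType d1} {V : measurableType d2}
    (X : T -> U) (Y : T -> V) :=
  forall A B, measurable A -> measurable B ->
    P (X @^-1` A `&` Y @^-1` B) = P (X @^-1` A) * P (Y @^-1` B).

(** Both [A |-> P (A & B)] and [A |-> P A * P B] are finite measures; agreeing on a class stable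
    under intersection and containing the whole space, they agree on the generated sigma-algebra. *)
Lemma indep_g_sigma (C : set (set T)) (B : set T) : setI_closed C -> C setT ->
  C `<=` measurable -> measurable B ->
  (forall A, C A -> P (A `&` B) = P A * P B) ->
  forall A, <<s C >> A -> P (A `&` B) = P A * P B.
Proof.
move=> CI CT Cm mB h A sA.
have PB : P B \is a fin_num by exact: fin_num_measure.
have PB0 : (0 <= fine (P B))%R by rewrite fine_ge0.
have -> : P A * P B = mscale (NngNum PB0) P A.
  by rewrite /mscale/= fineK// muleC.
rewrite -[LHS]/(mrestr P mB A).
apply: (@g_sigma_algebra_measure_unique _ R T C Cm (fun=> setT)) => //.
- by rewrite bigcup_const.
- by move=> D CD; rewrite [RHS](_ : _ = (fine (P B))%:E * P D)// fineK// muleC -h.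
- by move=> k; rewrite (_ : _ < +oo = (P (setT `&` B) < +oo))// setTI ltey_eq PB.
Qed.

Context (I : choiceType) (G : I -> set (set T)).
Hypotheses (GT : forall i, G i setT) (GI : forall i, setI_closed (G i))
  (Gm : forall i, G i `<=` measurable) (indG : mutually_independent P G).

(** The events form a family over the whole index type, trivial off [J] and off a finite list; two
    cylinders can then be compared index by index over one common list. *)
Definition cylinder (J : set I) : set (set T) :=
  [set A | exists (s : seq I) (E : I -> set T),
    [/\ forall i, G i (E i), forall i, ~ J i -> E i = setT,
        forall i, i \notin s -> E i = setT & A = \bigcap_i E i]].

Lemma bigcap_support (s : seq I) (E : I -> set T) :
  (forall i, i \notin s -> E i = setT) ->
  \bigcap_i E i = \big[setI/setT]_(i <- s) E i.
Proof.
move=> Es; rewrite -bigcap_seq; apply/seteqP; split => t h i _; first exact: h.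
by have [is_|/Es ->//] := boolP (i \in s); exact: h.
Qed.

Lemma cylinder_prob (s : seq I) (E : I -> set T) : uniq s ->
  (forall i, G i (E i)) -> (forall i, i \notin s -> E i = setT) ->
  P (\bigcap_i E i) = \prod_(i <- s) P (E i).
Proof. by move=> us GE /bigcap_support ->; exact: indG. Qed.

Lemma cylinderT J : cylinder J setT.
Proof. by exists [::], (fun=> setT); split => //; rewrite bigcapT. Qed.

Lemma cylinderI J : setI_closed (cylinder J).
Proof.
move=> _ _ [s [E [GE JE sE ->]]] [s' [E' [GE' JE' sE' ->]]].
exists (s ++ s'), (fun i => E i `&` E' i); split.
- by move=> i; exact: GI.
- by move=> i Ji; rewrite JE// JE'// setIT.
- by move=> i; rewrite mem_cat negb_or => /andP[/sE -> /sE' ->]; rewrite setIT.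
- by rewrite bigcapI.
Qed.

Lemma cylinder_measurable J : cylinder J `<=` measurable.
Proof.
move=> _ [s [E [GE _ sE ->]]]; rewrite (bigcap_support sE).
by apply: bigsetI_measurable => i _; exact: Gm.
Qed.

Lemma cylinder_indep J K A B : J `&` K = set0 -> cylinder J A -> cylinder K B ->
  P (A `&` B) = P A * P B.
Proof.
move=> JK [s [E [GE JE sE ->]]] [s' [E' [GE' JE' sE' ->]]].
have u := undup_uniq (s ++ s').
have sub i : i \notin undup (s ++ s') -> E i = setT /\ E' i = setT.
  by rewrite mem_undup mem_cat negb_or => /andP[/sE -> /sE' ->].
rewrite -bigcapI (cylinder_prob u)//; last 2 first.
- by move=> i; exact: GI.
- by move=> i /sub[-> ->]; rewrite setIT.
rewrite (cylinder_prob u GE); last by move=> i /sub[].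
rewrite (cylinder_prob u GE'); last by move=> i /sub[].
rewrite -big_split/=; apply: eq_bigr => i _.
have [Ji|Ji] := pselect (J i); last by rewrite JE// setTI probability_setT mul1e.
have Ki : ~ K i by move=> Ki; rewrite -[False]/(set0 i) -JK.
by rewrite JE'// setIT probability_setT mule1.
Qed.

Definition sigma_on (J : set I) : set (set T) := <<s cylinder J >>.

Lemma sigma_on_measurable J : sigma_on J `<=` measurable.
Proof.
apply: smallest_sub; last exact: cylinder_measurable.
exact: sigma_algebra_measurable.
Qed.

Lemma sigma_on_indep J K A B : J `&` K = set0 -> sigma_on J A -> sigma_on K B ->
  P (A `&` B) = P A * P B.
Proof.
move=> JK sA sB.
have mB : measurable B by exact: sigma_on_measurable sB.
apply: (@indep_g_sigma (cylinder J)) sA => //.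
- exact: cylinderI.
- exact: cylinderT.
- exact: cylinder_measurable.
move=> A' cA'; rewrite setIC muleC.
apply: (@indep_g_sigma (cylinder K)) sB => //.
- exact: cylinderI.
- exact: cylinderT.
- exact: cylinder_measurable.
- exact: cylinder_measurable cA'.
by move=> B' cB'; rewrite setIC muleC; exact: (cylinder_indep JK cA' cB').
Qed.

Lemma sigma_onS J K : J `<=` K -> sigma_on J `<=` sigma_on K.
Proof.
move=> JK; apply: smallest_sub; first exact: smallest_sigma_algebra.
move=> A [s [E [GE JE sE ->]]]; apply: sub_sigma_algebra.
by exists s, E; split => // i Ki; apply: JE => /JK.
Qed.

Lemma sigma_on_gen (J : set I) i A : J i -> G i A -> sigma_on J A.
Proof.
move=> Ji GA; apply: sub_sigma_algebra.
exists [:: i], (fun j => if j == i then A else setT); split.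
- by move=> j; case: ifPn => [/eqP ->|].
- by move=> j Jj; case: ifPn => // /eqP ji; rewrite ji in Jj.
- by move=> j; rewrite inE => /negPf ->.
- apply/seteqP; split => [t At j _|t /(_ i Logic.I)]; last by rewrite eqxx.
  by case: ifPn.
Qed.

(** The source is retyped with the sigma-algebra generated by the block [J], so that the closure
    properties of measurable functions apply unchanged. *)
Definition measurable_on J {d'} {U : measurableType d'} (f : T -> U) :=
  measurable_fun setT (f : g_sigma_algebraType (cylinder J) -> U).

Lemma measurable_on_preimage J {d'} {U : measurableType d'} (f : T -> U) A :
  measurable_on J f -> measurable A -> sigma_on J (f @^-1` A).
Proof. by move=> mf mA; rewrite -[X in sigma_on J X]setTI; exact: mf. Qed.

Lemma measurable_onS J K {d'} {U : measurableType d'} (f : T -> U) : J `<=` K ->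
  measurable_on J f -> measurable_on K f.
Proof.
move=> JK mf _ B mB; rewrite setTI; apply: sigma_onS JK _ _.
exact: measurable_on_preimage.
Qed.

Lemma measurable_on_fun J {d'} {U : measurableType d'} (f : T -> U) :
  measurable_on J f -> measurable_fun setT f.
Proof.
move=> mf _ B mB; rewrite setTI; apply: (@sigma_on_measurable J).
exact: measurable_on_preimage.
Qed.

Lemma measurable_on_indep J K {d1 d2} {U : measurableType d1}
    {V : measurableType d2} (f : T -> U) (g : T -> V) : J `&` K = set0 ->
  measurable_on J f -> measurable_on K g -> indep_fun f g.
Proof.
by move=> JK mf mg A B mA mB; apply: sigma_on_indep JK _ _;
  exact: measurable_on_preimage.
Qed.

End independence.

(** * Laws of random variables, decoupling of independent variables, symmetric laws *)

Definition pushp {d d'} {T1 : measurableType d} {T2 : measurableType d'}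
    {R : realType} (P : probability T1 R) (f : T1 -> T2)
    (mf : measurable_fun setT f) : set T2 -> \bar R := pushm P mf.

HB.instance Definition _ {d d'} {T1 : measurableType d} {T2 : measurableType d'}
    {R : realType} (P : probability T1 R) (f : T1 -> T2)
    (mf : measurable_fun setT f) := Measure.on (pushp P mf).

Lemma pushp_setT {d d'} {T1 : measurableType d} {T2 : measurableType d'}
    {R : realType} (P : probability T1 R) (f : T1 -> T2)
    (mf : measurable_fun setT f) : pushp P mf setT = 1%E.
Proof. by rewrite /pushp/= /pushforward preimage_setT probability_setT. Qed.

HB.instance Definition _ {d d'} {T1 : measurableType d} {T2 : measurableType d'}
    {R : realType} (P : probability T1 R) (f : T1 -> T2)
    (mf : measurable_fun setT f) :=
  Measure_isProbability.Build _ _ R (pushp P mf) (pushp_setT P mf).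

Lemma ge0_integral_pushp {d d'} {T1 : measurableType d} {T2 : measurableType d'}
    {R : realType} (P : probability T1 R) (f : T1 -> T2)
    (mf : measurable_fun setT f) (h : T2 -> \bar R) :
  measurable_fun setT h -> (forall x, 0 <= h x)%E ->
  (\int[pushp P mf]_x h x = \int[P]_t h (f t))%E.
Proof. by move=> mh h0; rewrite /pushp /pushm/= ge0_integral_pushforward. Qed.

Section decouple.
Local Open Scope ereal_scope.
Context d (T : measurableType d) (R : realType) (P : probability T R).

Lemma indep_fun_sym {d1 d2} {U : measurableType d1} {V : measurableType d2}
    (X : T -> U) (Y : T -> V) : indep_fun P X Y -> indep_fun P Y X.
Proof. by move=> XY A B mA mB; rewrite setIC muleC; exact: XY. Qed.

Lemma indep_fun_comp {d1 d2 d3 d4} {U : measurableType d1} {V : measurableType d2}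
    {U' : measurableType d3} {V' : measurableType d4}
    (X : T -> U) (Y : T -> V) (f : U -> U') (g : V -> V') :
  measurable_fun setT f -> measurable_fun setT g ->
  indep_fun P X Y -> indep_fun P (f \o X) (g \o Y).
Proof.
move=> mf mg XY A B mA mB.
by apply: (XY (f @^-1` A) (g @^-1` B)); rewrite -[_ @^-1` _]setTI;
  [exact: mf|exact: mg].
Qed.

(** The joint law agrees with the product of the laws on rectangles, hence everywhere; Tonelli then
    separates the variables. *)
Lemma ge0_integral_indep {d1 d2} {U : measurableType d1} {V : measurableType d2}
    (X : T -> U) (Y : T -> V) (h : U * V -> \bar R) :
  measurable_fun setT X -> measurable_fun setT Y -> indep_fun P X Y ->
  measurable_fun setT h -> (forall z, 0 <= h z) ->
  \int[P]_t h (X t, Y t) = \int[P]_t \int[P]_s h (X t, Y s).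
Proof.
move=> mX mY XY mh h0.
have mXY : measurable_fun setT (fun t => (X t, Y t)) by exact: measurable_fun_pair.
rewrite -(ge0_integral_pushp P mXY mh h0).
rewrite (@eq_measure_integral _ _ _ _ (pushp P mX \x pushp P mY)); last first.
  move=> A mA _; apply/esym.
  have H : forall B C, measurable B -> measurable C ->
      pushp P mXY (B `*` C) = pushp P mX B * pushp P mY C.
    by move=> B C mB mC; exact: XY.
  exact: (product_measure_unique H).
rewrite fubini_tonelli1//= ge0_integral_pushp//.
- apply: eq_integral => t _; rewrite /fubini_F ge0_integral_pushp//.
  exact: measurableT_comp.
- exact: measurable_fun_fubini_tonelli_F.
- by move=> x; exact: integral_ge0.
Qed.

Definition has_mean (X : T -> R) (m : R) :=
  P.-integrable setT (EFin \o X) /\ \int[P]_t (X t)%:E = m%:E.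

Lemma has_meanD X Y m n : has_mean X m -> has_mean Y n ->
  has_mean (fun t => X t + Y t)%R (m + n)%R.
Proof.
move=> [iX EX] [iY EY]; split; first exact: (integrableD measurableT iX iY).
by rewrite (integralD_EFin measurableT iX iY) EX EY.
Qed.

Lemma has_meanZ c X m : has_mean X m -> has_mean (fun t => c * X t)%R (c * m)%R.
Proof.
move=> [iX EX]; split; first exact: (integrableZl measurableT c iX).
transitivity (c%:E * \int[P]_t (X t)%:E); last by rewrite EX EFinM.
exact: (integralZl measurableT iX c).
Qed.

Lemma has_mean_ext X Y m n : (forall t, X t = Y t) -> m = n -> has_mean X m -> has_mean Y n.
Proof. by move=> /funext -> ->. Qed.

Lemma has_mean_cst c : has_mean (fun=> c) c.
Proof.
split; first exact: finite_measure_integrable_cst.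
by rewrite integral_cst// -[RHS]mule1; congr *%E; exact: probability_setT.
Qed.

Lemma integrable_dom (X : T -> R) (Y : T -> R) : measurable_fun setT X ->
  P.-integrable setT (EFin \o Y) -> (forall t, `|X t| <= Y t)%R ->
  P.-integrable setT (EFin \o X).
Proof.
move=> mX iY XY; apply: le_integrable iY => //; first exact/measurable_EFinP.
by move=> t _ /=; rewrite lee_fin (le_trans (XY t))// ler_norm.
Qed.

(** Integrability of the product comes from decoupling its absolute value; its mean then comes from
    Fubini for the product of the two laws. *)
Lemma has_meanM X Y m n : indep_fun P X Y -> has_mean X m -> has_mean Y n ->
  has_mean (fun t => X t * Y t)%R (m * n)%R.
Proof.
move=> XY [iX EX] [iY EY].
have /measurable_EFinP mX : measurable_fun setT (EFin \o X) by case/integrableP : iX.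
have /measurable_EFinP mY : measurable_fun setT (EFin \o Y) by case/integrableP : iY.
have m2 : measurable_fun setT (fun z : R * R => z.1 * z.2)%R.
  by apply: measurable_funM; [exact: measurable_fst|exact: measurable_snd].
have iXY : P.-integrable setT (EFin \o (fun t => X t * Y t)%R).
  apply/integrableP; split; first exact/measurable_EFinP/measurable_funM.
  have := @ge0_integral_indep _ _ _ _ X Y (fun z => `|(z.1 * z.2)%:E|) mX mY XY.
  move=> ->//=; last by apply/measurable_EFinP; exact: measurableT_comp.
  have mnY : measurable_fun setT (fun s => `|Y s|%:E).
    by apply/measurable_EFinP; exact: measurableT_comp.
  under eq_integral => t _.
    under eq_integral do rewrite normrM EFinM.
    rewrite ge0_integralZl//.
    over.
  rewrite ge0_integralZr//; last 2 first.
    by apply/measurable_EFinP; exact: measurableT_comp.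
    exact: integral_ge0.
  case/integrableP : iX => _ /= iX; case/integrableP : iY => _ /= iY.
  by apply: lte_mul_pinfty => //; rewrite ?integral_ge0// ge0_fin_numE ?integral_ge0.
split => //.
have mXY : measurable_fun setT (fun t => (X t, Y t)) by exact: measurable_fun_pair.
have H : forall B C, measurable B -> measurable C ->
    pushp P mXY (B `*` C) = pushp P mX B * pushp P mY C.
  by move=> B C mB mC; exact: XY.
have mE : measurable_fun setT (fun z : R * R => (z.1 * z.2)%:E).
  exact/measurable_EFinP.
have iP : (pushp P mXY).-integrable setT (fun z : R * R => (z.1 * z.2)%:E).
  apply/integrableP; split => //; rewrite ge0_integral_pushp//.
    by case/integrableP : iXY.
  exact: measurableT_comp.
have iPP : (pushp P mX \x pushp P mY).-integrable setT (fun z : R * R => (z.1 * z.2)%:E).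
  apply/integrableP; split => //.
  rewrite (@eq_measure_integral _ _ _ _ (pushp P mXY)).
    by case/integrableP : iP.
  by move=> A mA _; exact: (product_measure_unique H).
have i1 Z (mZ : measurable_fun setT Z) : P.-integrable setT (EFin \o Z) ->
    \int[pushp P mZ]_x x%:E = \int[P]_t (Z t)%:E.
  move=> iZ; rewrite /pushp /pushm /= integral_pushforward//.
transitivity (\int[pushp P mXY]_z (z.1 * z.2)%:E).
  by rewrite /pushp /pushm /= integral_pushforward.
rewrite (@eq_measure_integral _ _ _ _ (pushp P mX \x pushp P mY)); last first.
  by move=> A mA _; apply/esym; exact: (product_measure_unique H).
rewrite -integral12_prod_meas1//.
have mEF : measurable_fun setT (fun x : R => x%:E).
  have : measurable_fun setT (EFin \o (fun x : R => x)) by exact/measurable_EFinP.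
  exact.
have iD Z (mZ : measurable_fun setT Z) : P.-integrable setT (EFin \o Z) ->
    (pushp P mZ).-integrable setT (fun x : R => x%:E).
  move=> iZ; apply/integrableP; split => //.
  rewrite ge0_integral_pushp//; first by case/integrableP : iZ.
  exact: measurableT_comp.
have iX' := iD _ mX iX; have iY' := iD _ mY iY.
transitivity (\int[pushp P mX]_x (n%:E * x%:E)).
  apply: eq_integral => x _; rewrite /fubini_F /=.
  rewrite (integralZl measurableT iY')//.
  by rewrite i1// EY muleC.
by rewrite integralZl// i1// EX EFinM muleC.
Qed.

(** Equality of the laws of [X] and [- X], tested on nonnegative functions so that no integrability
    enters. *)
Definition law_sym (X : T -> R) := forall h : R -> \bar R,
  measurable_fun setT h -> (forall x, 0 <= h x) ->
  \int[P]_t h (X t) = \int[P]_t h (- X t)%R.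

(** After decoupling, the sign of [Y] is flipped with [X] frozen, then the sign of [X] with [Y]
    frozen. *)
Lemma law_symD X Y : measurable_fun setT X -> measurable_fun setT Y ->
  indep_fun P X Y -> law_sym X -> law_sym Y -> law_sym (fun t => X t + Y t)%R.
Proof.
move=> mX mY XY sX sY h mh h0.
have mD (e f : R -> R) : measurable_fun setT e -> measurable_fun setT f ->
    measurable_fun setT (fun z : R * R => h (e z.1 + f z.2)%R).
  move=> me mf; apply: measurableT_comp => //; apply: measurable_funD.
    by apply: measurableT_comp => //; exact: measurable_fst.
  by apply: measurableT_comp => //; exact: measurable_snd.
have mN : measurable_fun setT (fun x : R => - x)%R by exact: oppr_measurable.
have mI : measurable_fun setT (fun x : R => x) by [].
rewrite (@ge0_integral_indep _ _ _ _ X Y (fun z => h (z.1 + z.2)%R))//; last exact: (mD (fun x => x) (fun x => x)).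
under [RHS]eq_integral do rewrite opprD.
rewrite (@ge0_integral_indep _ _ _ _ X Y (fun z => h (- z.1 - z.2)%R))//; last exact: (mD _ _ mN mN).
have mh1 (u : R) : measurable_fun setT (fun y => h (u + y)%R).
  by apply: measurableT_comp => //; exact: measurable_funD.
under eq_integral => t _ do rewrite (sY (fun y => h (X t + y)%R))//.
have mh2 (u : R) : measurable_fun setT (fun x : R => h (x + u)%R).
  by apply: measurableT_comp => //; exact: measurable_funD.
have mp : measurable_fun setT (fun z : T * T => (X z.1, Y z.2)).
  apply: measurable_fun_pair; first exact: (measurableT_comp mX measurable_fst).
  exact: (measurableT_comp mY measurable_snd).
have mXY (e f : R -> R) : measurable_fun setT e -> measurable_fun setT f ->
    measurable_fun setT (fun z : T * T => h (e (X z.1) + f (Y z.2))%R).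
  by move=> me mf; exact: (measurableT_comp (mD _ _ me mf) mp).
rewrite (fubini_tonelli (fun z : T * T => h (X z.1 - Y z.2)%R))//=; last exact: (mXY (fun x => x) _ mI mN).
rewrite (fubini_tonelli (fun z : T * T => h (- X z.1 - Y z.2)%R))//=; last exact: (mXY _ _ mN mN).
by apply: eq_integral => s _; rewrite (sX (fun x => h (x - Y s)%R)).
Qed.

Lemma law_symZ c X : measurable_fun setT X -> law_sym X -> law_sym (fun t => c * X t)%R.
Proof.
move=> mX sX h mh h0; rewrite (sX (fun x => h (c * x)%R))//.
  by apply: eq_integral => t _; rewrite mulrN.
by apply: measurableT_comp => //; exact: measurable_funM.
Qed.

(** By symmetry the positive and the negative part of an odd function of [X] have the same
    integral. *)
Lemma law_sym_mean0 (X : T -> R) (g : R -> R) : measurable_fun setT X ->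
  law_sym X -> measurable_fun setT g -> (forall x, g (- x) = - g x)%R ->
  P.-integrable setT (EFin \o (g \o X)) -> has_mean (fun t => g (X t)) 0.
Proof.
move=> mX sX mg gN ig; split => //.
rewrite integralE.
have -> : \int[P]_t (fun t => (g (X t))%:E)^\+ t = \int[P]_t (fun t => (g (X t))%:E)^\- t.
  transitivity (\int[P]_t maxe (g (- X t))%:E 0); last first.
    by apply: eq_integral => t _; rewrite gN funenegE EFinN.
  rewrite -(sX (fun x => maxe (g x)%:E 0))//; last first.
    by move=> x; rewrite le_max lexx orbT.
    by apply: measurable_maxe => //; exact/measurable_EFinP.
  by apply: eq_integral => t _; rewrite funeposE.
rewrite subee//.
exact: integrable_neg_fin_num.
Qed.

End decouple.

(** * Symmetric variables with prescribed variance, fourth cumulant and characteristic function *)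

Section good.
Context d (T : measurableType d) (R : realType) (P : probability T R).

(** Here [k] is the fourth cumulant, so that both [v] and [k] add over independent sums. By symmetry
    the characteristic function [phi] is real and is the mean of a cosine. *)
Record sym_moments (X : T -> R) (v k : R) (phi : R -> R) : Prop := SymMoments {
  sm_meas : measurable_fun setT X;
  sm_sym : law_sym P X;
  sm_2 : has_mean P (fun t => X t ^+ 2) v;
  sm_4 : has_mean P (fun t => X t ^+ 4) (k + 3 * v ^+ 2);
  sm_cos : forall u, has_mean P (fun t => cos (u * X t)) (phi u);
  sm_phi : forall u, 0 <= phi u }.

Lemma sm_odd X (g : R -> R) v k phi : sym_moments X v k phi ->
  measurable_fun setT g -> (forall x, g (- x) = - g x) ->
  (forall x, `|g x| <= 1 + x ^+ 2 + x ^+ 4) -> has_mean P (fun t => g (X t)) 0.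
Proof.
move=> [mX sX h2 h4 _ _] mg gN gb; apply: law_sym_mean0 => //.
have [i _] := has_meanD (has_meanD (has_mean_cst P 1) h2) h4.
by apply: (integrable_dom (measurableT_comp mg mX) i) => t; exact: gb.
Qed.

Lemma sm_1 X v k phi : sym_moments X v k phi -> has_mean P X 0.
Proof.
move=> h; apply: (sm_odd (g := fun x => x) h) => // x.
have : `|x| ^+ 2 = x ^+ 2 by rewrite real_normK ?num_real.
have : 0 <= x ^+ 4 by exact: exprn_even_ge0.
by move: (normr_ge0 x); move: `|x| => y y0 h4 <-; nra.
Qed.

Lemma sm_3 X v k phi : sym_moments X v k phi -> has_mean P (fun t => X t ^+ 3) 0.
Proof.
move=> h; apply: (sm_odd (g := fun x => x ^+ 3) h) => [|x|x].
- exact: measurable_funX.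
- by rewrite exprNn; ring.
- rewrite normrX; have e2 : `|x| ^+ 2 = x ^+ 2 by rewrite real_normK ?num_real.
  have -> : x ^+ 4 = `|x| ^+ 4 by rewrite (_ : 4 = 2 * 2)%N// !exprM e2.
  by rewrite -e2; move: (normr_ge0 x); move: `|x| => y y0; nra.
Qed.

Lemma sm_sin X v k phi u : sym_moments X v k phi ->
  has_mean P (fun t => sin (u * X t)) 0.
Proof.
move=> h; apply: (sm_odd (g := fun x => sin (u * x)) h) => [|x|x].
- by apply: continuous_measurable_fun; exact: continuous_sinM.
- by rewrite mulrN sinN.
- apply: (le_trans (norm_sin_le1 _)).
  by rewrite -addrA lerDl addr_ge0 ?sqr_ge0 ?exprn_even_ge0.
Qed.

Lemma sym_moments0 : sym_moments (fun=> 0) 0 0 (fun=> 1).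
Proof.
split => //.
- by move=> h mh h0; under [RHS]eq_integral do rewrite oppr0.
- by apply: has_mean_ext (has_mean_cst P 0) => // t; rewrite expr0n.
- apply: has_mean_ext (has_mean_cst P 0); first by move=> t; rewrite expr0n.
  by rewrite expr0n/= mulr0 addr0.
- by move=> u; apply: has_mean_ext (has_mean_cst P 1) => // t; rewrite mulr0 cos0.
Qed.

Lemma sym_moments_ext X Y v v' k k' phi phi' : (forall t, X t = Y t) -> v = v' ->
  k = k' -> (forall u, phi u = phi' u) -> sym_moments X v k phi ->
  sym_moments Y v' k' phi'.
Proof. by move=> /funext -> -> -> /funext ->. Qed.

Lemma sym_momentsZ c X v k phi : sym_moments X v k phi ->
  sym_moments (fun t => c * X t) (c ^+ 2 * v) (c ^+ 4 * k) (fun u => phi (u * c)).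
Proof.
move=> [mX sX h2 h4 hc hp]; split => //.
- exact: measurable_funM.
- exact: law_symZ.
- by apply: has_mean_ext (has_meanZ (c ^+ 2) h2) => // t; rewrite exprMn.
- by apply: has_mean_ext (has_meanZ (c ^+ 4) h4) => [t|]; [rewrite exprMn|ring].
- by move=> u; apply: has_mean_ext (hc (u * c)) => // t; rewrite mulrA.
Qed.

(** Cross terms with an odd power, and the product of the sines, have mean [0]. The term [6 X^2 Y^2]
    contributes [6 v w], which completes [3 v^2 + 3 w^2] to [3 (v + w)^2]. *)
Lemma sym_momentsD X Y v w k l phi psi : indep_fun P X Y ->
  sym_moments X v k phi -> sym_moments Y w l psi ->
  sym_moments (fun t => X t + Y t) (v + w) (k + l) (fun u => phi u * psi u).
Proof.
move=> XY hX hY; have [mX sX hX2 hX4 hXc hXp] := hX; have [mY sY hY2 hY4 hYc hYp] := hY.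
have ind (f g : R -> R) : measurable_fun setT f -> measurable_fun setT g ->
    indep_fun P (fun t => f (X t)) (fun t => g (Y t)).
  by move=> mf mg; exact: (indep_fun_comp mf mg XY).
have mXn n : measurable_fun setT (fun x : R => x ^+ n) by exact: measurable_funX.
have mid : measurable_fun setT (fun x : R => x) by [].
have mc u : measurable_fun setT (fun x : R => cos (u * x)).
  by apply: continuous_measurable_fun; exact: continuous_cosM.
have ms u : measurable_fun setT (fun x : R => sin (u * x)).
  by apply: continuous_measurable_fun; exact: continuous_sinM.
have hX1 := sm_1 hX; have hX3 := sm_3 hX; have hY1 := sm_1 hY; have hY3 := sm_3 hY.
split.
- exact: measurable_funD.
- exact: law_symD.
- have h := has_meanD (has_meanD hX2 (has_meanZ 2 (has_meanM XY hX1 hY1))) hY2.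
  by apply: has_mean_ext h => [t|]; ring.
- have h31 := has_meanM (ind _ _ (mXn 3%N) mid) hX3 hY1.
  have h22 := has_meanM (ind _ _ (mXn 2%N) (mXn 2%N)) hX2 hY2.
  have h13 := has_meanM (ind _ _ mid (mXn 3%N)) hX1 hY3.
  have h := has_meanD (has_meanD (has_meanD (has_meanD hX4 (has_meanZ 4 h31))
    (has_meanZ 6 h22)) (has_meanZ 4 h13)) hY4.
  by apply: has_mean_ext h => [t|]; ring.
- move=> u; have hs := has_meanM (ind _ _ (ms u) (ms u)) (sm_sin u hX) (sm_sin u hY).
  have hc := has_meanM (ind _ _ (mc u) (mc u)) (hXc u) (hYc u).
  have h := has_meanD hc (has_meanZ (-1) hs).
  apply: has_mean_ext h => [t|]; last by ring.
  by rewrite mulrDr cosD mulN1r.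
- by move=> u; rewrite mulr_ge0.
Qed.

End good.

(** * Poisson weights and their moments *)

Section poisson.
Context {R : realType}.

Definition poisson_weight (l : R) (p : nat) : R := l ^+ p * p`!%:R^-1 * expR (- l).

Lemma poisson_weight_ge0 l p : 0 <= l -> 0 <= poisson_weight l p.
Proof. by move=> l0; rewrite !mulr_ge0 ?expR_ge0 ?exprn_ge0// invr_ge0. Qed.

Lemma poisson_prob1 (l : R) p : 0 <= l ->
  poisson_prob l 0 [set p] = (poisson_weight l p)%:E.
Proof.
rewrite le_eqVlt => /predU1P[<-|l0].
  (* At rate [0] the Poisson law is the Dirac mass at [0], in agreement with [0 ^+ 0 = 1] in the
     weight. *)
  rewrite /poisson_prob ltxx /poisson_weight oppr0 expR0 mulr1 diracE.
  rewrite expr0n; case: p => [|p]; first by rewrite mem_set// fact0 invr1 mulr1.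
  by rewrite memNset// mul0r.
rewrite /poisson_prob l0 esum_set1 /poisson_pmf ?l0//.
by rewrite lee_fin poisson_weight_ge0// ltW.
Qed.

Lemma poisson_pgf (l c : R) : 0 <= l -> 0 <= c ->
  (\sum_(0 <= p <oo) (c ^+ p * poisson_weight l p)%:E = (expR (l * (c - 1)))%:E)%E.
Proof.
move=> l0 c0.
have -> : expR (l * (c - 1)) = expR (- l) * expR (l * c).
  by rewrite -expRD; congr expR; ring.
under eq_eseriesr => p _.
  rewrite (_ : c ^+ p * _ = expR (- l) * ((l * c) ^+ p * p`!%:R^-1)); last first.
    by rewrite /poisson_weight exprMn; ring.
  rewrite EFinM; over.
rewrite /= nneseriesZl/=; last first.
  by move=> n _; rewrite lee_fin mulr_ge0 ?exprn_ge0 ?mulr_ge0.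
rewrite EFinM; congr *%E; rewrite expRE -EFin_lim; last first.
  rewrite /pseries/=; under eq_fun do rewrite mulrC.
  exact: is_cvg_series_exp_coeff.
apply/congr_lim/funext => n/=; rewrite /pseries/= /series/= -sumEFin//.
by under eq_bigr do rewrite mulrC.
Qed.

Lemma poisson_mass (l : R) : 0 <= l ->
  (\sum_(0 <= p <oo) (poisson_weight l p)%:E = 1)%E.
Proof.
move=> l0; have := poisson_pgf l0 ler01; rewrite subrr mulr0 expR0 => <-.
by apply: eq_eseriesr => p _; rewrite expr1n mul1r.
Qed.

(** The factor [p] cancels against [p!], so [E (N g(N)) = l E g(N + 1)]; taking [g = 1] and then
    [g p = p] gives the first two moments. *)
Lemma poisson_shift (l : R) (g : nat -> R) : 0 <= l -> (forall p, 0 <= g p) ->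
  (\sum_(0 <= p <oo) (p%:R * g p * poisson_weight l p)%:E =
   l%:E * \sum_(0 <= p <oo) (g p.+1 * poisson_weight l p)%:E)%E.
Proof.
move=> l0 g0; rewrite nneseries_recl//; last first.
  by move=> p _; rewrite lee_fin; apply: mulr_ge0 (poisson_weight_ge0 _ l0); apply: mulr_ge0.
rewrite !mul0r add0e -nneseriesZl; last first.
  by move=> p _; rewrite lee_fin; apply: mulr_ge0 (poisson_weight_ge0 _ l0).
rewrite -nneseries_addn ; last first.
  by move=> p; rewrite lee_fin; apply: mulr_ge0 (poisson_weight_ge0 _ l0); apply: mulr_ge0.
apply: eq_eseriesr => p _; rewrite addn1 -EFinM; congr EFin.
rewrite /poisson_weight factS natrM exprS.
have : p.+1%:R != 0 :> R by rewrite pnatr_eq0.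
have : p`!%:R != 0 :> R by rewrite pnatr_eq0 -lt0n fact_gt0.
move: p.+1%:R p`!%:R => a b b0 a0.
by field; rewrite a0 b0.
Qed.

End poisson.

(** * Compound Poisson sums *)

Lemma measurable_fun_index d (T : measurableType d) d' (U : measurableType d')
    (N : T -> nat) (S : nat -> T -> U) : measurable_fun setT N ->
  (forall p, measurable_fun setT (S p)) -> measurable_fun setT (fun t => S (N t) t).
Proof.
move=> mN mS _ B mB; rewrite setTI.
have -> : (fun t => S (N t) t) @^-1` B =
    \bigcup_p (N @^-1` [set p] `&` S p @^-1` B).
  apply/seteqP; split => [t Bt|t [p _ [/= <-]]//]; first by exists (N t).
apply: bigcupT_measurable => p; apply: measurableI.
  by rewrite -[_ @^-1` _]setTI; exact: mN.
by rewrite -[_ @^-1` _]setTI; exact: mS.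
Qed.

Section compound_poisson.
Context d (T : measurableType d) (R : realType) (P : probability T R).
Variables (lam v k : R) (phi : R -> R) (N : T -> nat) (S : nat -> T -> R).
Hypotheses (lam0 : 0 <= lam) (mN : measurable_fun setT N)
  (NE : forall p, P (N @^-1` [set p]) = (poisson_weight lam p)%:E)
  (hS : forall p, sym_moments P (S p) (p%:R * v) (p%:R * k) (fun u => phi u ^+ p))
  (NS : forall p, indep_fun P N (S p)).

Let Y t := S (N t) t.

Let mS p : measurable_fun setT (S p). Proof. by case: (hS p). Qed.

Let mY : measurable_fun setT Y. Proof. exact: measurable_fun_index. Qed.

(** The space is split along the value [p] of [N]: on that event [Y] is [S p], and [S p] is
    independent of [N]. *)
Lemma integral_compound (h : R -> \bar R) : measurable_fun setT h ->
  (forall x, 0 <= h x)%E ->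
  (\int[P]_t h (Y t) =
   \sum_(0 <= p <oo) ((poisson_weight lam p)%:E * \int[P]_t h (S p t)))%E.
Proof.
move=> mh h0.
have mF p : measurable (N @^-1` [set p]) by rewrite -[_ @^-1` _]setTI; exact: mN.
have eT : [set: T] = \bigcup_p (N @^-1` [set p]).
  by apply/seteqP; split => // t _; exists (N t).
have mhY : measurable_fun setT (fun t => h (Y t)) by exact: measurableT_comp.
transitivity (\int[P]_(t in \bigcup_p (N @^-1` [set p])) h (Y t))%E.
  by rewrite -eT.
rewrite ge0_integral_bigcup//; last 2 first.
- exact: measurable_funTS.
- by apply/trivIsetP => i j _ _ ij; apply/seteqP; split => // t [/= -> /eqP]; rewrite (negPf ij).
apply: eq_eseriesr => p _.
transitivity (\int[P]_t (if N t == p then h (S p t) else 0))%E.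
  rewrite integral_mkcond; apply: eq_integral => t _; rewrite patchE.
  case: ifPn => [/set_mem/= <-|/negP Np]; first by rewrite eqxx.
  by case: eqP => // Ntp; case: Np; rewrite inE.
have mE : measurable_fun setT (fun z : nat * R => z.1 == p).
  exact: (measurableT_comp (f := fun n => n == p) _ measurable_fst).
rewrite (@ge0_integral_indep _ _ _ P _ _ _ _ N (S p)
  (fun z => if z.1 == p then h z.2 else 0%E))//; last 2 first.
- apply: measurable_fun_ifT => //.
  exact: measurableT_comp measurable_snd.
- by move=> z; case: ifP.
transitivity (\int[P]_(t in N @^-1` [set p]) (\int[P]_s h (S p s)))%E.
  rewrite [RHS]integral_mkcond; apply: eq_integral => t _; rewrite patchE.
  case: ifPn => [/set_mem/= ->|/negP Np].
    by under eq_integral do rewrite eqxx.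
  have [Ntp|Ntp] := eqVneq (N t) p; first by case: Np; rewrite inE.
  by rewrite integral0.
by rewrite integral_cst// muleC; congr (_ * _)%E; exact: NE.
Qed.

Lemma ge0_has_mean (X : T -> R) m : measurable_fun setT X -> (forall t, 0 <= X t) ->
  (\int[P]_t (X t)%:E = m%:E)%E -> has_mean P X m.
Proof.
move=> mX X0 EX; split => //; apply/integrableP; split; first exact/measurable_EFinP.
by under eq_integral do rewrite /= ger0_norm//; rewrite EX ltry.
Qed.

Lemma poisson_mean : (\sum_(0 <= p <oo) (p%:R * poisson_weight lam p)%:E = lam%:E)%E.
Proof.
have := poisson_shift (g := fun=> 1) lam0 (fun=> ler01).
under eq_eseriesr do rewrite mulr1.
move=> ->; under eq_eseriesr do rewrite mul1r.
by rewrite poisson_mass// mule1.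
Qed.

Lemma poisson_sq : (\sum_(0 <= p <oo) (p%:R ^+ 2 * poisson_weight lam p)%:E
  = (lam + lam ^+ 2)%:E)%E.
Proof.
have w0 p := poisson_weight_ge0 p lam0.
have := poisson_shift (g := fun p => p%:R) lam0 (fun p => ler0n _ p).
under eq_eseriesr do rewrite -expr2.
move=> ->; under eq_eseriesr do rewrite -natr1 mulrDl mul1r EFinD.
rewrite nneseriesD; last 2 first.
- by move=> p _; rewrite lee_fin mulr_ge0.
- by move=> p _; rewrite lee_fin.
by rewrite poisson_mean poisson_mass// -EFinD -EFinM; congr EFin; ring.
Qed.

(** Given [N = p] the fourth moment is [p k + 3 p^2 v^2], and [E N^2 = lam + lam^2]. The fourth
    cumulant is thus [lam] times the fourth moment of one summand, and the characteristic function
    comes from the Poisson generating function. *)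
Theorem sym_moments_compound :
  sym_moments P Y (lam * v) (lam * (k + 3 * v ^+ 2))
    (fun u => expR (lam * (phi u - 1))).
Proof.
have w0 p := poisson_weight_ge0 p lam0.
have phi0 u : 0 <= phi u.
  by case: (hS 1) => _ _ _ _ _ /(_ u); rewrite expr1.
have mX n : measurable_fun setT (fun x : R => (x ^+ n)%:E).
  by apply/measurable_EFinP; exact: measurable_funX.
have v0 : 0 <= v.
  case: (hS 1) => _ _ [_ + ] _ _ _; rewrite mul1r => e.
  by rewrite -lee_fin -e; apply: integral_ge0 => t _; rewrite lee_fin sqr_ge0.
have k0 : 0 <= k + 3 * v ^+ 2.
  case: (hS 1) => _ _ _ [_ + ] _ _; rewrite !mul1r => e.
  by rewrite -lee_fin -e; apply: integral_ge0 => t _; rewrite lee_fin exprn_even_ge0.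
split => //.
- move=> h mh h0.
  have mhN : measurable_fun setT (fun x : R => h (- x)).
    by apply: measurableT_comp => //; exact: oppr_measurable.
  rewrite integral_compound// (integral_compound mhN)//.
  apply: eq_eseriesr => p _; congr *%E.
  by case: (hS p) => _ sp _ _ _ _; exact: sp.
- apply: ge0_has_mean => [|t|]; [exact: measurable_funX|exact: sqr_ge0|].
  rewrite (integral_compound (mX 2%N)); last by move=> x; rewrite lee_fin sqr_ge0.
  under eq_eseriesr => p _.
    case: (hS p) => _ _ [_ ->] _ _ _.
    rewrite (_ : (_ * _)%E = (v%:E * (p%:R * poisson_weight lam p)%:E)%E); last first.
      by rewrite -!EFinM; congr EFin; ring.
    over.
  rewrite nneseriesZl//; last by move=> p _; rewrite lee_fin mulr_ge0.
  by rewrite poisson_mean -EFinM mulrC.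
- apply: ge0_has_mean => [|t|]; [exact: measurable_funX|exact: exprn_even_ge0|].
  rewrite (integral_compound (mX 4%N)); last by move=> x; rewrite lee_fin exprn_even_ge0.
  (* [k] has no sign, so [3 v^2 p] is added on both sides: every series then has nonnegative terms,
     and the finite surplus is subtracted at the end. *)
  have E p : ((poisson_weight lam p)%:E * \int[P]_t (S p t ^+ 4)%:E +
    (3 * v ^+ 2)%:E * (p%:R * poisson_weight lam p)%:E =
    (k + 3 * v ^+ 2)%:E * (p%:R * poisson_weight lam p)%:E + (3 * v ^+ 2)%:E * (p%:R ^+ 2 * poisson_weight lam p)%:E)%E.
    case: (hS p) => _ _ _ [_ ->] _ _.
    by rewrite -!EFinM -!EFinD; congr EFin; ring.
  have S1 : (\sum_(0 <= p <oo) (3 * v ^+ 2)%:E * (p%:R * poisson_weight lam p)%:E = (3 * v ^+ 2 * lam)%:E)%E.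
    rewrite nneseriesZl//; last by move=> p _; rewrite lee_fin mulr_ge0.
    by rewrite poisson_mean.
  have S2 : (\sum_(0 <= p <oo) (k + 3 * v ^+ 2)%:E * (p%:R * poisson_weight lam p)%:E = ((k + 3 * v ^+ 2) * lam)%:E)%E.
    rewrite nneseriesZl//; last by move=> p _; rewrite lee_fin mulr_ge0.
    by rewrite poisson_mean.
  have S3 : (\sum_(0 <= p <oo) (3 * v ^+ 2)%:E * (p%:R ^+ 2 * poisson_weight lam p)%:E = (3 * v ^+ 2 * (lam + lam ^+ 2))%:E)%E.
    rewrite nneseriesZl//; last by move=> p _; rewrite lee_fin mulr_ge0// sqr_ge0.
    by rewrite poisson_sq.
  have v3 : 0 <= 3 * v ^+ 2 by rewrite mulr_ge0// sqr_ge0.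
  have I4 p : (0 <= (poisson_weight lam p)%:E * \int[P]_t (S p t ^+ 4)%:E)%E.
    by rewrite mule_ge0 ?lee_fin// integral_ge0// => t _; rewrite lee_fin exprn_even_ge0.
  have : (\sum_(0 <= p <oo) ((poisson_weight lam p)%:E * \int[P]_t (S p t ^+ 4)%:E)
     + (3 * v ^+ 2 * lam)%:E = (lam * (k + 3 * v ^+ 2) + 3 * (lam * v) ^+ 2)%:E + (3 * v ^+ 2 * lam)%:E)%E.
    rewrite -S1 -nneseriesD//; last first.
      by move=> p _; rewrite mule_ge0 ?lee_fin// mulr_ge0.
    under eq_eseriesr do rewrite E.
    rewrite nneseriesD; last 2 first.
    - by move=> p _; rewrite mule_ge0 ?lee_fin// mulr_ge0.
    - by move=> p _; rewrite mule_ge0 ?lee_fin// mulr_ge0// sqr_ge0.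
    by rewrite S1 S2 S3 -!EFinD; congr EFin; ring.
  by move=> /(congr1 (fun x => x - (3 * v ^+ 2 * lam)%:E)%E); rewrite !addeK.
- move=> u.
  have mc : measurable_fun setT (fun x : R => (1 + cos (u * x))%:E).
    apply/measurable_EFinP; apply: measurable_funD => //.
    by apply: continuous_measurable_fun; exact: continuous_cosM.
  have c0 x : 0 <= 1 + cos (u * x) by have := cos_geN1 (u * x); lra.
  (* The cosine is shifted by [1] to be nonnegative, as [integral_compound] demands. *)
  have h1 : has_mean P (fun t => 1 + cos (u * Y t)) (1 + expR (lam * (phi u - 1))).
    apply: ge0_has_mean => [|t|] //.
      have : measurable_fun setT (fun x : R => 1 + cos (u * x)) by exact/measurable_EFinP.
      by move=> m; exact: (measurableT_comp m mY).
    rewrite (integral_compound mc) => [|x]; last by rewrite lee_fin.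
    under eq_eseriesr => p _.
      case: (hS p) => _ _ _ _ /(_ u)/(has_meanD (has_mean_cst P 1))[_ ->] _.
      rewrite -EFinM mulrDr mulr1 EFinD mulrC.
      over.
    rewrite nneseriesD; last 2 first.
    - by move=> p _; rewrite lee_fin.
    - by move=> p _; rewrite lee_fin mulr_ge0// exprn_ge0.
    by rewrite poisson_mass// poisson_pgf// EFinD.
  by apply: has_mean_ext (has_meanD h1 (has_mean_cst P (-1))) => [t|]; ring.
Qed.

End compound_poisson.

(** * Integration against a measure given by a density *)

Section density.
Local Open Scope ereal_scope.
Context d (T : measurableType d) (R : realType).
Variables (mu nu : {measure set T -> \bar R}) (f : T -> R).
Hypotheses (mf : measurable_fun setT f) (f0 : forall x, (0 <= f x)%R)
  (nuE : forall V, measurable V -> nu V = \int[mu]_(x in V) (f x)%:E).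

Import HBNNSimple.

Let indic_density A : measurable A ->
  \int[nu]_x (\1_A x)%:E = \int[mu]_x (\1_A x * f x)%:E.
Proof.
move=> mA; rewrite integral_indic// setIT nuE//.
rewrite integral_mkcond; apply: eq_integral => x _.
by rewrite patchE indicE; case: ifPn => _; rewrite ?mul1r ?mul0r.
Qed.

Let nnsfun_density (g : {nnsfun T >-> R}) :
  \int[nu]_x (g x)%:E = \int[mu]_x (g x * f x)%:E.
Proof.
have mI k : measurable (g @^-1` [set k]) by rewrite -[_ @^-1` _]setTI; exact: measurable_funP.
have m1 k : measurable_fun setT (fun x => (k * \1_(g @^-1` [set k]) x)%:E).
  by apply/measurable_EFinP/measurable_funM => //; exact: measurable_indic.
have m2 k : measurable_fun setT (fun x => (k * \1_(g @^-1` [set k]) x)%:E * (f x)%:E).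
  by apply: emeasurable_funM => //; exact/measurable_EFinP.
have gE x : (g x)%:E = \sum_(k \in range g) (k * \1_(g @^-1` [set k]) x)%:E.
  by rewrite fimfunE -fsumEFin.
under eq_integral do rewrite gE.
under [RHS]eq_integral => x _.
  rewrite EFinM gE ge0_mule_fsuml; last by move=> k; exact: nnfun_muleindic_ge0.
  over.
rewrite !ge0_integral_fsum//; last 2 first.
- by move=> k x _; apply: mule_ge0; rewrite ?lee_fin//; exact: nnfun_muleindic_ge0.
- by move=> k x _; exact: nnfun_muleindic_ge0.
apply: eq_fsbigr => k /set_mem[x _ <-].
under eq_integral do rewrite EFinM.
under [RHS]eq_integral do rewrite EFinM -muleA.
have mi : measurable_fun setT (fun y => (\1_(g @^-1` [set g x]) y : R)%:E).
  by apply/measurable_EFinP; exact: measurable_indic.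
have mif : measurable_fun setT
    (fun y => (\1_(g @^-1` [set g x]) y : R)%:E * (f y)%:E).
  by apply: emeasurable_funM => //; exact/measurable_EFinP.
rewrite ge0_integralZl ?lee_fin// [RHS]ge0_integralZl ?lee_fin//; last first.
  by move=> y _; rewrite mule_ge0 ?lee_fin.
by rewrite indic_density.
Qed.

Lemma ge0_integral_density (g : T -> \bar R) : measurable_fun setT g ->
  (forall x, 0 <= g x) -> \int[nu]_x g x = \int[mu]_x (g x * (f x)%:E).
Proof.
move=> mg g0; pose g_ := nnsfun_approx measurableT mg.
have cg x : (g_ n x)%:E @[n --> \oo] --> g x by exact: cvg_nnsfun_approx.
have nd x : {homo (fun n => (g_ n x)%:E) : a b / (a <= b)%N >-> a <= b}.
  by move=> a b ab; rewrite lee_fin; exact/lefP/nd_nnsfun_approx.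
have mg_ n : measurable_fun setT (fun x => (g_ n x)%:E) by exact/measurable_EFinP.
transitivity (limn (fun n => \int[nu]_x (g_ n x)%:E)).
  rewrite -monotone_convergence//.
  - by apply: eq_integral => x _; apply/esym/cvg_lim => //; exact: cg.
  - by move=> n x _; rewrite lee_fin.
under eq_fun do rewrite nnsfun_density.
under [in LHS]eq_fun do under eq_integral do rewrite EFinM.
rewrite -monotone_convergence//.
- apply: eq_integral => x _; apply/cvg_lim => //.
  by apply: cvgeZr => //; exact: cg.
- by move=> n; apply: emeasurable_funM => //; exact/measurable_EFinP.
- by move=> n x _; rewrite mule_ge0 ?lee_fin.
- by move=> x _ a b ab; rewrite lee_wpmul2r ?lee_fin//; exact: nd.
Qed.

End density.

(** * Moments and characteristic function of a Logistic random variable *)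

Section logistic_variable.
Context d (T : measurableType d) (R : realType) (P : probability T R).
Notation mu := (@lebesgue_measure R).
Local Notation f := (@logistic_pdf R).
Variable X : T -> R.
Hypotheses (mX : measurable_fun setT X)
  (lawX : forall B, measurable B -> P (X @^-1` B) = logistic_prob B).

Lemma ge0_integral_logistic (g : R -> \bar R) : measurable_fun setT g ->
  (forall x, 0 <= g x)%E ->
  (\int[P]_t g (X t) = \int[mu]_x (g x * (f x)%:E))%E.
Proof.
move=> mg g0; rewrite -(ge0_integral_pushp (T2 := measurableTypeR R) P mX)//.
apply: (@ge0_integral_density _ _ R mu (pushp (T2 := measurableTypeR R) P mX) f) => //.
- exact: (continuous_measurable_fun (is_derive_continuous (@is_derive_logistic_pdf R))).
- exact: logistic_pdf_ge0.
Qed.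

Lemma has_mean_logistic (g : R -> R) (D : R) : continuous g ->
  (forall x, 0 <= g x) -> (forall x, g x <= D * (1 + x ^+ 2) ^+ 2) ->
  has_mean P (fun t => g (X t)) (LI g 1).
Proof.
move=> cg g0 gD; have mg := continuous_measurable_fun cg.
apply: ge0_has_mean => //; first exact: (measurableT_comp mg mX).
rewrite (ge0_integral_logistic (g := EFin \o g))//; last exact/measurable_EFinP.
have gD' x : `|g x| <= D * (1 + x ^+ 2) ^+ 2 by rewrite ger0_norm.
have i := integrable_LI (ltn0Sn 0) cg gD'.
rewrite /LI /Rintegral fineK; last exact: integrable_fin_num i.
by apply: eq_integral => x _; rewrite expr1 EFinM.
Qed.

Lemma law_sym_logistic : law_sym P X.
Proof.
move=> h mh h0.
have mhN : measurable_fun setT (fun x : R => h (- x)).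
  by apply: measurableT_comp => //; exact: oppr_measurable.
rewrite ge0_integral_logistic// (ge0_integral_logistic mhN)//.
have mf : measurable_fun setT f.
  exact: (continuous_measurable_fun (is_derive_continuous (@is_derive_logistic_pdf R))).
have mN : measurable_fun setT (-%R : R -> R) by exact: oppr_measurable.
have mF : measurable_fun setT (fun x => h x * (f x)%:E)%E.
  by apply: emeasurable_funM => //; exact/measurable_EFinP.
transitivity (\int[pushm (T2 := measurableTypeR R) mu mN]_x (h x * (f x)%:E))%E.
  by apply: eq_measure_integral => A mA _; exact/esym/lebesgue_measureN.
rewrite /pushm/= ge0_integral_pushforward//; last first.
  by move=> x _; rewrite mule_ge0// lee_fin logistic_pdf_ge0.
by apply: eq_integral => x _; rewrite /= logistic_pdf_even.
Qed.

Lemma mk1_LI : LI (fun x : R => x ^+ 2) 1 = mk 1.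
Proof. by rewrite /mk Jk1 divr1. Qed.

Lemma qk1_LI : LI (fun x : R => x ^+ 4) 1 = qk 1.
Proof. by rewrite /qk Jk1 divr1. Qed.

Lemma sym_moments_logistic : sym_moments P X (pi ^+ 2 / 3)
  (qk 1 - 3 * (pi ^+ 2 / 3) ^+ 2) (fun u => LI (fun x => cos (u * x)) 1).
Proof.
have ccos u : continuous (fun x : R => cos (u * x)) by exact: continuous_cosM.
have bnd (x c : R) : 0 <= c -> c <= 2 -> c <= 2 * (1 + x ^+ 2) ^+ 2.
  move=> c0 c2; apply: le_trans c2 _; rewrite ler_peMr// exprn_ege1// lerDl.
  exact: sqr_ge0.
split => //.
- exact: law_sym_logistic.
- rewrite -mk1E -mk1_LI; apply: (@has_mean_logistic (fun x => x ^+ 2) 1).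
  + exact: continuous_exprn.
  + by move=> x; exact: sqr_ge0.
  + by move=> x; rewrite mul1r (le_trans (ler_norm _))// exprn_bound.
- rewrite subrK -qk1_LI; apply: (@has_mean_logistic (fun x => x ^+ 4) 1).
  + exact: continuous_exprn.
  + by move=> x; exact: exprn_even_ge0.
  + by move=> x; rewrite mul1r (le_trans (ler_norm _))// exprn_bound.
- move=> u; have h := @has_mean_logistic (fun x => 1 + cos (u * x)) 2.
  have c1 : continuous (fun x : R => 1 + cos (u * x)).
    by move=> x; apply: cvgD; [exact: cvg_cst|exact: ccos].
  have c0 x : 0 <= 1 + cos (u * x) by have := cos_geN1 (u * x); lra.
  have c2 x : 1 + cos (u * x) <= 2 * (1 + x ^+ 2) ^+ 2.
    by apply: bnd => //; have := cos_le1 (u * x); lra.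
  apply: has_mean_ext (has_meanD (h c1 c0 c2) (has_mean_cst P (-1))) => [t|].
    by ring.
  have i0 := @integrable_X0 R 1 isT.
  have ic := integrable_LI (ltn0Sn 0) (ccos u) (cosM_bound u).
  rewrite /LI; under eq_Rintegral do rewrite mulrDl.
  rewrite RintegralD// -/(LI (fun=> 1) 1) Jk1; ring.
(* The characteristic function is nonnegative as a limit of products of positive factors. *)
- move=> u; rewrite -(cvg_lim (@Rhausdorff R) (@cvg_LIcos R u)); apply: limr_ge.
    by apply/cvg_ex; eexists; exact: (@cvg_LIcos R u).
  near=> n; apply: prodr_ge0 => i _; rewrite invr_ge0 addr_ge0// divr_ge0 ?sqr_ge0//.
Unshelve. all: by end_near. Qed.

End logistic_variable.

(** * The levels of the logistic expansion *)

Section levy_model.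
Context (R : realType) d (T : measurableType d) (P : probability T R) (a : R)
  (X : T -> R) (Xnk : nat -> nat -> T -> R) (Pn : nat -> T -> nat).
Hypotheses (mX : measurable_fun setT X)
  (mXnk : forall n k, measurable_fun setT (Xnk n k))
  (lawX : forall n k B, measurable B -> P (Xnk n k @^-1` B) = logistic_prob B)
  (mPn : forall n (U : set nat), measurable (Pn n @^-1` U))
  (lawP : forall n (U : set nat),
     P (Pn n @^-1` U) = poisson_prob (a ^+ 2 * 2 ^+ n / 2) 0 U)
  (ind : mutually_independent P (levents X Xnk Pn)).

Let G : (option ((nat * nat) + nat)%type : choiceType) -> set (set T) :=
  levents X Xnk Pn.
Let indG : mutually_independent P G. Proof. exact: ind. Qed.

Let GT i : G i setT.
Proof.
by case: i => [[[n k]|n]|]; exists setT; rewrite ?preimage_setT//=; exact: measurableT.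
Qed.

Let GI i : setI_closed (G i).
Proof.
case: i => [[[n k]|n]|] _ _ [B mB <-] [C mC <-]; exists (B `&` C) => //=;
  by [exact: measurableI|rewrite preimage_setI].
Qed.

Let Gm i : G i `<=` measurable.
Proof.
case: i => [[[n k]|n]|] _ [B mB <-].
- by rewrite -[_ @^-1` _]setTI; exact: mXnk.
- exact: mPn.
- by rewrite -[_ @^-1` _]setTI; exact: mX.
Qed.

(** [X] belongs to no level; the summands and the Poisson count with index [n] form level [n].
    Independence is later used between disjoint sets of levels, and within a level. *)
Let lvl (i : lidx) : option nat :=
  match i with None => None | Some (inl (n, _)) => Some n | Some (inr n) => Some n end.

Let mon_gen d' (U : measurableType d') (f : T -> U) J i : J i ->
  (forall B, measurable B -> G i (f @^-1` B)) -> measurable_on G J f.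
Proof.
move=> Ji fG _ B mB; rewrite setTI.
exact: (sigma_on_gen GT Ji (fG B mB)).
Qed.

Let monX J n k : J (Some (inl (n, k))) -> measurable_on G J (Xnk n k).
Proof. by move=> Ji; apply: mon_gen Ji _ => B mB; exists B. Qed.

Let monX0 J : J None -> measurable_on G J X.
Proof. by move=> Ji; apply: mon_gen Ji _ => B mB; exists B. Qed.

Let monP J n : J (Some (inr n)) -> measurable_on G J (Pn n).
Proof. by move=> Ji; apply: mon_gen Ji _ => B mB; exists B. Qed.

Definition row_sum n p t : R := \sum_(k < p) Xnk n k t.
Definition row n t : R := row_sum n (Pn n t) t.
Definition row_range m j t : R := \sum_(m <= n < m + j) (2 ^+ n)^-1 * row n t.
Local Notation lam n := (a ^+ 2 * 2 ^+ n / 2 : R).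

Let monSg J n p (g : nat -> R -> R) : (forall k, measurable_fun setT (g k)) ->
  (forall k, (k < p)%N -> J (Some (inl (n, k)))) ->
  measurable_on G J (fun t => \sum_(k < p) g k (Xnk n k t)).
Proof.
move=> mg; elim: p => [|p IH] Jk.
  by under eq_fun do rewrite big_ord0; exact: measurable_cst.
under eq_fun do rewrite big_ord_recr/=.
apply: measurable_funD; first by apply: IH => k kp; apply: Jk; exact: ltnW.
by apply: measurableT_comp => //; apply: monX; exact: Jk.
Qed.

Let monS J n p : (forall k, (k < p)%N -> J (Some (inl (n, k)))) ->
  measurable_on G J (row_sum n p).
Proof. by move=> Jk; exact: (@monSg J n p (fun=> id)). Qed.

Let monrow J n : (forall i, lvl i = Some n -> J i) -> measurable_on G J (row n).
Proof.
move=> Jn; apply: measurable_fun_index; first by apply: monP; exact: Jn.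
by move=> p; apply: monS => k _; exact: Jn.
Qed.

Let monrange J m j : (forall n i, (m <= n < m + j)%N -> lvl i = Some n -> J i) ->
  measurable_on G J (row_range m j).
Proof.
elim: j => [|j IH] Jn.
  rewrite (_ : row_range m 0 = fun=> 0); first exact: measurable_cst.
  by apply/funext => t; rewrite /row_range addn0 big_geq.
rewrite (_ : row_range m j.+1 = fun t => row_range m j t + (2 ^+ (m + j))^-1 * row (m + j) t); last first.
  by apply/funext => t; rewrite /row_range addnS big_nat_recr// leq_addr.
apply: measurable_funD.
  apply: IH => n i /andP[mn nm]; apply: Jn; rewrite mn/= addnS.
  exact: ltnW.
apply: measurable_funM; first exact: measurable_cst.
by apply: monrow => i; apply: Jn; rewrite leq_addr addnS ltnSn.
Qed.

Lemma lev_partialE N M t : lev_partial X Xnk Pn (N + M) t =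
  lev_partial X Xnk Pn N t + row_range N.+1 M t.
Proof.
rewrite /lev_partial -addrA; congr (_ + _).
rewrite -!(big_mkord xpredT (fun n => (2 ^+ n)^-1 * row n t)) -addSn.
by rewrite (big_cat_nat _ (n := N.+1))//= leq_addr.
Qed.

Lemma lev_partial_range N : lev_partial X Xnk Pn N = fun t => X t + row_range 0 N.+1 t.
Proof.
apply/funext => t; rewrite /lev_partial; congr (_ + _).
by rewrite -(big_mkord xpredT (fun n => (2 ^+ n)^-1 * row n t)).
Qed.

(** Levels above [N] on one side, [X] and the levels up to [N] on the other, use disjoint index
    sets. This is the source of the independence of [Z] from [A_N]. *)
Lemma indep_lev_partial N M : indep_fun P (row_range N.+1 M) (lev_partial X Xnk Pn N).
Proof.
pose J : set (option ((nat * nat) + nat)%type) := [set i | exists2 n, (N < n)%N & lvl i = Some n].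
pose K : set (option ((nat * nat) + nat)%type) := [set i | i = None \/ exists2 n, (n <= N)%N & lvl i = Some n].
apply: (measurable_on_indep GT GI Gm indG (J := J) (K := K)).
- apply/seteqP; split => // i [[n Nn ln] [iN|[m mN lm]]]; first by rewrite iN in ln.
  by move: lm; rewrite ln => -[nm]; rewrite -nm leqNgt Nn in mN.
- by apply: monrange => n i /andP[Nn _] li; exists n.
- rewrite lev_partial_range; apply: measurable_funD; first by apply: monX0; left.
  by apply: monrange => n i /andP[_ nN] li; right; exists n.
Qed.

Lemma measurable_row_range m j : measurable_fun setT (row_range m j).
Proof.
apply: (measurable_on_fun Gm (J := setT)).
by apply: monrange.
Qed.

Lemma measurable_row n : measurable_fun setT (row n).
Proof. by apply: (measurable_on_fun Gm (J := setT)); exact: monrow. Qed.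

Lemma measurable_lev_partial N : measurable_fun setT (lev_partial X Xnk Pn N).
Proof.
rewrite lev_partial_range; apply: measurable_funD => //.
exact: measurable_row_range.
Qed.

Definition phiX (u : R) : R := LI (fun x => cos (u * x)) 1.

(** The functions [g k] are arbitrary so that the same lemma serves the rows themselves and the
    weighted [softplus] sums of the mixing variable. *)
Lemma indep_row_sum n p (g : nat -> R -> R) : (forall k, measurable_fun setT (g k)) ->
  indep_fun P (fun t => \sum_(k < p) g k (Xnk n k t)) (Xnk n p).
Proof.
move=> mg; pose J : set (option ((nat * nat) + nat)%type) :=
  [set i | exists2 k, (k < p)%N & i = Some (inl (n, k))].
apply: (measurable_on_indep GT GI Gm indG (J := J) (K := [set Some (inl (n, p))])).
- by apply/seteqP; split => // i [[k kp ->] [kpE]]; rewrite kpE ltnn in kp.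
- by apply: monSg => // k kp; exists k.
- exact: monX.
Qed.

Lemma sym_moments_row_sum n p : sym_moments P (row_sum n p)
  (p%:R * (pi ^+ 2 / 3)) (p%:R * (qk 1 - 3 * (pi ^+ 2 / 3) ^+ 2))
  (fun u => phiX u ^+ p).
Proof.
elim: p => [|p IH].
  apply: sym_moments_ext (sym_moments0 P) => [t|||u]; rewrite ?mul0r ?expr0//.
  by rewrite /row_sum big_ord0.
have h := sym_moments_logistic (mXnk n p) (@lawX n p).
have I : indep_fun P (row_sum n p) (Xnk n p) .
  exact: (@indep_row_sum n p (fun=> id)).
apply: sym_moments_ext (sym_momentsD I IH h) => [t|||u].
- by rewrite /row_sum big_ord_recr.
- by rewrite -natr1; ring.
- by rewrite -natr1; ring.
- by rewrite exprSr.
Qed.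

Lemma sym_moments_row n : sym_moments P (row n) (lam n * (pi ^+ 2 / 3))
  (lam n * qk 1) (fun u => expR (lam n * (phiX u - 1))).
Proof.
have l0 : 0 <= lam n by rewrite divr_ge0// mulr_ge0 ?sqr_ge0// exprn_ge0.
have mP : measurable_fun setT (Pn n) by move=> _ B _; rewrite setTI; exact: mPn.
have NE p : P (Pn n @^-1` [set p]) = (poisson_weight (lam n) p)%:E.
  by rewrite lawP poisson_prob1.
have NS p : indep_fun P (Pn n) (row_sum n p).
  pose J : set (option ((nat * nat) + nat)%type) := [set i | exists2 k, (k < p)%N & i = Some (inl (n, k))].
  apply: (measurable_on_indep GT GI Gm indG (J := [set Some (inr n)]) (K := J)).
  - by apply/seteqP; split => // i [/= -> [k _]].
  - exact: monP.
  - by apply: monS => k kp; exists k.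
have := sym_moments_compound l0 mP NE (sym_moments_row_sum n) NS.
by apply: sym_moments_ext => //; ring.
Qed.

Definition range_cf m j (u : R) : R :=
  \prod_(m <= n < m + j) expR (lam n * (phiX (u * (2 ^+ n)^-1) - 1)).

(** Level [n] contributes [4^-n] times its variance, of order [2^-n], and [16^-n] times its fourth
    cumulant, that is [(a^2 / 2) 8^-n qk 1]. The ratio [1 / 8] turns the factor [1 / 2] into
    [1 / 2 * 8 / 7 = 4 / 7]. *)
Lemma sym_moments_range m j : sym_moments P (row_range m j)
  (a ^+ 2 * (pi ^+ 2 / 3) * ((2 ^+ m)^-1 - (2 ^+ (m + j))^-1))
  (4 / 7 * a ^+ 2 * qk 1 * ((8 ^+ m)^-1 - (8 ^+ (m + j))^-1))
  (range_cf m j).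
Proof.
elim: j => [|j IH].
  apply: sym_moments_ext (sym_moments0 P) => [t|||u]; rewrite ?addn0 ?subrr ?mulr0//.
    by rewrite /row_range addn0 big_geq.
  by rewrite /range_cf addn0 big_geq.
have h := sym_momentsZ (2 ^+ (m + j))^-1 (sym_moments_row (m + j)).
have I : indep_fun P (row_range m j) (fun t => (2 ^+ (m + j))^-1 * row (m + j) t).
  pose J : set (option ((nat * nat) + nat)%type) := [set i | exists2 n, (m <= n < m + j)%N & lvl i = Some n].
  pose K : set (option ((nat * nat) + nat)%type) := [set i | lvl i = Some (m + j)%N].
  apply: (measurable_on_indep GT GI Gm indG (J := J) (K := K)).
  - apply/seteqP; split => // i [[n /andP[_ nj] ln]]; rewrite /K/= ln => -[nE].
    by rewrite nE ltnn in nj.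
  - by apply: monrange => n i nm li; exists n.
  - apply: measurable_funM; first exact: measurable_cst.
    by apply: monrow.
apply: sym_moments_ext (sym_momentsD I IH h) => [t|||u].
- by rewrite /row_range addnS big_nat_recr// leq_addr.
- rewrite addnS (exprS 2); have : 2 ^+ (m + j) != 0 :> R by rewrite expf_neq0.
  have : 2 ^+ m != 0 :> R by rewrite expf_neq0.
  move: (2 ^+ (m + j)) (2 ^+ m) => x y y0 x0.
  by field; rewrite x0 y0.
- rewrite addnS (exprS 8).
  have -> : 8 ^+ (m + j) = (2 ^+ (m + j)) ^+ 3 :> R.
    by rewrite -exprM mulnC exprM; congr (_ ^+ _); ring.
  have : 8 ^+ m != 0 :> R by rewrite expf_neq0.
  have : 2 ^+ (m + j) != 0 :> R by rewrite expf_neq0.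
  move: (2 ^+ (m + j)) (8 ^+ m) => x y x0 y0.
  by field; rewrite x0 y0.
- by rewrite /range_cf addnS big_nat_recr// leq_addr.
Qed.

End levy_model.

(** * Measurability of pointwise limits and a weighted Cauchy-Schwarz inequality *)

Lemma getPN_lim (R : realType) (u : nat -> R) : ~ cvgn u -> limn u = point.
Proof.
move=> nu; apply: getPN => l ul; apply: nu; apply/cvg_ex; exists l.
exact: ul.
Qed.

(** The set of convergence is measurable by the Cauchy criterion with countably many tolerances; off
    it [limn] takes the constant default value [point]. *)
Lemma measurable_fun_limn d (T : measurableType d) (R : realType)
    (f : nat -> T -> R) : (forall n, measurable_fun setT (f n)) ->
  measurable_fun setT (fun t => limn (f ^~ t)).
Proof.
move=> mf.
pose C : set T := [set t | cvgn (f ^~ t)].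
have CE : C = \bigcap_k \bigcup_n \bigcap_m
    [set t | `|f n t - f (n + m)%N t| < k.+1%:R^-1].
  apply/seteqP; split => [t /= /cvg_ex[/= l fl] k _|t Ct].
    have e0 : 0 < k.+1%:R^-1 / 2 :> R by rewrite divr_gt0// invr_gt0.
    have /cvgrPdist_lt/(_ _ e0)[n _ hn] := fl.
    exists n => // m _ /=.
    have h1 := hn n (leqnn n); have h2 := hn (n + m)%N (leq_addr m n).
    rewrite (_ : _ - _ = (l - f (n + m)%N t) - (l - f n t)); last by ring.
    by rewrite (le_lt_trans (ler_normB _ _))// [ltRHS]splitr ltrD.
  apply/cauchy_cvgP/cauchy_exP => e e0.
  have [k ke] : exists k, k.+1%:R^-1 < e.
    by have [k] := ltr_add_invr e0; rewrite add0r; exists k.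
  have [n _ hn] := Ct k Logic.I.
  exists (f n t); exists n => // m /= nm; rewrite /ball/=.
  by apply: lt_trans ke; have := hn (m - n)%N Logic.I; rewrite /= subnKC.
have mC : measurable C.
  rewrite CE; apply: bigcapT_measurable => k; apply: bigcupT_measurable => n.
  apply: bigcapT_measurable => m.
  have mg : measurable_fun setT (fun t => `|f n t - f (n + m)%N t|).
    by apply: measurableT_comp => //; exact: measurable_funB.
  rewrite -[X in measurable X]setTI.
  rewrite (_ : [set t | _] = (fun t => `|f n t - f (n + m)%N t|) @^-1` `]-oo, k.+1%:R^-1[).
    exact: mg.
  by apply/seteqP; split => t /=; rewrite in_itv.
pose g n t : R := if t \in C then f n t else point.
apply: (measurable_fun_cvg (h := g)).
  move=> n; apply: measurable_fun_if => //.
  - apply: (measurable_fun_bool true); rewrite setTI.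
    rewrite (_ : _ @^-1` _ = C)//; apply/seteqP; split => t /=.
      by move=> /set_mem.
    by move=> Ct; exact: mem_set.
  - exact: measurable_funS (mf n).
move=> t _; have [Ct|Ct] := pselect (C t).
  by rewrite /g mem_set.
rewrite /g memNset// getPN_lim//; exact: cvg_cst.
Qed.

Lemma Cauchy_Schwarz_step (R : realType) (x z s w a b : R) : 0 <= s -> 0 <= w ->
  0 <= a -> 0 <= b -> x ^+ 2 <= s * w -> z ^+ 2 <= a * b ->
  (x + z) ^+ 2 <= (s + a) * (w + b).
Proof.
move=> s0 w0 a0 b0 h1 h2.
have : (2 * x * z) ^+ 2 <= (s * b + a * w) ^+ 2.
  apply: (@le_trans _ _ (4 * ((s * w) * (a * b)))).
    have -> : (2 * x * z) ^+ 2 = 4 * (x ^+ 2 * z ^+ 2) by ring.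
    by rewrite ler_wpM2l// ler_pM// sqr_ge0.
  by have := sqr_ge0 (s * b - a * w); nra.
rewrite -ler_sqrt ?sqr_ge0// !sqrtr_sqr => h3.
have := le_trans (ler_norm _) h3.
rewrite ger0_norm ?addr_ge0 ?mulr_ge0//; nra.
Qed.

(** Cauchy-Schwarz with weights [(3 / 4) ^+ n], whose partial sums are at most [4]. *)
Lemma weighted_sum_sq (R : realType) (y : nat -> R) j :
  (\sum_(n < j) `|y n|) ^+ 2 <= 4 * \sum_(n < j) (4 / 3) ^+ n * y n ^+ 2.
Proof.
pose s m : R := \sum_(n < m) (3 / 4) ^+ n.
have s4 m : s m <= 4.
  suff -> : s m = 4 * (1 - (3 / 4) ^+ m).
    have : 0 <= (3 / 4 : R) ^+ m by exact: exprn_ge0.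
    by lra.
  elim: m => [|m IH]; first by rewrite /s big_ord0 expr0; ring.
  by rewrite /s big_ord_recr/= -/(s m) IH exprS; field.
have w0 m : 0 <= \sum_(n < m) (4 / 3) ^+ n * y n ^+ 2.
  by apply: sumr_ge0 => n _; rewrite mulr_ge0 ?sqr_ge0// exprn_ge0.
apply: (@le_trans _ _ (s j * \sum_(n < j) (4 / 3) ^+ n * y n ^+ 2)); last first.
  exact: ler_wpM2r.
elim: j => [|j IH]; first by rewrite /s !big_ord0 expr0n mul0r.
rewrite /s !big_ord_recr/=; apply: Cauchy_Schwarz_step => //.
- by apply: sumr_ge0 => n _; rewrite exprn_ge0.
- exact: w0.
- by rewrite mulr_ge0 ?sqr_ge0// exprn_ge0.
- rewrite mulrA -exprMn real_normK ?num_real// (_ : 3 / 4 * (4 / 3) = 1); last by field.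
  by rewrite expr1n mul1r.
Qed.

(** * Convergence of the expansion and the exact truncation error *)

Section truncation_error.
Context (R : realType) d (T : measurableType d) (P : probability T R) (a : R)
  (X : T -> R) (Xnk : nat -> nat -> T -> R) (Pn : nat -> T -> nat).
Hypotheses (mX : measurable_fun setT X)
  (mXnk : forall n k, measurable_fun setT (Xnk n k))
  (lawX : forall n k B, measurable B -> P (Xnk n k @^-1` B) = logistic_prob B)
  (mPn : forall n (U : set nat), measurable (Pn n @^-1` U))
  (lawP : forall n (U : set nat),
     P (Pn n @^-1` U) = poisson_prob (a ^+ 2 * 2 ^+ n / 2) 0 U)
  (ind : mutually_independent P (levents X Xnk Pn)).

Local Notation row := (row Xnk Pn).
Local Notation row_range := (row_range Xnk Pn).
Local Notation lev := (lev_partial X Xnk Pn).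

(** An integrable bound for the squares of all finite blocks of levels, obtained from
    [weighted_sum_sq]. The mean of [row n ^+ 2] grows like [2 ^+ n], which [3 ^+ n] beats; where [W]
    is finite the expansion converges absolutely. *)
Let W t : \bar R := (\sum_(0 <= n <oo) (4 * (3 ^+ n)^-1 * row n t ^+ 2)%:E)%E.

Let w0 n t : 0 <= 4 * (3 ^+ n)^-1 * row n t ^+ 2.
Proof. by rewrite mulr_ge0 ?sqr_ge0// mulr_ge0// invr_ge0 exprn_ge0. Qed.

Let mrow n : measurable_fun setT (row n).
Proof. exact: (measurable_row mX mXnk mPn). Qed.

Let mw n : measurable_fun setT (fun t => (4 * (3 ^+ n)^-1 * row n t ^+ 2)%:E).
Proof.
by apply/measurable_EFinP; apply: measurable_funM => //; exact: measurable_funX.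
Qed.

Let W0 t : (0 <= W t)%E.
Proof. by apply: nneseries_ge0 => n _ _; rewrite lee_fin. Qed.

Let iW : P.-integrable setT W.
Proof.
apply/integrableP; split.
  by apply: ge0_emeasurable_sum => // n t _ _; rewrite lee_fin.
under eq_integral do rewrite gee0_abs//.
rewrite integral_nneseries//; last by move=> n t _; rewrite lee_fin.
rewrite [ltLHS](_ : _ = (\sum_(0 <= n <oo) (geometric (2 * a ^+ 2 * (pi ^+ 2 / 3)) (2 / 3) n)%:E)%E).
  set g := geometric _ _; rewrite [ltLHS](_ : _ = (limn (series g))%:E) ?ltry//.
  rewrite -EFin_lim; last by apply: is_cvg_geometric_series; rewrite ger0_norm; lra.
  by apply/congr_lim/funext => n /=; rewrite /series/= -sumEFin.
apply: eq_eseriesr => n _.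
have := sm_2 (sym_moments_row mX mXnk lawX mPn lawP ind n).
move=> /(has_meanZ (4 * (3 ^+ n)^-1))[_ ->]; congr EFin.
by rewrite /geometric/= expr_div_n; field; rewrite expf_neq0.
Qed.

Let absE n t : (4 / 3) ^+ n * ((2 ^+ n)^-1 * row n t) ^+ 2 = (3 ^+ n)^-1 * row n t ^+ 2.
Proof.
rewrite expr_div_n (_ : 4 = 2 ^+ 2 :> R); last by ring.
by rewrite -exprM mulnC exprM; field; rewrite !expf_neq0.
Qed.

Let abs_sum_le j t : W t \is a fin_num ->
  (\sum_(n < j) `|(2 ^+ n)^-1 * row n t|) ^+ 2 <= fine (W t).
Proof.
move=> Wf; apply: le_trans (weighted_sum_sq (fun n => (2 ^+ n)^-1 * row n t) j) _.
rewrite -lee_fin fineK//; under eq_bigr do rewrite absE.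
rewrite mulr_sumr; under eq_bigr do rewrite mulrA.
rewrite -(big_mkord xpredT (fun n => 4 * (3 ^+ n)^-1 * row n t ^+ 2)) -sumEFin.
by apply: nneseries_lim_ge => n _ _; rewrite lee_fin.
Qed.

Let cvg_lev t : W t \is a fin_num -> cvgn (fun N => lev N t).
Proof.
move=> Wf.
have : cvgn (series (fun n => (2 ^+ n)^-1 * row n t)).
  apply: normed_cvg; apply: nondecreasing_is_cvgn.
    by apply: nondecreasing_series => n _ _; exact: normr_ge0.
  exists (1 + fine (W t)) => _ [j _ <-]; have := abs_sum_le j Wf.
  rewrite -(big_mkord xpredT (fun n => `|(2 ^+ n)^-1 * row n t|)).
  set z := \sum_(_ <= _ < _) _ => h; change (z <= 1 + fine (W t)).
  by nra.
move=> /cvg_ex[/= l hl]; apply/cvg_ex; exists (X t + l).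
rewrite (_ : (fun N => lev N t) = fun N => X t + series (fun n => (2 ^+ n)^-1 * row n t) N.+1); last first.
  by apply/funext => N; rewrite lev_partial_range.
by apply: cvgD; [exact: cvg_cst|move: hl; rewrite -cvg_shiftS].
Qed.

Let range_le m j t : W t \is a fin_num -> row_range m j t ^+ 2 <= fine (W t).
Proof.
move=> Wf; apply: le_trans (abs_sum_le (m + j) Wf).
rewrite -[leLHS]real_normK ?num_real// lerXn2r ?nnegrE// ?sumr_ge0//.
apply: le_trans (ler_norm_sum _ _ _) _.
rewrite -(big_mkord xpredT (fun n => `|(2 ^+ n)^-1 * row n t|)).
by rewrite [leRHS](big_cat_nat _ (n := m))//= ?leq_addr// lerDr sumr_ge0.
Qed.

(** Squares of the blocks [N < n <= N + M] converge almost everywhere to the square of the tail and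
    are dominated by [W], so their known second moments pass to the limit. *)
Lemma truncation_errorE (h : R) N :
  (\int[P]_t ((levyA h X Xnk Pn t - levyA_N h X Xnk Pn N t) ^+ 2)%:E
     = (a ^+ 2 / (3 * 2 ^+ N.+1) * (h / 2) ^+ 2)%:E)%E.
Proof.
pose q := h / (pi *+ 2).
have mL : measurable_fun setT (fun t => limn (lev ^~ t) - lev N t).
  apply: measurable_funB; last exact: (measurable_lev_partial mX mXnk mPn).
  by apply: measurable_fun_limn => n; exact: (measurable_lev_partial mX mXnk mPn).
have [|||||_ _ hl] := @dominated_convergence _ _ _ P setT measurableT
  (fun M t => (row_range N.+1 M t ^+ 2)%:E) (fun t => ((limn (lev ^~ t) - lev N t) ^+ 2)%:E) W.
- move=> M; apply/measurable_EFinP/measurable_funX.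
  exact: (measurable_row_range mX mXnk mPn).
- by apply/measurable_EFinP/measurable_funX.
- apply: filterS (integrable_ae measurableT iW) => t /(_ Logic.I) Wf _.
  apply: cvg_EFin; first exact: nearW.
  have c : row_range N.+1 M t @[M --> \oo] --> limn (lev ^~ t) - lev N t.
    rewrite (_ : (fun M => _) = fun M => lev (M + N) t - lev N t); last first.
      by apply/funext => M; rewrite addnC lev_partialE addrC addKr.
    apply: cvgB; last exact: cvg_cst.
    by rewrite (cvg_shiftn N (fun M => lev M t)); exact: cvg_lev.
  by apply: cvgM.
- exact: iW.
- apply: filterS (integrable_ae measurableT iW) => t /(_ Logic.I) Wf M _.
  by rewrite abse_EFin ger0_norm ?sqr_ge0// -(fineK Wf) lee_fin; exact: range_le.
have E2 : (\int[P]_t ((limn (lev ^~ t) - lev N t) ^+ 2)%:E =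
    (a ^+ 2 * (pi ^+ 2 / 3) * (2 ^+ N.+1)^-1)%:E)%E.
  apply: (cvg_unique (@ereal_hausdorff R) hl).
  rewrite (_ : (fun M => _) = fun M => (a ^+ 2 * (pi ^+ 2 / 3) *
    ((2 ^+ N.+1)^-1 - (2 ^+ (N.+1 + M))^-1))%:E); last first.
    by apply/funext => M; case: (sm_2 (sym_moments_range mX mXnk lawX mPn lawP ind N.+1 M)).
  apply: cvg_EFin; first exact: nearW.
  apply: cvgM; first exact: cvg_cst.
  rewrite -[X in _ --> X]subr0; apply: cvgB; first exact: cvg_cst.
  rewrite (_ : (fun M => _) = fun M => ((2 : R)^-1 : R^o) ^+ (M + N.+1)); last first.
    by apply/funext => M; rewrite addnC -exprVn.
  rewrite (cvg_shiftn N.+1 (fun M => ((2 : R)^-1 : R^o) ^+ M)).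
  by apply: cvg_expr; rewrite ger0_norm; lra.
transitivity (\int[P]_t ((q ^+ 2)%:E * ((limn (lev ^~ t) - lev N t) ^+ 2)%:E))%E.
  by apply: eq_integral => t _; rewrite -EFinM -exprMn /levyA /levyA_N mulrBr.
rewrite ge0_integralZl_EFin ?sqr_ge0//; last 2 first.
  by move=> t _; rewrite lee_fin sqr_ge0.
  by apply/measurable_EFinP/measurable_funX.
rewrite E2 -EFinM; congr EFin; rewrite /q.
have : 2 ^+ N.+1 != 0 :> R by rewrite expf_neq0.
move: (2 ^+ N.+1) (pi_gt0 R) => z; move: (@pi R) => p p0 z0.
by rewrite -mulr_natl; field; rewrite z0 gt_eqF.
Qed.

End truncation_error.

(** * Countable mixtures of probabilities *)

Section mixture.
Context d (T : measurableType d) (R : realType).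
Variables (w : nat -> {nonneg R}) (m : nat -> probability T R).

(** The proof that the weights sum to one is an argument of the set function, so that the structure
    of probability can be attached to it. *)
Definition mixture : (\sum_(0 <= k <oo) ((w k)%:num)%:E = 1)%E -> set T -> \bar R :=
  fun=> mseries (fun k => mscale (w k) (m k)) 0.

Variable w1 : (\sum_(0 <= k <oo) ((w k)%:num)%:E = 1)%E.

HB.instance Definition _ := Measure.on (mixture w1).

Let mixture_setT : mixture w1 setT = 1%E.
Proof.
rewrite /mixture /mseries/= -w1; apply: eq_eseriesr => k _.
by rewrite /mscale/= probability_setT mule1.
Qed.

HB.instance Definition _ :=
  Measure_isProbability.Build _ _ R (mixture w1) mixture_setT.

Lemma ge0_integral_mixture (g : T -> \bar R) : measurable_fun setT g ->
  (forall x, 0 <= g x)%E ->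
  (\int[mixture w1]_x g x = \sum_(0 <= k <oo) ((w k)%:num)%:E * \int[m k]_x g x)%E.
Proof.
move=> mg g0; rewrite /mixture ge0_integral_measure_series//.
by apply: eq_eseriesr => k _; rewrite ge0_integral_mscale.
Qed.

End mixture.

(** * Gaussian scale mixtures and their closure properties *)

Section gauss_mixture.
Context {R : realType}.
Local Notation RR := (measurableTypeR R).

(** [phi] is the characteristic function of a centred Gaussian with random variance [|x|]; the
    absolute value replaces a support condition on [rho]. *)
Definition gauss_mixture (phi : R -> R) := exists rho : probability RR R,
  forall t, (\int[rho]_x (expR (- (`|x| * t ^+ 2 / 2)))%:E = (phi t)%:E)%E.

Lemma measurable_gauss_weight (t : R) :
  measurable_fun setT (fun x : R => (expR (- (`|x| * t ^+ 2 / 2)))%:E).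
Proof.
apply/measurable_EFinP; apply: measurableT_comp => //; apply: measurableT_comp => //.
by apply: measurable_funM => //; apply: measurable_funM.
Qed.

Lemma gauss_mixture_ext phi psi : (forall t, phi t = psi t) ->
  gauss_mixture phi -> gauss_mixture psi.
Proof. by move=> /funext ->. Qed.

Lemma gauss_mixture_push d (T : measurableType d) (P : probability T R)
    (S : T -> R) phi : measurable_fun setT S ->
  (forall t, \int[P]_x (expR (- (`|S x| * t ^+ 2 / 2)))%:E = (phi t)%:E)%E ->
  gauss_mixture phi.
Proof.
move=> mS h; exists (pushp (T2 := RR) P mS) => t; rewrite ge0_integral_pushp//.
exact: measurable_gauss_weight.
Qed.

Lemma gauss_mixture1 : gauss_mixture (fun=> 1).
Proof.
apply: (@gauss_mixture_push _ _ (@normal_prob R 0 1) (fun=> 0)) => // t.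
rewrite normr0 !mul0r oppr0 expR0 integral_cst// mul1e.
exact: probability_setT.
Qed.

Lemma gauss_mixtureZ phi c : gauss_mixture phi -> gauss_mixture (fun t => phi (t * c)).
Proof.
move=> [rho h]; apply: (@gauss_mixture_push _ _ rho (fun x => c ^+ 2 * x)).
  exact: measurable_funM.
move=> t; rewrite -h; apply: eq_integral => x _; congr (expR _)%:E.
by rewrite normrM ger0_norm ?sqr_ge0//; ring.
Qed.

(** The variances of independent Gaussians add, so the mixing variable of the product is the sum of
    the two, under the product law. *)
Lemma gauss_mixtureM phi psi : gauss_mixture phi -> gauss_mixture psi ->
  gauss_mixture (fun t => phi t * psi t).
Proof.
move=> [rho h] [sig k].
have mS : measurable_fun setT (fun x : RR * RR => `|x.1| + `|x.2|).
  by apply: measurable_funD; apply: measurableT_comp.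
apply: (@gauss_mixture_push _ _ (rho \x sig)%E _ _ mS) => t.
rewrite fubini_tonelli1//=; last first.
  have /measurable_EFinP m1 := measurable_gauss_weight t.
  by apply/measurable_EFinP; apply: (measurableT_comp m1 mS).
transitivity (\int[rho]_x ((expR (- (`|x| * t ^+ 2 / 2)))%:E * (psi t)%:E))%E.
  apply: eq_integral => x _; rewrite /fubini_F/= -k.
  rewrite -ge0_integralZl//; last exact: measurable_gauss_weight.
  apply: eq_integral => y _; rewrite -EFinM -expRD; congr (expR _)%:E.
  by rewrite ger0_norm ?addr_ge0//; ring.
rewrite ge0_integralZr//; last 2 first.
- exact: measurable_gauss_weight.
- by rewrite -k; exact: integral_ge0.
by rewrite h EFinM.
Qed.

Lemma gauss_mixture_prod (I : Type) (s : seq I) (phi : I -> R -> R) :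
  (forall i, gauss_mixture (phi i)) -> gauss_mixture (fun t => \prod_(i <- s) phi i t).
Proof.
move=> h; elim: s => [|i s IH].
  by apply: gauss_mixture_ext gauss_mixture1 => t; rewrite big_nil.
by apply: gauss_mixture_ext (gauss_mixtureM (h i) IH) => t; rewrite big_cons.
Qed.

(** Poisson weights mix the mixing laws of the powers [phi ^+ p]; the generating function sums them
    to the exponential. *)
Lemma gauss_mixture_compound l phi : 0 <= l -> (forall t, 0 <= phi t) -> gauss_mixture phi ->
  gauss_mixture (fun t => expR (l * (phi t - 1))).
Proof.
move=> l0 phi0 h.
have /choice[m hm] : forall p, exists rho : probability RR R, forall t,
    (\int[rho]_x (expR (- (`|x| * t ^+ 2 / 2)))%:E = (phi t ^+ p)%:E)%E.
  elim=> [|p IH]; first exact: gauss_mixture1.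
  by apply: gauss_mixture_ext (gauss_mixtureM h IH) => t; rewrite exprS.
exists (mixture (w := fun p => NngNum (poisson_weight_ge0 p l0)) m (poisson_mass l0)).
move=> t; rewrite ge0_integral_mixture//; last exact: measurable_gauss_weight.
rewrite -poisson_pgf//; apply: eq_eseriesr => p _.
by rewrite hm -EFinM mulrC.
Qed.

End gauss_mixture.

(** * Exponential variables as images of Logistic ones *)

Section softplus.
Context {R : realType}.

(** This is [- ln (sigmoid x)], standard exponential when the argument is Logistic, by
    [integral_sigmoid_pow]. *)
Definition softplus (x : R) : R := ln (1 + expR (- x)).

Lemma softplus_ge0 x : 0 <= softplus x.
Proof. by rewrite ln_ge0// lerDl expR_ge0. Qed.

Lemma continuous_softplus : continuous softplus.
Proof.
have c1 : continuous (fun x : R => 1 + expR (- x)).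
  move=> x; apply: cvgD; first exact: cvg_cst.
  by apply: continuous_comp; [exact: opp_continuous|exact: continuous_expR].
move=> x; apply: (continuous_comp (c1 x)).
by apply: continuous_ln; exact: sigmoid_denom_gt0.
Qed.

Lemma softplus_le x : softplus x <= 2 * (1 + x ^+ 2) ^+ 2.
Proof.
have h : softplus x <= 2 + x ^+ 2.
  rewrite -[leRHS]expRK ler_ln ?posrE ?expR_gt0 ?sigmoid_denom_gt0//.
  rewrite (_ : 2 + x ^+ 2 = 1 + (1 + x ^+ 2)); last by ring.
  rewrite expRD; set z := expR (1 + x ^+ 2).
  have z1 : 1 <= z by rewrite -expR0 ler_expR addr_ge0 ?sqr_ge0.
  have zx : expR (- x) <= z by rewrite ler_expR; have := sqr_ge0 (x + 1); nra.
  have := expR_ge1Dx (1 : R); nra.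
apply: le_trans h _; have := sqr_ge0 x; nra.
Qed.

End softplus.

(** * The Logistic law and the blocks of levels as Gaussian scale mixtures *)

Section logistic_mixture.
Context (R : realType) d (T : measurableType d) (P : probability T R)
  (a : R) (X : T -> R) (Xnk : nat -> nat -> T -> R) (Pn : nat -> T -> nat).
Hypotheses (mX : measurable_fun setT X)
  (mXnk : forall n k, measurable_fun setT (Xnk n k))
  (lawX : forall n k B, measurable B -> P (Xnk n k @^-1` B) = logistic_prob B)
  (mPn : forall n (U : set nat), measurable (Pn n @^-1` U))
  (lawP : forall n (U : set nat),
     P (Pn n @^-1` U) = poisson_prob (a ^+ 2 * 2 ^+ n / 2) 0 U)
  (ind : mutually_independent P (levents X Xnk Pn)).

Let c j : R := 2 / j.+1%:R ^+ 2.
Let c0 j : 0 <= c j. Proof. by rewrite divr_ge0// exprn_ge0. Qed.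
(** A truncation of the mixing variable of the Logistic law. The variables [Xnk 0 j] act here as a
    ready supply of independent Logistic variables. *)
Let D J t : R := \sum_(j < J) c j * softplus (Xnk 0 j t).

Let ms : measurable_fun setT (@softplus R).
Proof. exact: continuous_measurable_fun continuous_softplus. Qed.

Let mterm j : measurable_fun setT (fun t => c j * softplus (Xnk 0 j t)).
Proof. by apply: measurable_funM => //; exact: measurableT_comp. Qed.

Let mD J : measurable_fun setT (D J).
Proof. by apply: measurable_sum => j; exact: mterm. Qed.

Let D0 J t : 0 <= D J t.
Proof. by apply: sumr_ge0 => j _; rewrite mulr_ge0// softplus_ge0. Qed.

Let mean_expD u J : 0 <= u -> has_mean P (fun t => expR (- (u * D J t)))
  (\prod_(j < J) (1 + u * c j)^-1).
Proof.
move=> u0; elim: J => [|J IH].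
  by apply: has_mean_ext (has_mean_cst P 1) => [t|]; rewrite ?big_ord0// /D big_ord0 mulr0 oppr0 expR0.
have mexp (v : R) : measurable_fun setT (fun x : R => expR (- (v * x))).
  have m1 : measurable_fun setT (fun x : R => v * x) by exact: measurable_funM.
  by apply: measurableT_comp => //; exact: measurableT_comp m1.
have h : has_mean P (fun t => expR (- (u * c J * softplus (Xnk 0 J t)))) (1 + u * c J)^-1.
  have me : measurable_fun setT (fun x : R => expR (- (u * c J * softplus x))).
    exact: (measurableT_comp (mexp (u * c J)) ms).
  apply: ge0_has_mean => [|t|]; rewrite ?expR_ge0//.
    exact: (measurableT_comp me (mXnk 0%N J)).
  rewrite (ge0_integral_logistic (mXnk 0%N J) (@lawX 0%N J)
    (g := fun x => (expR (- (u * c J * softplus x)))%:E)).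
  - rewrite -integral_sigmoid_pow ?mulr_ge0//.
  - exact/measurable_EFinP.
  - by move=> x; rewrite lee_fin expR_ge0.
have mg k : measurable_fun setT (fun x : R => c k * softplus x).
  exact: measurable_funM.
have I := indep_row_sum mX mXnk mPn ind 0%N J mg.
have m2 : measurable_fun setT (fun x : R => expR (- (u * c J * softplus x))).
  exact: (measurableT_comp (mexp (u * c J)) ms).
have := has_meanM (indep_fun_comp (mexp u) m2 I) IH h.
apply: has_mean_ext => [t|]; last by rewrite big_ord_recr.
by rewrite /= -expRD /D big_ord_recr/=; congr expR; ring.
Qed.

Let W t : \bar R := (\sum_(0 <= j <oo) (c j * softplus (Xnk 0 j t))%:E)%E.

Let iW : P.-integrable setT W.
Proof.
have w0 j t : (0 <= (c j * softplus (Xnk 0 j t))%:E)%E.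
  by rewrite lee_fin mulr_ge0// softplus_ge0.
have W0 t : (0 <= W t)%E by apply: nneseries_ge0.
have mw j : measurable_fun setT (fun t => (c j * softplus (Xnk 0 j t))%:E).
  exact/measurable_EFinP.
apply/integrableP; split; first exact: ge0_emeasurable_sum.
under eq_integral do rewrite gee0_abs//.
rewrite integral_nneseries//.
have e j : (\int[P]_t (c j * softplus (Xnk 0 j t))%:E = (LI softplus 1 * c j)%:E)%E.
  have := has_mean_logistic (mXnk 0%N j) (@lawX 0%N j) continuous_softplus
    softplus_ge0 softplus_le.
  by move=> /(has_meanZ (c j))[_ ->]; rewrite mulrC.
under eq_eseriesr do rewrite e.
have cv : series (fun j => LI softplus 1 * c j) n @[n --> \oo] --> LI softplus 1 * mk 1.
  rewrite (_ : (fun n => _) = fun n => LI softplus 1 * \sum_(j < n) c j).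
    by apply: cvgM; [exact: cvg_cst|exact: cvg_sum_mk].
  by apply/funext => n; rewrite /series/= big_mkord mulr_sumr.
rewrite [ltLHS](_ : _ = (limn (series (fun j => LI softplus 1 * c j)))%:E) ?ltry//.
rewrite -EFin_lim; last by apply/cvg_ex; eexists; exact: cv.
by apply/congr_lim/funext => n /=; rewrite /series/= -sumEFin.
Qed.

Let cvg_D t : W t \is a fin_num -> cvgn (D ^~ t).
Proof.
move=> Wf; apply: nondecreasing_is_cvgn.
  apply/nondecreasing_seqP => n; rewrite /D big_ord_recr/= lerDl.
  by rewrite mulr_ge0// softplus_ge0.
exists (fine (W t)) => _ [n _ <-]; rewrite -lee_fin fineK// /D.
rewrite -(big_mkord xpredT (fun j => c j * softplus (Xnk 0 j t))) -sumEFin.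
by apply: nneseries_lim_ge => j _ _; rewrite lee_fin mulr_ge0// softplus_ge0.
Qed.

(* The infinite divisibility behind the mixture: [\sum_j 2 / (j + 1)^2 E_j] with
   independent standard exponential [E_j] has Laplace transform
   [\prod_j (1 + 2 u / (j + 1)^2)^-1], which at [u = t^2 / 2] is the
   characteristic function of the Logistic law; [softplus] of a Logistic
   variable is exponential. *)
Lemma gauss_mixture_logistic : gauss_mixture (@phiX R).
Proof.
have mL : measurable_fun setT (fun t => limn (D ^~ t)) by exact: measurable_fun_limn.
apply: (gauss_mixture_push (P := P) mL) => u.
have mE (f : T -> R) : measurable_fun setT f ->
    measurable_fun setT (fun t => (expR (- (`|f t| * u ^+ 2 / 2)))%:E).
  by move=> mf; apply: measurableT_comp (measurable_gauss_weight u) mf.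
have [|||||_ _ hl] := @dominated_convergence _ _ _ P setT measurableT
  (fun J t => (expR (- (`|D J t| * u ^+ 2 / 2)))%:E)
  (fun t => (expR (- (`|limn (D ^~ t)| * u ^+ 2 / 2)))%:E) (cst 1%E).
- by move=> J; exact: mE.
- exact: mE.
- apply: filterS (integrable_ae measurableT iW) => t /(_ Logic.I) Wf _.
  apply: cvg_EFin; first exact: nearW.
  have h := cvg_D Wf.
  have hn : `|D J t| * u ^+ 2 / 2 @[J --> \oo] --> `|limn (D ^~ t)| * u ^+ 2 / 2.
    by apply: cvgM; [apply: cvgM; [exact: cvg_norm|exact: cvg_cst]|exact: cvg_cst].
  by apply: continuous_cvg; [exact: continuous_expR|exact: cvgN hn].
- exact: finite_measure_integrable_cst.
- apply: aeW => t J _; rewrite abse_EFin ger0_norm ?expR_ge0// lee_fin.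
  by rewrite expR_le1 oppr_le0 divr_ge0// mulr_ge0 ?sqr_ge0.
apply: (cvg_unique (@ereal_hausdorff R) hl).
rewrite (_ : (fun J => _) = fun J => (\prod_(j < J) (1 + u ^+ 2 / j.+1%:R ^+ 2)^-1)%:E).
  by apply: cvg_EFin; [exact: nearW|exact: cvg_LIcos].
have u0 : 0 <= u ^+ 2 / 2 by rewrite divr_ge0 ?sqr_ge0.
apply/funext => J; have [_ h] := mean_expD J u0.
transitivity ((\prod_(j < J) (1 + u ^+ 2 / 2 * c j)^-1)%:E : \bar R).
  rewrite -h; apply: eq_integral => t _; rewrite ger0_norm//.
  by congr (expR _)%:E; ring.
congr EFin; apply: eq_bigr => j _; rewrite /c; congr (_ ^-1).
by field; rewrite addrC natr1 pnatr_eq0.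
Qed.

Lemma gauss_mixture_range m j : gauss_mixture (range_cf a m j).
Proof.
apply: (gauss_mixture_prod (index_iota m (m + j))) => n.
have phi0 : forall u : R, 0 <= phiX u.
  exact: (sm_phi (sym_moments_logistic (mXnk 0%N 0%N) (@lawX 0%N 0%N))).
have l0 : 0 <= a ^+ 2 * 2 ^+ n / 2 by rewrite divr_ge0// mulr_ge0 ?sqr_ge0// exprn_ge0.
exact: (gauss_mixtureZ (2 ^+ n)^-1
  (gauss_mixture_compound l0 phi0 gauss_mixture_logistic)).
Qed.

End logistic_mixture.

(** * Probabilities given by a density *)

Section density_probability.
Local Open Scope ereal_scope.
Context d (T : measurableType d) (R : realType) (mu : {measure set T -> \bar R})
  (f : T -> R).

Definition mdensity (_ : measurable_fun setT f) (_ : forall x, (0 <= f x)%R)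
  (_ : \int[mu]_x (f x)%:E = 1) (A : set T) : \bar R := \int[mu]_(x in A) (f x)%:E.

Hypotheses (mf : measurable_fun setT f) (f0 : forall x, (0 <= f x)%R)
  (f1 : \int[mu]_x (f x)%:E = 1).
Local Notation nu := (mdensity mf f0 f1).

Let nu0 : nu set0 = 0. Proof. exact: integral_set0. Qed.

Let nu_ge0 A : 0 <= nu A.
Proof. by apply: integral_ge0 => x _; rewrite lee_fin. Qed.

Let nu_sigma_additive : semi_sigma_additive nu.
Proof.
move=> A mA tA mUA; rewrite /mdensity ge0_integral_bigcup//.
- apply: is_cvg_ereal_nneg_natsum_cond => n _ _.
  by apply: integral_ge0 => x _; rewrite lee_fin.
- by apply: measurable_funTS; exact/measurable_EFinP.
- by move=> x _; rewrite lee_fin.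
Qed.

HB.instance Definition _ := isMeasure.Build _ _ _ nu nu0 nu_ge0 nu_sigma_additive.

HB.instance Definition _ := Measure_isProbability.Build _ _ R nu f1.

Lemma ge0_integral_mdensity (g : T -> \bar R) : measurable_fun setT g ->
  (forall x, 0 <= g x) -> \int[nu]_x g x = \int[mu]_x (g x * (f x)%:E).
Proof. exact: ge0_integral_density. Qed.

End density_probability.

(* The library infers no sigma-finite structure on the bare [L \x Q]. *)
Definition prod_prob {d1 d2} {U : measurableType d1} {S : measurableType d2}
    {R : realType} (L : probability U R) (Q : probability S R) :
  probability (U * S)%type R := (L \x Q)%E.

(** * Gluing two joint laws along a common coordinate *)

Section gluing.
Local Open Scope ereal_scope.
Context d1 d2 d3 (T : measurableType d1) (U : measurableType d2)
  (S : measurableType d3) (R : realType).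
Variables (P : probability T R) (L : probability U R) (Q : probability S R)
  (al : T -> U -> R) (be : S -> U -> R).
Hypotheses (mal : measurable_fun setT (fun z : T * U => al z.1 z.2))
  (mbe : measurable_fun setT (fun z : S * U => be z.1 z.2))
  (al0 : forall t u, (0 <= al t u)%R) (be0 : forall s u, (0 <= be s u)%R)
  (alP : forall u, \int[P]_t (al t u)%:E = 1)
  (beQ : forall u, \int[Q]_s (be s u)%:E = 1)
  (beL : forall s, \int[L]_u (be s u)%:E = 1).

Let den (z : T * (U * S)) : R := be z.2.2 z.2.1 * al z.1 z.2.1.

Let mbe' : measurable_fun setT (fun w : U * S => be w.2 w.1)%R.
Proof.
apply: (measurableT_comp mbe (g := fun w : U * S => (w.2, w.1))).
by apply: measurable_fun_pair; [exact: measurable_snd|exact: measurable_fst].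
Qed.

Let mden : measurable_fun setT den.
Proof.
apply: measurable_funM.
  apply: (measurableT_comp mbe' (g := fun z : T * (U * S) => z.2)).
  exact: measurable_snd.
apply: (measurableT_comp mal (g := fun z : T * (U * S) => (z.1, z.2.1))).
apply: measurable_fun_pair; first exact: measurable_fst.
by apply: (measurableT_comp measurable_fst); exact: measurable_snd.
Qed.

Let den0 z : (0 <= den z)%R.
Proof. by rewrite mulr_ge0. Qed.

Local Notation B := (P \x prod_prob L Q).

Let integral_US (h : U * S -> \bar R) : measurable_fun setT h -> (forall w, 0 <= h w) ->
  \int[B]_z (h z.2 * (den z)%:E) = \int[Q]_s \int[L]_u (h (u, s) * (be s u)%:E).
Proof.
move=> mh h0; rewrite fubini_tonelli2//; last 2 first.
- apply: emeasurable_funM; last exact/measurable_EFinP.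
  by apply: (measurableT_comp mh); exact: measurable_snd.
- by move=> z; rewrite mule_ge0// lee_fin.
transitivity (\int[prod_prob L Q]_w (h w * (be w.2 w.1)%:E)).
  apply: eq_integral => w _; rewrite /fubini_G/= /den/=.
  under eq_integral do rewrite EFinM muleA.
  rewrite ge0_integralZl//; last 3 first.
  - apply/measurable_EFinP; apply: (measurableT_comp mal (g := fun t => (t, w.1))).
    exact: measurable_pair2.
  - by move=> t _; rewrite lee_fin.
  - by rewrite mule_ge0// lee_fin.
  by rewrite alP mule1.
rewrite /prod_prob fubini_tonelli2//; last by move=> z; rewrite mule_ge0// lee_fin.
by apply: emeasurable_funM => //; exact/measurable_EFinP.
Qed.

Let den1 : \int[B]_z (den z)%:E = 1.
Proof.
have := integral_US (h := cst 1).
under eq_integral do rewrite mul1e.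
move=> ->//; transitivity (\int[Q]_s 1); last first.
  by rewrite integral_cst// mul1e; exact: probability_setT.
apply: eq_integral => s _; rewrite -[RHS](beL s).
by apply: eq_integral => u _; rewrite mul1e.
Qed.

(** The density [be s u * al t u] with respect to the product of [P], [L] and [Q] makes the outer
    coordinates conditionally independent given [u]. Integrating out one of them leaves the
    prescribed joint law of the other with [u]. The third formula shows that the sample point [t]
    acts on the new coordinates only through [al t]. *)
Theorem gluing : exists P' : probability (T * (U * S))%type R,
  [/\ forall h : T * U -> \bar R, measurable_fun setT h -> (forall w, 0 <= h w) ->
        \int[P']_z h (z.1, z.2.1) = \int[P]_t \int[L]_u (h (t, u) * (al t u)%:E),
      forall h : U * S -> \bar R, measurable_fun setT h -> (forall w, 0 <= h w) ->
        \int[P']_z h z.2 = \int[Q]_s \int[L]_u (h (u, s) * (be s u)%:E) &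
      forall (g : T -> \bar R) (h : U * S -> \bar R),
        measurable_fun setT g -> (forall t, 0 <= g t) ->
        measurable_fun setT h -> (forall w, 0 <= h w) ->
        \int[P']_z (g z.1 * h z.2) = \int[P]_t (g t *
          \int[prod_prob L Q]_w (h w * (be w.2 w.1 * al t w.1)%:E))].
Proof.
exists (mdensity mden den0 den1); split.
- move=> h mh h0; have m1 : measurable_fun setT (fun z : T * (U * S) => h (z.1, z.2.1)).
    apply: (measurableT_comp mh (g := fun z : T * (U * S) => (z.1, z.2.1))).
    apply: measurable_fun_pair; first exact: measurable_fst.
    by apply: (measurableT_comp measurable_fst); exact: measurable_snd.
  rewrite ge0_integral_mdensity// fubini_tonelli1//; last 2 first.
  + by apply: emeasurable_funM => //; exact/measurable_EFinP.
  + by move=> z; rewrite mule_ge0// lee_fin.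
  apply: eq_integral => t _; rewrite /fubini_F/= /den/=.
  have mu1 : measurable_fun setT (fun u => h (t, u)).
    by apply: measurableT_comp => //; exact: measurable_pair1.
  have mu2 : measurable_fun setT (fun u => al t u).
    by apply: (measurableT_comp mal (g := fun u => (t, u))); exact: measurable_pair1.
  rewrite /prod_prob (fubini_tonelli1
    (fun w : U * S => h (t, w.1) * (be w.2 w.1 * al t w.1)%:E))/=; last 2 first.
  + apply: emeasurable_funM; first by apply: (measurableT_comp mu1); exact: measurable_fst.
    apply/measurable_EFinP; apply: measurable_funM => //.
    by apply: (measurableT_comp mu2); exact: measurable_fst.
  + by move=> w; rewrite mule_ge0// lee_fin mulr_ge0.
  apply: eq_integral => u _; rewrite /fubini_F/=.
  under eq_integral do rewrite mulrC EFinM muleA.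
  rewrite ge0_integralZl//; last 3 first.
  + by apply/measurable_EFinP; apply: (measurableT_comp mbe (g := fun s => (s, u))); exact: measurable_pair2.
  + by move=> s _; rewrite lee_fin.
  + by rewrite mule_ge0// lee_fin.
  by rewrite beQ mule1.
- move=> h mh h0; rewrite ge0_integral_mdensity//; first exact: integral_US.
  by apply: measurableT_comp => //; exact: measurable_snd.
- move=> g h mg g0 mh h0.
  have m1 : measurable_fun setT (fun z : T * (U * S) => g z.1 * h z.2).
    apply: emeasurable_funM.
      by apply: (measurableT_comp mg); exact: measurable_fst.
    by apply: (measurableT_comp mh); exact: measurable_snd.
  rewrite ge0_integral_mdensity//; last by move=> z; rewrite mule_ge0.
  rewrite fubini_tonelli1//; last 2 first.
  + by apply: emeasurable_funM => //; exact/measurable_EFinP.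
  + by move=> z; rewrite !mule_ge0// lee_fin.
  apply: eq_integral => t _; rewrite /fubini_F/=.
  under eq_integral do rewrite -muleA.
  rewrite ge0_integralZl//.
  + apply: emeasurable_funM => //; apply/measurable_EFinP.
    by apply: (measurableT_comp mden (g := fun w => (t, w))); exact: measurable_pair1.
  + by move=> w _; rewrite mule_ge0// lee_fin.
Qed.

End gluing.

(** * Exchange of integrals under a Gaussian bound, and positivity of means *)

Section gauss_fubini.
Context d (S : measurableType d) (R : realType) (Q : probability S R).
Notation mu := (@lebesgue_measure R).

Lemma integrable_gauss (e : R) : 0 < e ->
  mu.-integrable setT (EFin \o (fun t : R => expR (- (e * t ^+ 2 / 2)))).
Proof.
move=> e0; have := integrable_cos_gpdf 0 (_ : 0 < e^-1); rewrite invr_gt0 => /(_ e0) i.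
have := integrableZl measurableT (Num.sqrt (2 * pi * e^-1)) i.
apply: eq_integrable => // t _; rewrite /= -EFinM /gpdf mul0r cos0 mul1r mulrA.
have e2 : e != 0 by rewrite gt_eqF.
have p0 := pi_gt0 R.
rewrite mulfV ?mul1r; last by rewrite gt_eqF// sqrtr_gt0 !mulr_gt0// invr_gt0.
by congr (expR _)%:E; field.
Qed.

Lemma gauss_fubini (e : R) (F : S -> R -> R) : 0 < e ->
  measurable_fun setT (fun z : S * R => F z.1 z.2) ->
  (forall s t, `|F s t| <= expR (- (e * t ^+ 2 / 2))) ->
  (\int[Q]_s \int[mu]_t (F s t)%:E = \int[mu]_t \int[Q]_s (F s t)%:E)%E.
Proof.
move=> e0 mF Fe.
have i : (Q \x mu)%E.-integrable setT (fun z : S * R => (F z.1 z.2)%:E).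
  apply/integrable12ltyP; first exact/measurable_EFinP.
  have /integrableP[_ ioo] := integrable_gauss e0.
  apply: le_lt_trans ioo.
  apply: (@le_trans _ _ (\int[Q]_s \int[mu]_t (expR (- (e * t ^+ 2 / 2)))%:E)%E).
    apply: ge0_le_integral => //.
    - by move=> s _; exact: integral_ge0.
    - apply: (measurable_fun_fubini_tonelli_F (m2 := mu) (fun z : S * R => `|(F z.1 z.2)%:E|%E)) => //.
      by apply: measurableT_comp => //; exact/measurable_EFinP.
    move=> s _; apply: ge0_le_integral => //.
      + apply: measurableT_comp => //; apply/measurable_EFinP.
        by apply: (measurableT_comp mF (g := fun t => (s, t))); exact: measurable_pair1.
      + by case/integrableP : (integrable_gauss e0).
      + by move=> t _; rewrite lee_fin.
  rewrite integral_cst// [X in (_ * X)%E](_ : _ = 1%E); last exact: probability_setT.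
  rewrite mule1 le_eqVlt; apply/orP; left; apply/eqP.
  by apply: eq_integral => t _; rewrite /= ger0_norm// expR_ge0.
by rewrite (integral12_prod_meas1 i) -(integral21_prod_meas1 i).
Qed.

Lemma has_mean_gt0 (f : S -> R) m : (forall s, 0 < f s) -> has_mean Q f m -> 0 < m.
Proof.
move=> f0 [i Ef]; rewrite lt_neqAle; apply/andP; split; last first.
  by rewrite -lee_fin -Ef; apply: integral_ge0 => s _; rewrite lee_fin ltW.
apply/eqP => m0.
have mf : measurable_fun setT (EFin \o f) by case/integrableP : i.
have /(ae_eq_integral_abs _ measurableT mf)[N [mN N0 fN]] : (\int[Q]_s `|(EFin \o f) s| = 0)%E.
  by rewrite /= -[RHS]/(0%:E) m0 -Ef; apply: eq_integral => s _; rewrite gtr0_norm.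
have : (Q setT <= Q N)%E.
  apply: le_measure; rewrite ?inE// => s _; apply: fN => /= h.
  by have /eqP := h Logic.I; rewrite eqe gt_eqF.
by rewrite probability_setT N0 lee_fin ler10.
Qed.

End gauss_fubini.

(** * The density of a smoothed variable, written in two ways *)

Section gauss_smoothing.
Context {R : realType}.
Notation mu := (@lebesgue_measure R).

Lemma gpdf_le (e s x : R) : 0 < e -> e <= s -> gpdf s x <= (Num.sqrt (2 * pi * e))^-1.
Proof.
move=> e0 es; have s0 := lt_le_trans e0 es; have p0 := pi_gt0 R.
rewrite -[leRHS]mulr1; apply: ler_pM; rewrite ?invr_ge0 ?expR_ge0//.
  rewrite lef_pV2 ?posrE ?sqrtr_gt0 ?mulr_gt0//.
  by rewrite ler_sqrt ?mulr_ge0 ?(ltW s0) ?(ltW p0)// ler_pM2l// mulr_gt0.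
by rewrite expR_le1 mulNr oppr_le0 divr_ge0 ?sqr_ge0// mulr_ge0// ltW.
Qed.

Lemma norm_cos_gauss (y e t : R) :
  `|cos (y * t) * expR (- (e * t ^+ 2 / 2))| <= expR (- (e * t ^+ 2 / 2)).
Proof.
by rewrite normrM (ger0_norm (expR_ge0 _)) ler_piMl ?expR_ge0// norm_cos_le1.
Qed.

Lemma gpdf_FourierE (e y : R) : 0 < e ->
  (\int[mu]_t (cos (y * t) * expR (- (e * t ^+ 2 / 2)))%:E = (2 * pi * gpdf e y)%:E)%E.
Proof.
move=> e0; rewrite -gpdf_Fourier// /Rintegral fineK//.
have mg : measurable_fun setT (fun t : R => expR (- (e * t ^+ 2 / 2))).
  by apply/measurable_EFinP; case/integrableP : (integrable_gauss e0).
apply: integrable_fin_num => //; apply: le_integrable (integrable_gauss e0) => //.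
  apply/measurable_EFinP/measurable_funM => //.
  by apply: continuous_measurable_fun; exact: continuous_cosM.
by move=> t _ /=; rewrite lee_fin (ger0_norm (expR_ge0 _)) norm_cos_gauss.
Qed.

Lemma measurable_gauss2 : measurable_fun setT
  (fun z : R * R => expR (- (z.1 * z.2 ^+ 2 / 2))).
Proof.
apply: measurableT_comp => //; apply: measurableT_comp => //.
apply: measurable_funM => //; apply: measurable_funM; first exact: measurable_fst.
by apply: measurable_funX; exact: measurable_snd.
Qed.

Lemma measurable_cosM2 : measurable_fun setT (fun z : R * R => cos (z.1 * z.2)).
Proof.
have mc : measurable_fun setT (@cos R).
  by apply: continuous_measurable_fun; exact: continuous_cos.
apply: (measurableT_comp mc).
by apply: measurable_funM; [exact: measurable_fst|exact: measurable_snd].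
Qed.

Context d (T : measurableType d) (P : probability T R)
  (rho : probability (measurableTypeR R) R).
Variables (V : T -> R) (phi : R -> R) (e : R).
Hypotheses (mV : measurable_fun setT V) (e0 : 0 < e)
  (hcos : forall u, has_mean P (fun t => cos (u * V t)) (phi u))
  (hsin : forall u, has_mean P (fun t => sin (u * V t)) 0)
  (hrho : forall t, (\int[rho]_x (expR (- (`|x| * t ^+ 2 / 2)))%:E = (phi t)%:E)%E).

Let g u t := cos (u * t) * expR (- (e * t ^+ 2 / 2)) * phi t.

Let mgauss : measurable_fun setT (fun t : R => expR (- (e * t ^+ 2 / 2))).
Proof. exact: (measurableT_comp measurable_gauss2 (measurable_pair1 e)). Qed.

Let smooth_P u : (\int[P]_t (gpdf e (u - V t))%:E * (2 * pi)%:E = \int[mu]_t (g u t)%:E)%E.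
Proof.
have mVu : measurable_fun setT (fun t => u - V t) by exact: measurable_funB.
rewrite -ge0_integralZr ?lee_fin ?mulr_ge0 ?pi_ge0//; last 2 first.
- apply/measurable_EFinP; apply: (measurableT_comp (f := gpdf e)) => //.
  exact: (measurableT_comp measurable_gpdf (measurable_pair1 e)).
- by move=> t _; rewrite lee_fin gpdf_ge0.
transitivity (\int[P]_t \int[mu]_x (cos ((u - V t) * x) * expR (- (e * x ^+ 2 / 2)))%:E)%E.
  by apply: eq_integral => t _; rewrite gpdf_FourierE// -EFinM mulrC.
rewrite (gauss_fubini (F := fun t x => cos ((u - V t) * x) * expR (- (e * x ^+ 2 / 2))) _ e0)//; last 2 first.
- apply: measurable_funM.
    apply: (measurableT_comp measurable_cosM2 (g := fun z : T * R => (u - V z.1, z.2))).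
    apply: measurable_fun_pair; last exact: measurable_snd.
    exact: (measurableT_comp mVu measurable_fst).
  exact: (measurableT_comp mgauss measurable_snd).
- by move=> t x; exact: norm_cos_gauss.
apply: eq_integral => x _.
have := has_meanD (has_meanZ (cos (u * x)) (hcos x)) (has_meanZ (sin (u * x)) (hsin x)).
move=> /(has_meanZ (expR (- (e * x ^+ 2 / 2)))).
set m := (_ * _ : R); move=> h; have [_ <-] : has_mean P
    (fun t => cos ((u - V t) * x) * expR (- (e * x ^+ 2 / 2))) (g u x).
  apply: has_mean_ext h => [t|]; last by rewrite /m /g; ring.
  by rewrite mulrBl cosB (mulrC (V t)); ring.
by [].
Qed.

Let smooth_rho u : (\int[rho]_x (gpdf (e + `|x|) u)%:E * (2 * pi)%:E = \int[mu]_t (g u t)%:E)%E.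
Proof.
have s0 (x : R) : 0 < e + `|x| by rewrite ltr_pwDl.
have ms : measurable_fun setT (fun x : R => e + `|x|) by exact: measurable_funD.
have mgx : measurable_fun setT (fun x : R => gpdf (e + `|x|) u).
  apply: (measurableT_comp measurable_gpdf (g := fun x : R => (e + `|x|, u))).
  exact: measurable_fun_pair.
rewrite -ge0_integralZr ?lee_fin ?mulr_ge0 ?pi_ge0//; last 2 first.
- exact/measurable_EFinP.
- by move=> t _; rewrite lee_fin gpdf_ge0.
transitivity (\int[rho]_x \int[mu]_t (cos (u * t) * expR (- ((e + `|x|) * t ^+ 2 / 2)))%:E)%E.
  by apply: eq_integral => x _; rewrite gpdf_FourierE// -EFinM mulrC.
rewrite (gauss_fubini (S := measurableTypeR R) (F := fun (x t : R) => cos (u * t) * expR (- ((e + `|x|) * t ^+ 2 / 2))) _ e0)//; last 2 first.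
- apply: measurable_funM.
    have mc : measurable_fun setT (fun t : R => cos (u * t)).
      by apply: continuous_measurable_fun; exact: continuous_cosM.
    exact: (measurableT_comp mc measurable_snd).
  apply: (measurableT_comp measurable_gauss2 (g := fun z : R * R => (e + `|z.1|, z.2))).
  apply: measurable_fun_pair; last exact: measurable_snd.
  exact: (measurableT_comp ms measurable_fst).
- move=> x t; apply: (le_trans (norm_cos_gauss _ _ _)).
  by rewrite ler_expR lerN2 ler_pM2r// ler_wpM2r ?sqr_ge0// lerDl.
apply: eq_integral => t _.
have h : has_mean rho (fun x : R => expR (- (`|x| * t ^+ 2 / 2))) (phi t).
  by apply: ge0_has_mean => //; apply/measurable_EFinP; exact: measurable_gauss_weight.
have [_ <-] : has_mean rho (fun x : R =>
    cos (u * t) * expR (- ((e + `|x|) * t ^+ 2 / 2))) (g u t).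
  apply: has_mean_ext (has_meanZ (cos (u * t) * expR (- (e * t ^+ 2 / 2))) h) => //.
  by move=> x; rewrite -mulrA -expRD; congr (_ * expR _); ring.
by [].
Qed.

(** The left side is the density of [V] plus Gaussian noise of variance [e], the right side that of
    a Gaussian of random variance [e + |x|]. Both have characteristic function
    [phi t * expR (- (e t^2 / 2))], and the noise makes the Fourier inversion absolutely
    convergent. *)
Lemma gauss_smoothing u :
  (\int[P]_t (gpdf e (u - V t))%:E = \int[rho]_x (gpdf (e + `|x|) u)%:E)%E.
Proof.
have p0 : (2 * pi : R) != 0 by rewrite gt_eqF// mulr_gt0// pi_gt0.
have := smooth_P u; rewrite -smooth_rho => /(congr1 (fun x => x * (2 * pi)^-1%:E)%E).
by rewrite -!muleA -EFinM mulfV// !mule1.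
Qed.

End gauss_smoothing.

(** * Scaling and shifting under the Gaussian density *)

Section gaussian_scale.
Context {R : realType}.
Notation mu := (@lebesgue_measure R).

Lemma measurable_gpdf2 (s : R) : measurable_fun setT (gpdf s).
Proof. exact: (measurableT_comp measurable_gpdf (measurable_pair1 s)). Qed.

Lemma ge0_integral_gpdf_scale (s : R) (h : R -> \bar R) : 0 < s ->
  measurable_fun setT h -> (forall x, 0 <= h x)%E ->
  (\int[mu]_u (h (u / Num.sqrt s)%R * (gpdf s u)%:E) = \int[mu]_z (h z * (gpdf 1 z)%:E))%E.
Proof.
move=> s0 mh h0; have r0 : 0 < Num.sqrt s by rewrite sqrtr_gt0.
have mhg : measurable_fun setT (fun z => h z * (gpdf 1 z)%:E)%E.
  by apply: emeasurable_funM => //; apply/measurable_EFinP; exact: measurable_gpdf2.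
have hg0 x : (0 <= h x * (gpdf 1 x)%:E)%E by rewrite mule_ge0// lee_fin gpdf_ge0.
pose F z := ((Num.sqrt s)^-1%:E * (h z * (gpdf 1 z)%:E))%E.
transitivity (\int[mu]_u F ((u - 0) / Num.sqrt s)%R)%E.
  apply: eq_integral => u _; rewrite /F subr0 muleCA -EFinM; congr (_ * _%:E)%E.
  have p2 : 0 <= 2 * pi :> R by rewrite mulr_ge0 ?pi_ge0.
  rewrite /gpdf mulr1 mulrA -invfM mulrC (sqrtrM _ p2) mulrC; congr (_^-1 * expR _).
    by rewrite mulrC.
  rewrite expr_div_n sqr_sqrtr ?(ltW s0)//.
  by field; rewrite gt_eqF.
rewrite ge0_integral_affine//; last 2 first.
- exact: measurable_funeM.
- by move=> x; rewrite mule_ge0// lee_fin invr_ge0.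
rewrite ge0_integralZl// ?lee_fin ?invr_ge0//.
by rewrite muleA -EFinM mulfV ?mul1e// gt_eqF.
Qed.

Lemma gpdf_shift (s v : R) (h : R -> \bar R) : measurable_fun setT h ->
  (forall x, 0 <= h x)%E ->
  (\int[mu]_u (h u * (gpdf s (u - v))%:E) = \int[mu]_y (h (v + y)%R * (gpdf s y)%:E))%E.
Proof.
move=> mh h0; rewrite -(ge0_integral_shift v (f := fun y => h (v + y)%R * (gpdf s y)%:E)%E).
- by apply: eq_integral => u _; rewrite (addrC v) subrK.
- apply: emeasurable_funM; first by apply: measurableT_comp => //; exact: measurable_funD.
  by apply/measurable_EFinP; exact: measurable_gpdf2.
- by move=> x; rewrite mule_ge0// lee_fin gpdf_ge0.
Qed.

Lemma normal_prob_gpdf (B : set R) : measurable B ->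
  (\int[mu]_z ((\1_B z)%:E * (gpdf 1 z)%:E) = normal_prob 0 1 B)%E.
Proof.
move=> mB; rewrite /normal_prob [RHS]integral_mkcond; apply: eq_integral => z _.
rewrite patchE indicE gpdfE// sqrtr1; case: ifPn => _; by rewrite ?mul1e ?mul0e.
Qed.

(* The defect in Jensen's inequality for the square root is controlled by the
   variance of [r ^+ 2]: [r (r - s)^2 (r + 2 s) >= 0]. *)
Lemma sqr_sub_le (r s : R) : 0 <= r -> 0 < s ->
  (r - s) ^+ 2 <= r ^+ 4 / s ^+ 2 - 2 * r ^+ 2 + s ^+ 2.
Proof.
move=> r0 s0; rewrite -subr_ge0.
have -> : r ^+ 4 / s ^+ 2 - 2 * r ^+ 2 + s ^+ 2 - (r - s) ^+ 2 =
    r * (r - s) ^+ 2 * (r + 2 * s) / s ^+ 2.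
  by field; rewrite gt_eqF.
have h : 0 <= r + 2 * s by rewrite addr_ge0// mulr_ge0// ltW.
by rewrite divr_ge0 ?sqr_ge0// (mulr_ge0 (mulr_ge0 r0 (sqr_ge0 _)) h).
Qed.

End gaussian_scale.

(** * Coupling a Gaussian scale mixture with a single Gaussian *)

Lemma measure_preimage_integral d d' (S : measurableType d) (S' : measurableType d')
    (R : realType) (Q : {measure set S -> \bar R}) (W : S -> S') (B : set S') :
  measurable_fun setT W -> measurable B ->
  (Q (W @^-1` B) = \int[Q]_z (\1_B (W z) : R)%:E)%E.
Proof.
move=> mW mB; have mWB : measurable (W @^-1` B) by rewrite -[_ @^-1` _]setTI; exact: mW.
by rewrite -[LHS]/(Q (W @^-1` B)) -[W @^-1` B]setIT -integral_indic.
Qed.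

Section gauss_coupling.
Context (R : realType) d (T : measurableType d) (P : probability T R).
Notation mu := (@lebesgue_measure R).
Local Notation RR := (measurableTypeR R).
Variables (V : T -> R) (v k e sigma : R) (phi : R -> R).
Hypotheses (hV : sym_moments P V v k phi) (gphi : gauss_mixture phi) (e0 : 0 < e)
  (sigma0 : 0 < sigma) (sigmaE : sigma ^+ 2 = v + e).

(** [U] is [V] plus noise of variance [e], and also [sqrt s * Z] with random variance [s]. Replacing
    [sqrt s] by [sigma] costs at most [Var s / sigma^2], and comparing the fourth moments of [U] on
    both sides gives [Var s = k / 3]. *)
Theorem gauss_coupling : exists (P' : probability (T * (RR * RR))%type R)
    (U Z : T * (RR * RR) -> R),
  measurable_fun setT U /\ measurable_fun setT Z /\
  (forall E, measurable E -> P' (fst @^-1` E) = P E) /\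
  (forall B, measurable B -> P' (Z @^-1` B) = normal_prob 0 1 B) /\
  (forall Y : T -> R, measurable_fun setT Y -> indep_fun P V Y ->
     indep_fun P' Z (Y \o fst)) /\
  (\int[P']_z ((U z - V z.1) ^+ 2)%:E = e%:E)%E /\
  (\int[P']_z ((U z - sigma * Z z) ^+ 2)%:E <= (k / (3 * sigma ^+ 2))%:E)%E.
Proof.
have mV := sm_meas hV; have [rho hrho] := gphi.
have smooth := gauss_smoothing mV e0 (sm_cos hV) (fun u => sm_sin u hV) hrho.
pose s (x : R) : R := e + `|x|.
have s0 x : 0 < s x by rewrite ltr_pwDl.
have ms : measurable_fun setT s by exact: measurable_funD.
have mgs : measurable_fun setT (fun z : R * R => gpdf (s z.1) z.2).
  apply: (measurableT_comp measurable_gpdf (g := fun z : R * R => (s z.1, z.2))).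
  apply: measurable_fun_pair; last exact: measurable_snd.
  exact: (measurableT_comp ms measurable_fst).
(* [f] is the density of [U]; [hr] writes it as a mixture over the variance, [hP] as a smoothing of
   the law of [V]. Its positivity allows the division in [al] and [be]. *)
pose f u := fine (\int[rho]_x (gpdf (s x) u)%:E)%E.
have hr u : has_mean rho (fun x => gpdf (s x) u) (f u).
  have mg : measurable_fun setT (fun x : R => gpdf (s x) u).
    exact: (measurableT_comp mgs (measurable_pair2 u)).
  have [i _] := has_mean_cst rho (Num.sqrt (2 * pi * e))^-1.
  have ig : rho.-integrable setT (EFin \o (fun x => gpdf (s x) u)).
    apply: (integrable_dom (T := RR) mg i) => x; rewrite ger0_norm ?gpdf_ge0//.
    by apply: gpdf_le => //; rewrite lerDl.
  by split => //; rewrite /f fineK//; exact: integrable_fin_num.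
have hP u : has_mean P (fun t => gpdf e (u - V t)) (f u).
  apply: ge0_has_mean => [|t|]; last by rewrite smooth; case: (hr u).
    apply: (measurableT_comp (measurable_gpdf2 e)).
    exact: measurable_funB.
  exact: gpdf_ge0.
have f0 u : 0 < f u by apply: has_mean_gt0 (hr u) => x; exact: gpdf_gt0.
have mf : measurable_fun setT f.
  apply/measurable_EFinP.
  rewrite (_ : EFin \o f = fubini_G rho (fun z : RR * R => (gpdf (s z.1) z.2)%:E)).
    apply: (measurable_fun_fubini_tonelli_G (m1 := rho)) => [|z].
      exact/measurable_EFinP.
    by rewrite lee_fin gpdf_ge0.
  by apply/funext => u; rewrite /fubini_G /=; case: (hr u) => _ ->.
have f1 : (\int[mu]_u (f u)%:E = 1)%E.
  transitivity (\int[mu]_u \int[rho]_x (gpdf (s x) u)%:E)%E.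
    by apply: eq_integral => u _; case: (hr u) => _ ->.
  rewrite -(fubini_tonelli (m1 := rho) (m2 := mu) (fun z : RR * R => (gpdf (s z.1) z.2)%:E))//=; last 2 first.
  - exact/measurable_EFinP.
  - by move=> z; rewrite lee_fin gpdf_ge0.
  under eq_integral do rewrite integral_gpdf//.
  by rewrite integral_cst// mul1e; exact: probability_setT.
pose L : probability RR R := mdensity (mu := mu) mf (fun u => ltW (f0 u)) f1.
have HL (h : R -> \bar R) (g : R -> R) : measurable_fun setT h -> (forall u, 0 <= h u)%E ->
    measurable_fun setT g -> (forall u, 0 <= g u) ->
    (\int[L]_u (h u * (g u / f u)%:E) = \int[mu]_u (h u * (g u)%:E))%E.
  move=> mh h0 mg g0; rewrite ge0_integral_mdensity//.
  - by apply: eq_integral => u _; rewrite -muleA -EFinM divfK// gt_eqF.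
  - apply: emeasurable_funM => //; apply/measurable_EFinP/measurable_funM => //.
    exact: measurable_funV.
  - by move=> u; rewrite mule_ge0// lee_fin divr_ge0// ltW.
(* Conditional densities of [U] relative to its law [L]: given the sample point, and given the
   mixing variable. *)
pose al t u := gpdf e (u - V t) / f u.
pose be (x : RR) (u : RR) : R := gpdf (s x) u / f u.
have mgV : measurable_fun setT (fun z : T * RR => gpdf e (z.2 - V z.1)).
  apply: (measurableT_comp (measurable_gpdf2 e) (g := fun z : T * RR => z.2 - V z.1)).
  apply: measurable_funB; first exact: measurable_snd.
  exact: (measurableT_comp mV measurable_fst).
have mal : measurable_fun setT (fun z : T * RR => al z.1 z.2).
  apply: measurable_funM => //.
  by apply: measurable_funV; exact: (measurableT_comp mf measurable_snd).
have mbe : measurable_fun setT (fun z : RR * RR => be z.1 z.2).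
  apply: measurable_funM => //.
  by apply: measurable_funV; exact: (measurableT_comp mf measurable_snd).
have al0 t u : 0 <= al t u by rewrite divr_ge0 ?gpdf_ge0// ltW.
have be0 x u : 0 <= be x u by rewrite divr_ge0 ?gpdf_ge0// ltW.
have alP u : (\int[P]_t (al t u)%:E = 1)%E.
  have := has_meanZ (f u)^-1 (hP u); rewrite mulVf ?gt_eqF// => -[_ <-].
  by apply: eq_integral => t _; rewrite mulrC.
have beQ u : (\int[rho]_x (be x u)%:E = 1)%E.
  have := has_meanZ (f u)^-1 (hr u); rewrite mulVf ?gt_eqF// => -[_ <-].
  by apply: eq_integral => t _; rewrite mulrC.
have beL x : (\int[L]_u (be x u)%:E = 1)%E.
  have := HL (cst 1%E) (gpdf (s x)).
  under eq_integral do rewrite mul1e.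
  move=> -> //; last 2 first.
  - exact: measurable_gpdf2.
  - by move=> u; exact: gpdf_ge0.
  by under eq_integral do rewrite mul1e; exact: integral_gpdf.
have [P' [G1 G2 G3]] := gluing mal mbe al0 be0 alP beQ beL.
(* Given the sample point [t], [U] is Gaussian with mean [V t] and variance [e]. *)
have G1' (h : T * RR -> \bar R) : measurable_fun setT h -> (forall w, 0 <= h w)%E ->
    (\int[P']_z h (z.1, z.2.1) =
     \int[P]_t \int[mu]_y (h (t, (V t + y)%R) * (gpdf e y)%:E))%E.
  move=> mh h0; rewrite G1//; apply: eq_integral => t _.
  have mht : measurable_fun setT (fun u => h (t, u)).
    exact: (measurableT_comp mh (measurable_pair1 t)).
  rewrite -(gpdf_shift e (V t) mht)//; apply: HL => //.
  - exact: (measurableT_comp mgV (measurable_pair1 t)).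
  - by move=> u; exact: gpdf_ge0.
(* Given the mixing variable [x], [U] is centred Gaussian with variance [s x]. *)
have G2' (h : RR * RR -> \bar R) : measurable_fun setT h -> (forall w, 0 <= h w)%E ->
    (\int[P']_z h z.2 = \int[rho]_x \int[mu]_u (h (u, x) * (gpdf (s x) u)%:E))%E.
  move=> mh h0; rewrite G2//; apply: eq_integral => x _; apply: HL => //.
  - exact: (measurableT_comp mh (measurable_pair2 x)).
  - exact: measurable_gpdf2.
  - by move=> u; exact: gpdf_ge0.
(* [U] over its conditional standard deviation: standard Normal for each fixed [x], hence also
   unconditionally. *)
pose zeta (w : RR * RR) : R := w.1 / Num.sqrt (s w.2).
have mzeta : measurable_fun setT zeta.
  apply: measurable_funM; first exact: measurable_fst.
  apply: measurable_funV; apply: (measurableT_comp (f := @Num.sqrt R)).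
    exact: (continuous_measurable_fun (@sqrt_continuous R)).
  exact: (measurableT_comp ms measurable_snd).
pose U (z : T * (RR * RR)) : R := z.2.1; pose Z (z : T * (RR * RR)) : R := zeta z.2.
have mU : measurable_fun setT U by exact: (measurableT_comp measurable_fst measurable_snd).
have mZ : measurable_fun setT Z by exact: (measurableT_comp mzeta measurable_snd).
have m1 d1 (S : measurableType d1) (B : set S) : measurable B ->
    measurable_fun setT (fun x => (\1_B x : R)%:E).
  by move=> mB; apply/measurable_EFinP; exact: measurable_indic.
have marg E : measurable E -> P' (fst @^-1` E) = P E.
  move=> mE; rewrite measure_preimage_integral//.
  rewrite (G1' (fun w => (\1_E w.1)%:E)); last 2 first.
  - by apply: (measurableT_comp (m1 _ _ _ mE)); exact: measurable_fst.
  - by move=> w; rewrite lee_fin.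
  transitivity (\int[P]_t (\1_E t : R)%:E)%E; last by rewrite integral_indic// setIT.
  apply: eq_integral => t _; rewrite /= ge0_integralZl ?lee_fin//; last 2 first.
  - by apply/measurable_EFinP; exact: measurable_gpdf2.
  - by move=> y _; rewrite lee_fin gpdf_ge0.
  by rewrite integral_gpdf// mule1.
have lawZ B : measurable B -> P' (Z @^-1` B) = normal_prob 0 1 B.
  move=> mB; rewrite measure_preimage_integral//.
  rewrite (G2' (fun w => (\1_B (zeta w))%:E)); last 2 first.
  - exact: (measurableT_comp (m1 _ _ _ mB) mzeta).
  - by move=> w; rewrite lee_fin.
  transitivity (\int[rho]_x normal_prob 0 1 B)%E; last first.
    rewrite integral_cst// -[RHS]mule1; congr *%E; exact: probability_setT.
  apply: eq_integral => x _; rewrite /zeta /=.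
  rewrite (ge0_integral_gpdf_scale (s0 x) (h := fun y => (\1_B y)%:E))//.
  - exact: normal_prob_gpdf.
  - exact: m1.
have indZ (Y : T -> R) : measurable_fun setT Y -> indep_fun P V Y ->
    indep_fun P' Z (Y \o fst).
  move=> mY VY B C mB mC.
  pose g t : \bar R := (\1_C (Y t))%:E; pose h (w : RR * RR) : \bar R := (\1_B (zeta w))%:E.
  have mg : measurable_fun setT g by exact: (measurableT_comp (m1 _ _ _ mC) mY).
  have mh : measurable_fun setT h by exact: (measurableT_comp (m1 _ _ _ mB) mzeta).
  have g0 t : (0 <= g t)%E by rewrite lee_fin.
  have h0 w : (0 <= h w)%E by rewrite lee_fin.
  (* [K (V t)] is the conditional probability of the event [Z] in [B] given the sample point; being
     a function of [V] alone, it decouples from [Y]. *)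
  pose K (v : R) : \bar R := (\int[prod_prob L rho]_w
    (h w * (be w.2 w.1 * (gpdf e (w.1 - v) / f w.1))%:E))%E.
  have K0 v' : (0 <= K v')%E.
    apply: integral_ge0 => w _; rewrite mule_ge0// lee_fin mulr_ge0//.
    by rewrite divr_ge0 ?gpdf_ge0// ltW.
  have mK : measurable_fun setT K.
    apply: (measurable_fun_fubini_tonelli_F (m2 := prod_prob L rho)
      (fun z : R * (RR * RR) => h z.2 * (be z.2.2 z.2.1 * (gpdf e (z.2.1 - z.1) / f z.2.1))%:E)%E) => [|z].
      have m21 : measurable_fun setT (fun z : R * (RR * RR) => z.2.1).
        exact: (measurableT_comp measurable_fst measurable_snd).
      apply: emeasurable_funM; first exact: (measurableT_comp mh measurable_snd).
      apply/measurable_EFinP; apply: measurable_funM.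
        apply: (measurableT_comp mbe (g := fun z : R * (RR * RR) => (z.2.2, z.2.1))).
        apply: measurable_fun_pair => //.
        exact: (measurableT_comp measurable_snd measurable_snd).
      apply: measurable_funM; last by apply: measurable_funV; exact: (measurableT_comp mf m21).
      apply: (measurableT_comp (measurable_gpdf2 e)).
      by apply: measurable_funB => //; exact: measurable_fst.
    rewrite mule_ge0// lee_fin mulr_ge0//.
    by rewrite divr_ge0 ?gpdf_ge0// ltW.
  have E3 : (\int[P]_t (g t * K (V t)) = (\int[P]_t g t) * \int[P]_t K (V t))%E.
    rewrite (ge0_integral_indep (X := V) (Y := Y) (P := P)
      (h := fun z : R * R => (\1_C z.2)%:E * K z.1)%E mV mY VY)//; last 2 first.
    - apply: emeasurable_funM; last exact: (measurableT_comp mK measurable_fst).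
      by apply: (measurableT_comp (m1 _ _ _ mC)); exact: measurable_snd.
    - by move=> z; rewrite mule_ge0// lee_fin.
    rewrite -ge0_integralZl//; last 2 first.
    - exact: (measurableT_comp mK mV).
    - exact: integral_ge0.
    by apply: eq_integral => t _; rewrite /= ge0_integralZr.
  have G3' : (\int[P']_z (g z.1 * h z.2) = \int[P]_t g t * \int[P']_z h z.2)%E.
    rewrite G3//; transitivity (\int[P]_t (g t * K (V t)))%E; first by [].
    rewrite E3; congr (_ * _)%E; apply/esym.
    have := G3 (cst 1%E) h; under eq_integral do rewrite mul1e.
    by move=> ->//; apply: eq_integral => t _; rewrite mul1e.
  transitivity (\int[P']_z (g z.1 * h z.2))%E.
    rewrite -[X in P' X = _]setIT -integral_indic//; last first.
      apply: measurableI; rewrite -[_ @^-1` _]setTI; first exact: mZ.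
      by apply: (measurableT_comp mY) => //; exact: measurable_fst.
    by apply: eq_integral => z _; rewrite indicI /= mulrC EFinM.
  rewrite G3' muleC (measure_preimage_integral _ mZ mB); congr (_ * _)%E.
  rewrite -(measure_preimage_integral P mY mC); apply/esym/(marg (Y @^-1` C)).
  by rewrite -[_ @^-1` _]setTI; exact: mY.
(* Even moments of [U], computed once from its variance and once from [V] plus noise. *)
have mom n (c : R -> R) : (0 < n)%N -> ~~ odd n ->
    (forall t x : R, 0 < t -> (\int[mu]_y ((0 + y) ^+ n * gpdf t y)%:E = (c t)%:E)%E) ->
    (\int[rho]_x (c (s x))%:E = \int[P]_t \int[mu]_y ((V t + y) ^+ n * gpdf e y)%:E)%E.
  move=> n0 en hc; have mn : measurable_fun setT (fun x : R => (x ^+ n)%:E).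
    by apply/measurable_EFinP; exact: measurable_funX.
  have := G2' (fun w => (w.1 ^+ n)%:E); have := G1' (fun w => (w.2 ^+ n)%:E).
  move=> -> //=; last 2 first.
  - exact: (measurableT_comp mn measurable_snd).
  - by move=> w; rewrite lee_fin exprn_even_ge0.
  move=> h; transitivity (\int[rho]_x \int[mu]_u ((u ^+ n)%:E * (gpdf (s x) u)%:E))%E.
    apply: eq_integral => x _; rewrite -hc//.
    by apply: eq_integral => y _; rewrite add0r EFinM.
  rewrite -h//; last 2 first.
  - exact: (measurableT_comp mn measurable_fst).
  - by move=> w; rewrite lee_fin exprn_even_ge0.
have S2 : has_mean rho s (sigma ^+ 2).
  apply: ge0_has_mean => // [x|]; first exact: ltW.
  rewrite (@mom 2%N id)// => [|t x t0]; last by rewrite gpdf_moment2// expr0n add0r.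
  have [_ <-] : has_mean P (fun t => V t ^+ 2 + e) (sigma ^+ 2).
    by rewrite sigmaE; exact: has_meanD (sm_2 hV) (has_mean_cst P e).
  by apply: eq_integral => t _; rewrite gpdf_moment2.
(* Gaussian noise leaves the fourth cumulant [k] unchanged and raises the variance to [sigma^2]. *)
have S4 : has_mean rho (fun x => 3 * s x ^+ 2) (k + 3 * sigma ^+ 4).
  apply: ge0_has_mean => // [|x|].
  - by apply: measurable_funM => //; exact: measurable_funX.
  - by rewrite mulr_ge0// sqr_ge0.
  rewrite (@mom 4%N (fun t => 3 * t ^+ 2))// => [|t x t0]; last first.
    by rewrite gpdf_moment4// !expr0n/= mulr0 mul0r !add0r.
  have [_ <-] : has_mean P (fun t => V t ^+ 4 + 6 * V t ^+ 2 * e + 3 * e ^+ 2) (k + 3 * sigma ^+ 4).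
    have := has_meanD (has_meanD (sm_4 hV) (has_meanZ (6 * e) (sm_2 hV)))
      (has_mean_cst P (3 * e ^+ 2)).
    apply: has_mean_ext => [t|]; first by ring.
    by rewrite (_ : sigma ^+ 4 = (sigma ^+ 2) ^+ 2); [rewrite sigmaE; ring|ring].
  by apply: eq_integral => t _; rewrite gpdf_moment4.
exists P', U, Z; do 5 (split; first by []); split.
  rewrite (G1' (fun w => ((w.2 - V w.1) ^+ 2)%:E)); last 2 first.
  - apply/measurable_EFinP/measurable_funX; apply: measurable_funB.
      exact: measurable_snd.
    exact: (measurableT_comp mV measurable_fst).
  - by move=> w; rewrite lee_fin sqr_ge0.
  transitivity (\int[P]_t e%:E)%E; last first.
    by rewrite integral_cst// -[RHS]mule1; congr *%E; exact: probability_setT.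
  apply: eq_integral => t _; have := gpdf_moment2 0 e0.
  rewrite expr0n/= add0r => <-; apply: eq_integral => y _.
  by rewrite /= addrAC subrr.
rewrite (G2' (fun w => ((w.1 - sigma * zeta w) ^+ 2)%:E)); last 2 first.
- apply/measurable_EFinP/measurable_funX; apply: measurable_funB.
    exact: measurable_fst.
  exact: measurable_funM.
- by move=> w; rewrite lee_fin sqr_ge0.
(* Given [x], [U - sigma Z] is [sqrt (s x) - sigma] times a standard Normal. *)
have E x : (\int[mu]_u (((u - sigma * (u / Num.sqrt (s x))) ^+ 2)%:E * (gpdf (s x) u)%:E)
    = ((Num.sqrt (s x) - sigma) ^+ 2)%:E)%E.
  have r0 : 0 < Num.sqrt (s x) by rewrite sqrtr_gt0.
  have := gpdf_moment2 0 (s0 x); rewrite expr0n/= add0r => h.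
  transitivity (((1 - sigma / Num.sqrt (s x)) ^+ 2)%:E * (s x)%:E)%E; last first.
    rewrite -EFinM; congr EFin; have := sqr_sqrtr (ltW (s0 x)).
    move: r0; move: (Num.sqrt (s x)) => r r0 <-.
    by field; rewrite gt_eqF.
  rewrite -h -ge0_integralZl ?lee_fin ?sqr_ge0//.
  - by apply: eq_integral => u _; rewrite add0r -!EFinM; congr EFin; ring.
  - apply/measurable_EFinP/measurable_funM; last exact: measurable_gpdf2.
    by apply: measurable_funX; exact: measurable_funD.
  - by move=> u _; rewrite lee_fin mulr_ge0 ?gpdf_ge0// sqr_ge0.
under eq_integral do rewrite E.
(* The mean of this majorant from [sqr_sub_le] is [E s^2 / sigma^2 - sigma^2], that is
   [Var s / sigma^2]. *)
have [i <-] : has_mean rho (fun x => s x ^+ 2 / sigma ^+ 2 - 2 * s x + sigma ^+ 2)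
    (k / (3 * sigma ^+ 2)).
  have := has_meanD (has_meanD (has_meanZ (3 * sigma ^+ 2)^-1 S4) (has_meanZ (-2) S2))
    (has_mean_cst rho (sigma ^+ 2)).
  by apply: has_mean_ext => [x|]; field; rewrite gt_eqF.
apply: ge0_le_integral => //.
- by move=> x _; rewrite lee_fin sqr_ge0.
- apply/measurable_EFinP/measurable_funX; apply: measurable_funB => //.
  apply: (measurableT_comp (f := @Num.sqrt R)) => //.
  exact: (continuous_measurable_fun (@sqrt_continuous R)).
- by case/integrableP : i.
- move=> x _; rewrite lee_fin; have := sqr_sub_le (sqrtr_ge0 (s x)) sigma0.
  by rewrite (_ : 4 = 2 * 2)%N// exprM sqr_sqrtr// ltW.
Qed.

End gauss_coupling.

(** * Transfer to an extension and the constants of the final estimate *)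

Lemma ge0_integral_extension d d' (T : measurableType d) (T' : measurableType d')
    (R : realType) (P : probability T R) (P' : probability T' R) (p : T' -> T)
    (g : T -> \bar R) : measurable_fun setT p ->
  (forall E, measurable E -> P' (p @^-1` E) = P E) ->
  measurable_fun setT g -> (forall t, 0 <= g t)%E ->
  (\int[P']_z g (p z) = \int[P]_t g t)%E.
Proof.
move=> mp pE mg g0; rewrite -(ge0_integral_pushp P' mp mg g0).
by apply: eq_measure_integral => A mA _; exact: pE.
Qed.

(** Cauchy-Schwarz with [1 / 12 + 1 / 12 + 5 / 6 = 1]: the two terms that can be made arbitrarily
    small carry the large factors, the third only [6 / 5]. *)
Lemma cauchy_three (R : realType) (x y z : R) :
  (x + y + z) ^+ 2 <= 12 * x ^+ 2 + 12 * y ^+ 2 + 6 / 5 * z ^+ 2.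
Proof.
rewrite -subr_ge0 (_ : _ - _ = 6 * (x - y) ^+ 2 + 5^-1 * (5 * (x + y) - z) ^+ 2).
  by rewrite addr_ge0// mulr_ge0 ?sqr_ge0// invr_ge0.
by field.
Qed.

Lemma qk1_le_pi {R : realType} : qk 1 <= 2 / 3 * pi ^+ 4 :> R.
Proof.
have := @qk1_le R; rewrite mk1E => /le_trans; apply.
by rewrite le_eqVlt; apply/orP; left; apply/eqP; field.
Qed.

(** * Normal approximation of the tail of the expansion *)

Section levy_coupling.
Context (R : realType) d (T : measurableType d) (P : probability T R) (h a : R) (N : nat)
  (X : T -> R) (Xnk : nat -> nat -> T -> R) (Pn : nat -> T -> nat).
Hypotheses (mX : measurable_fun setT X)
  (mXnk : forall n k, measurable_fun setT (Xnk n k))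
  (lawX : forall n k B, measurable B -> P (Xnk n k @^-1` B) = logistic_prob B)
  (mPn : forall n (U : set nat), measurable (Pn n @^-1` U))
  (lawP : forall n (U : set nat),
     P (Pn n @^-1` U) = poisson_prob (a ^+ 2 * 2 ^+ n / 2) 0 U)
  (ind : mutually_independent P (levents X Xnk Pn)).

Local Notation A := (levyA h X Xnk Pn).
Local Notation A_N := (levyA_N h X Xnk Pn).

Lemma measurable_levyA_N n : measurable_fun setT (A_N n).
Proof. by apply: measurable_funM => //; exact: (measurable_lev_partial mX mXnk mPn). Qed.

Lemma measurable_levyA : measurable_fun setT A.
Proof.
apply: measurable_funM => //; apply: measurable_fun_limn => n.
exact: (measurable_lev_partial mX mXnk mPn).
Qed.

Let q := h / (pi *+ 2).

Lemma levyA_N_split M t : A_N (N + M) t = A_N N t + q * row_range Xnk Pn N.+1 M t.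
Proof. by rewrite /levyA_N lev_partialE mulrDr. Qed.

(** The standard deviation and the error bound are left as parameters so that [a = 0] and [a > 0]
    reach the same form. *)
Definition normal_approx (sigma C : R) := exists (d' : measure_display)
  (T' : measurableType d') (P' : probability T' R) (p : T' -> T),
  measurable_fun setT p /\
  (forall E, measurable E -> P' (p @^-1` E) = P E) /\
  exists Z : T' -> R,
    measurable_fun setT Z /\
    (forall B, measurable B -> P' (Z @^-1` B) = normal_prob 0 1 B) /\
    (forall B C, measurable B -> measurable C ->
       P' (Z @^-1` B `&` (A_N N \o p) @^-1` C)
       = (P' (Z @^-1` B) * P' ((A_N N \o p) @^-1` C))%E) /\
    (\int[P']_t ((A (p t) - (A_N N (p t) + sigma * Z t)) ^+ 2)%:E <= C%:E)%E.

(** With [sigma = 0] the variable [Z] drops out of the error, so a product with an independent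
    standard Normal is extension enough. *)
Lemma normal_approx0 C :
  (\int[P]_t ((A t - A_N N t) ^+ 2)%:E <= C%:E)%E -> normal_approx 0 C.
Proof.
move=> AC; have mA := measurable_levyA_N N.
have mp : measurable_fun setT (fst : T * measurableTypeR R -> T) by exact: measurable_fst.
pose P' : probability (T * measurableTypeR R)%type R := (P \x normal_prob 0 1)%E.
have PE E : measurable E -> P' (fst @^-1` E) = P E.
  move=> mE; rewrite -[RHS]mule1 -(@probability_setT _ _ _ (@normal_prob R 0 1)).
  rewrite -product_measure1E//; congr (P' _).
  by apply/seteqP; split => [z|z []].
have ZE B : measurable B -> P' (snd @^-1` B) = normal_prob 0 1 B.
  move=> mB; rewrite -[RHS]mul1e -(probability_setT P).
  rewrite -product_measure1E//; congr (P' _).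
  by apply/seteqP; split => [z|z []].
exists _, _, P', fst; split => //; split => //; exists snd; split => //; split => //; split.
- move=> B C' mB mC; have mAC : measurable (A_N N @^-1` C').
    by rewrite -[_ @^-1` _]setTI; exact: mA.
  rewrite ZE// (PE (A_N N @^-1` C'))// muleC -product_measure1E//; congr (P' _).
  by apply/seteqP; split => [z [? ?]|z [? ?]].
- under eq_integral do rewrite mul0r addr0.
  rewrite (ge0_integral_extension (P := P) (p := fst) (g := fun t => ((A t - A_N N t) ^+ 2)%:E))//.
  + by apply/measurable_EFinP/measurable_funX/measurable_funB => //; exact: measurable_levyA.
  + by move=> t; rewrite lee_fin sqr_ge0.
Qed.

Hypotheses (h_gt0 : 0 < h) (a_gt0 : 0 < a).

(** The error is [(A - A_(N+M)) + (V - U) + (U - sigma Z)] with [V] the scaled block of levels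
    [N + 1] to [N + M]. The first two summands have second moment [e M], the third is bounded by
    [gauss_coupling]. *)
Lemma normal_approx_gt0 : normal_approx (a / Num.sqrt (3 * 2 ^+ N.+1) * (h / 2))
  (8 / 15 * (2 ^+ (2 * N + 2))^-1 * (h / 2) ^+ 2).
Proof.
set sigma := a / _ * _; set C := 8 / 15 * _ * _.
(* The variance of the levels beyond [N + M], used again as noise variance, so that [V] plus noise
   has variance exactly [sigma ^+ 2]. *)
pose e M : R := a ^+ 2 / (3 * 2 ^+ (N + M).+1) * (h / 2) ^+ 2.
have p0 := pi_gt0 R.
have z0 n : (0 : R) < 2 ^+ n by rewrite exprn_gt0.
have C0 : 0 < C by rewrite !mulr_gt0// ?invr_gt0// exprn_gt0 ?divr_gt0.
have e0 M : 0 < e M.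
  by rewrite mulr_gt0 ?exprn_gt0 ?divr_gt0// ?exprn_gt0// mulr_gt0.
(* [24] is the sum of the two factors [12] of [cauchy_three]; the remaining [6 / 7] of [C] is
   [6 / 5 * (5 / 7)]. *)
have [M eM] : exists M, 24 * e M <= C / 7.
  have ce : 24 * e M @[M --> \oo] --> 0.
    rewrite (_ : (fun M => _) = geometric (24 * (a ^+ 2 / (3 * 2 ^+ N.+1) * (h / 2) ^+ 2)) 2^-1).
      by apply: cvg_geometric; rewrite ger0_norm; lra.
    apply/funext => M; rewrite /e /geometric/= -addSn exprD exprVn.
    by field; rewrite !gt_eqF.
  have C7 : 0 < C / 7 by rewrite divr_gt0.
  have /cvgrPdist_lt/(_ _ C7)[M _ /(_ M (leqnn M))] := ce.
  by rewrite sub0r normrN => /ltW/(le_trans (ler_norm _)) ?; exists M.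
have sigma0 : 0 < sigma by rewrite !mulr_gt0// invr_gt0 sqrtr_gt0 mulr_gt0.
have sigma2 : sigma ^+ 2 = a ^+ 2 / (3 * 2 ^+ N.+1) * (h / 2) ^+ 2.
  by rewrite exprMn expr_div_n sqr_sqrtr// mulr_ge0// ltW.
pose V t := q * row_range Xnk Pn N.+1 M t.
have hV := sym_momentsZ q (sym_moments_range mX mXnk lawX mPn lawP ind N.+1 M).
have gV := gauss_mixtureZ q (gauss_mixture_range a mX mXnk lawX mPn ind N.+1 M).
have sigmaE : sigma ^+ 2 = q ^+ 2 * (a ^+ 2 * (pi ^+ 2 / 3) *
    ((2 ^+ N.+1)^-1 - (2 ^+ (N.+1 + M))^-1)) + e M.
  rewrite sigma2 /e /q -addSn; move: (z0 N.+1) (z0 (N.+1 + M)%N) p0.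
  move: (2 ^+ N.+1) (2 ^+ (N.+1 + M)) (@pi R) => x y p x0 y0 p0.
  by rewrite -mulr_natl; field; rewrite !gt_eqF.
have [P' [U [Z [mU [mZ [PE [ZE [indZ [UV UZ]]]]]]]]] := gauss_coupling hV gV (e0 M) sigma0 sigmaE.
have mV : measurable_fun setT V by case: hV.
have mA := measurable_levyA_N N.
exists _, _, P', fst; split => //; split => //; exists Z; split => //; split => //.
split.
  move=> B B' mB mB'; apply: (indZ (A_N N) mA) => //.
  have mM (c : R) : measurable_fun setT (fun x : R => c * x) by exact: measurable_funM.
  exact: (indep_fun_comp (mM q) (mM q) (indep_lev_partial mX mXnk mPn ind N M)).
(* With [qk 1 <= 2 / 3 * pi ^+ 4] the powers of [pi] and [a] cancel, leaving [4 / 7 * (2 / 3) = 8 /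
   21 = 5 / 7 * (8 / 15)] times [4^-(N+1) (h / 2)^2]. *)
have k_le : q ^+ 4 * (4 / 7 * a ^+ 2 * qk 1 * ((8 ^+ N.+1)^-1 - (8 ^+ (N.+1 + M))^-1))
    / (3 * sigma ^+ 2) <= 5 / 7 * C.
  have eN : (8 : R) ^+ N.+1 = (2 ^+ N.+1) ^+ 3.
    by rewrite -exprM mulnC exprM; congr (_ ^+ _); ring.
  have x8 n : (0 : R) < 8 ^+ n by rewrite exprn_gt0.
  apply: (@le_trans _ _ (q ^+ 4 * (4 / 7 * a ^+ 2 * (2 / 3 * pi ^+ 4) * (8 ^+ N.+1)^-1)
      / (3 * sigma ^+ 2))).
    apply: ler_wpM2r; first by rewrite invr_ge0 mulr_ge0 ?sqr_ge0.
    apply: ler_wpM2l; first by rewrite exprn_even_ge0.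
    have a4 : 0 <= 4 / 7 * a ^+ 2 by rewrite mulr_ge0 ?sqr_ge0.
    apply: ler_pM.
    - by rewrite mulr_ge0// qk_ge0.
    - rewrite subr_ge0 lef_pV2 ?posrE// ler_eXn2l ?leq_addr//; lra.
    - by rewrite ler_wpM2l// qk1_le_pi.
    - by rewrite gerBl invr_ge0 ltW.
  rewrite sigma2 /C /q eN (_ : 2 * N + 2 = N.+1 * 2)%N; last first.
    by rewrite mulnC mulSn addnC.
  rewrite exprM; move: (z0 N.+1) p0; move: (2 ^+ N.+1) (@pi R) => z p z1 p0.
  by rewrite -mulr_natl le_eqVlt; apply/orP; left; apply/eqP; field; rewrite !gt_eqF.
pose D z := A z - A_N (N + M) z.
have mD : measurable_fun setT D.
  by apply: measurable_funB; [exact: measurable_levyA|exact: measurable_levyA_N].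
have ED : (\int[P']_z (D z.1 ^+ 2)%:E = (e M)%:E)%E.
  rewrite (ge0_integral_extension (P := P) (g := fun t => (D t ^+ 2)%:E) measurable_fst PE).
  - exact: truncation_errorE.
  - exact/measurable_EFinP/measurable_funX.
  - by move=> t; rewrite lee_fin sqr_ge0.
have mDf : measurable_fun setT (fun z : T * (measurableTypeR R * measurableTypeR R) => D z.1).
  exact: (measurableT_comp mD measurable_fst).
have mUV : measurable_fun setT (fun z => U z - V z.1).
  by apply: measurable_funB => //; exact: (measurableT_comp mV measurable_fst).
have mUZ : measurable_fun setT (fun z => U z - sigma * Z z).
  by apply: measurable_funB => //; exact: measurable_funM.
have sq (W : T * (measurableTypeR R * measurableTypeR R) -> R) c : 0 <= c -> measurable_fun setT W ->
    (\int[P']_z (c * W z ^+ 2)%:E = c%:E * \int[P']_z (W z ^+ 2)%:E)%E.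
  move=> c0 mW; under eq_integral do rewrite EFinM.
  rewrite ge0_integralZl ?lee_fin//.
  - exact/measurable_EFinP/measurable_funX.
  - by move=> z _; rewrite lee_fin sqr_ge0.
have m2 c (W : T * (measurableTypeR R * measurableTypeR R) -> R) : measurable_fun setT W ->
    measurable_fun setT (fun z => (c * W z ^+ 2)%:E).
  by move=> mW; apply/measurable_EFinP/measurable_funM => //; exact: measurable_funX.
apply: (@le_trans _ _ (\int[P']_z ((12 * D z.1 ^+ 2)%:E + (12 * (U z - V z.1) ^+ 2)%:E
    + (6 / 5 * (U z - sigma * Z z) ^+ 2)%:E))%E).
  apply: ge0_le_integral => //.
  - by move=> z _; rewrite lee_fin sqr_ge0.
  - apply/measurable_EFinP/measurable_funX; apply: measurable_funB.
      by apply: (measurableT_comp measurable_levyA); exact: measurable_fst.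
    apply: measurable_funD; last exact: measurable_funM.
    by apply: (measurableT_comp mA); exact: measurable_fst.
  - by apply: emeasurable_funD; [apply: emeasurable_funD|]; exact: m2.
  - move=> z _; rewrite -!EFinD lee_fin.
    have := cauchy_three (D z.1) (V z.1 - U z) (U z - sigma * Z z).
    rewrite (_ : D z.1 + _ + _ = A z.1 - (A_N N z.1 + sigma * Z z)).
      by rewrite -(sqrrN (V z.1 - U z)) opprB.
    by rewrite /D levyA_N_split /V; ring.
rewrite ge0_integralD//; last 4 first.
- by move=> z _; rewrite adde_ge0// lee_fin mulr_ge0 ?sqr_ge0.
- by apply: emeasurable_funD; exact: m2.
- by move=> z _; rewrite lee_fin mulr_ge0 ?sqr_ge0.
- exact: m2.
rewrite ge0_integralD//; last 4 first.
- by move=> z _; rewrite lee_fin mulr_ge0 ?sqr_ge0.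
- exact: m2.
- by move=> z _; rewrite lee_fin mulr_ge0 ?sqr_ge0.
- exact: m2.
rewrite !sq// ED UV.
apply: (@le_trans _ _ (12%:E * (e M)%:E + 12%:E * (e M)%:E + (6 / 5)%:E * (5 / 7 * C)%:E)%E).
  apply: leeD2l; apply: lee_wpmul2l; first by rewrite lee_fin divr_ge0.
  by apply: le_trans UZ _; rewrite lee_fin.
rewrite -!EFinM -!EFinD lee_fin; lra.
Qed.

End levy_coupling.

Unset Implicit Arguments.
Theorem theorem2 (R : realType) (d : measure_display) (T : measurableType d)
  (P : probability T R) (h a : R) (N : nat)
  (X : T -> R) (Xnk : nat -> nat -> T -> R) (Pn : nat -> T -> nat) :
  0 < h -> 0 <= a ->
  (* X and the X_{n,k} are standard logistic random variables *)
  measurable_fun setT X ->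
  (forall B, measurable B -> P (X @^-1` B) = logistic_prob B) ->
  (forall n k, measurable_fun setT (Xnk n k)) ->
  (forall n k B, measurable B -> P (Xnk n k @^-1` B) = logistic_prob B) ->
  (* P_n ~ Poisson(a^2 2^n / 2) *)
  (forall n (U : set nat), measurable (Pn n @^-1` U)) ->
  (forall n (U : set nat),
     P (Pn n @^-1` U) = poisson_prob (a ^+ 2 * 2 ^+ n / 2) 0 U) ->
  (* all mutually independent *)
  mutually_independent P (levents X Xnk Pn) ->
  (\int[P]_t ((levyA h X Xnk Pn t - levyA_N h X Xnk Pn N t) ^+ 2)%:E
     = (a ^+ 2 / (3 * 2 ^+ N.+1) * (h / 2) ^+ 2)%:E)%E
  /\
  (let sigmaN := a / Num.sqrt (3 * 2 ^+ N.+1) * (h / 2) in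
   exists (d' : measure_display) (T' : measurableType d')
          (P' : probability T' R) (p : T' -> T),
     (* (T', P') is an extension of (T, P) via p *)
     measurable_fun setT p /\
     (forall E, measurable E -> P' (p @^-1` E) = P E) /\
     exists Z : T' -> R,
       measurable_fun setT Z /\
       (* Z is standard Normal *)
       (forall B, measurable B -> P' (Z @^-1` B) = normal_prob 0 1 B) /\
       (* Z is independent of A_N(h) *)
       (forall B C, measurable B -> measurable C ->
          P' (Z @^-1` B `&` (levyA_N h X Xnk Pn N \o p) @^-1` C)
          = (P' (Z @^-1` B) * P' ((levyA_N h X Xnk Pn N \o p) @^-1` C))%E) /\
       (\int[P']_t ((levyA h X Xnk Pn (p t)
                      - (levyA_N h X Xnk Pn N (p t) + sigmaN * Z t)) ^+ 2)%:E
          <= (8 / 15 * (2 ^+ (2 * N + 2))^-1 * (h / 2) ^+ 2)%:E)%E).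
Proof.
move=> h0 a0 mX _ mXnk lawX mPn lawP ind.
have trunc := truncation_errorE mX mXnk lawX mPn lawP ind h.
split; first exact: trunc.
(* For [a = 0] the standard deviation is [0], whereas [gauss_coupling] divides by [sigma]; the
   truncation error, which is then [0], settles this case. *)
have [a_eq0|a_neq0] := eqVneq a 0; last first.
  have a_gt0 : 0 < a by rewrite lt_neqAle eq_sym a_neq0.
  exact: (normal_approx_gt0 N mX mXnk lawX mPn lawP ind h0 a_gt0).
rewrite {1}a_eq0 !mul0r; apply: (normal_approx0 mX mXnk mPn).
rewrite trunc a_eq0 expr0n/= !mul0r lee_fin.
by rewrite mulr_ge0 ?sqr_ge0// mulr_ge0 ?invr_ge0 ?exprn_ge0// divr_ge0.
Qed.
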